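(* Let $n$ be a natural number and let $f_{n,\xi}$ be a rescaled elliptic polynomial with atom distribution $\xi$ being a real random variable of mean zero and variance one obeying the bound $\mathbf{E}|\xi|^{2+\varepsilon} \le C$ for some $C, \varepsilon > 0$. Then one has $$\mathbf{E} N_{\mathbb{R}} = \sqrt{n} + O(n^{1/2-c})$$ for some $c > 0$ depending only on $\varepsilon$, where the implied constant depends only on $C, \varepsilon$. More generally, one has $$\mathbf{E} N_I = \int_I \frac{1}{\pi}\frac{dx}{1+x^2/n} + O(n^{1/2-c})$$ for any interval $I \subset \mathbb{R}$.
   Context: The rescaled elliptic (binomial) polynomial with atom distribution $\xi$ is the random polynomial $f_{n,\xi}(z)=\sum_{i=0}^n \sqrt{\binom{n}{i} n^{-i}}\,\xi_i z^i$, where $\xi_0,\ldots,\xi_n$ are jointly independent copies of $\xi$. For $\Omega\subset\mathbb{C}$, $N_\Omega$ is the number of zeroes of $f_{n,\xi}$ in $\Omega$, counted with multiplicity; by convention, when $f_{n,\xi}$ vanishes identically it has no zeroes in $\mathbb{C}$ (all $n$ zeroes are at $\infty$), so $N_\Omega=0$. $X=O(Y)$ means $|X|\le K Y$ with $K$ the implied constant. *)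

(* Defs.v *)
From HB Require Import structures.
From mathcomp Require Export all_boot all_order all_algebra.
From mathcomp Require Export all_classical all_reals all_analysis.
From mathcomp.real_closed Require Export complex.

Set Implicit Arguments.
Unset Strict Implicit.
Unset Printing Implicit Defensive.

Import Order.TTheory GRing.Theory Num.Theory.
Local Open Scope classical_set_scope.
Local Open Scope ring_scope.

Definition elliptic_poly (R : realType) (n : nat) (a : 'I_n.+1 -> R) :
    {poly R} :=
  \sum_(i < n.+1) (Num.sqrt ('C(n, i)%:R * n%:R ^- i) * a i) *: 'X^i.

(* The zero polynomial has no zeros in C, by convention. The finitely supported
   sum is 0 on an infinite support, but for p != 0 the support is contained
   in the finite set of roots of p. *)
Definition zero_count (R : realType) (p : {poly R[i]}) (Omega : set R[i]) :
    nat :=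
  if p == 0 then 0%N else (\big[addn/0%N]_(z \in Omega) mup z p)%N.

Definition elliptic_zero_count (R : realType) (n : nat) (a : 'I_n.+1 -> R)
    (Omega : set R[i]) : nat :=
  zero_count (map_poly (real_complex R) (elliptic_poly a)) Omega.

Definition on_real_axis (R : realType) (A : set R) : set R[i] :=
  [set real_complex R x | x in A].

Definition jointly_independent (R : realType) (d : measure_display)
    (T : measurableType d) (P : probability T R) (J : finType)
    (X : J -> {RV P >-> R}) : Prop :=
  forall (K : {set J}) (B : J -> set R),
    (forall j, measurable (B j)) ->
    P (\bigcap_(j in [set` K]) (X j @^-1` B j)) =
      (\prod_(j in K) P (X j @^-1` B j))%E.

Definition independent_copies (R : realType) (d0 d : measure_display)
    (T0 : measurableType d0) (P0 : probability T0 R) (xi : {RV P0 >-> R})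
    (T : measurableType d) (P : probability T R) (J : finType)
    (X : J -> {RV P >-> R}) : Prop :=
  jointly_independent X /\
  forall (j : J) (B : set R), measurable B ->
    distribution P (X j) B = distribution P0 xi B.

(* Main.v *)
From HB Require Import structures.
Require Import Defs.
From mathcomp Require Import measurable_realfun.
From mathcomp Require Import ring lra zify.
Set Implicit Arguments.
Unset Strict Implicit.
Unset Printing Implicit Defensive.
Import Order.TTheory GRing.Theory Num.Theory.
Import numFieldNormedType.Exports.
Local Open Scope classical_set_scope.
Local Open Scope ring_scope.

(** Substitute [x = sqrt n * tan t]. Multiplied by [cos t ^+ n], the polynomial
    becomes the random linear form [circle_value], whose values at the angles
    [t] and [t'] have covariance [cos (t - t') ^+ n] ([circle_weight_dot]). All
    angles look alike, and in the coordinate [t] the claimed density of roots is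
    the constant [sqrt n / pi] ([root_density_window]). The proof cuts the
    circle into cells of width [be], where [cos be ^+ n = cos (pi / k)], and
    shows that a cell contains [1 / k] roots on average, up to a relative error
    that is a power of [1 / n]; since [sqrt n * be] is close to [pi / k]
    ([scaled_width_approx]), this is the claimed density.

    One root in a cell forces a sign change between its end points, and a sign
    change forces a root. The probability of a sign change is found without
    computing a Gaussian integral. At an angle away from the multiples of
    [pi / 2] all weights of the form are small, so the characteristic function
    of the two end values is close to that of a Gaussian pair with correlation
    [cos (pi / k)] ([Ex_cos_lincomb]). Two such values are consecutive values of
    a random sinusoid [X_0, X_1, .., X_k] with [X_k = - X_0]. Exactly one of its
    [k] consecutive pairs has a sign change, and all these pairs have nearly the
    same characteristic function; so each has probability close to [1 / k]
    ([wedge_probability]). Characteristic functions control signs because a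
    smooth version of the sign is a convex combination of cosines
    ([trig_mix_sgn_poly]), and because small values are rare ([small_ball]).

    Two roots in a cell make both end values small, by a Jensen-type inequality
    for polynomials with clustered real roots ([roots_imply_small]); this is
    much rarer than a single sign change ([both_small_prob]). More than a small
    power of [n] roots in a cell would make an end value so small that a direct
    argument excludes it: among the binomial weights there is a long lacunary
    chain ([lacunary_binomial_chain]), and a lacunary sum of independent
    variables that are not concentrated is tiny only with very small probability
    ([lacunary_small_ball]).

    Near the multiples of [pi / 2] one weight may dominate and the Gaussian
    comparison fails. These bands have angular width [n ^ (-1/2 + a)] for some
    [a < 1/2]; covering each by one disc and using the bound on clusters again
    shows that they contain a negligible number of roots ([window_upper]).
    Summing over the cells inside an interval gives the estimate with error
    [sqrt n / l] for a small power [l] of [n] ([interval_estimate]). *)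

(** * Expectations and independence *)

Section expectation.
Context (R : realType) (d : measure_display) (T : measurableType d).
Context (P : probability T R).

Definition summable_rv (f : T -> R) := P.-integrable setT (EFin \o f).
Definition Ex (f : T -> R) : R := \int[P]_w f w.
Definition Pr (A : set T) : R := fine (P A).

Lemma summable_cst c : summable_rv (fun=> c).
Proof. exact: finite_measure_integrable_cst. Qed.

Lemma summable_meas (f : T -> R) : summable_rv f -> measurable_fun setT f.
Proof. by move/measurable_int/measurable_EFinP. Qed.

Lemma summable_le (f g : T -> R) : measurable_fun setT f -> summable_rv g ->
  (forall w, `|f w| <= g w) -> summable_rv f.
Proof.
move=> mf ig fg; apply: (le_integrable measurableT _ _ ig).
  exact/measurable_EFinP.
move=> w _; rewrite lee_fin (le_trans (fg w))//; exact: ler_norm.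
Qed.

Lemma summable_bounded (f : T -> R) c : measurable_fun setT f ->
  (forall w, `|f w| <= c) -> summable_rv f.
Proof. by move=> mf; apply: summable_le => //; exact: summable_cst. Qed.

Lemma summableD (f g : T -> R) : summable_rv f -> summable_rv g ->
  summable_rv (fun w => f w + g w).
Proof. by move=> i1 i2; exact: (integrableD measurableT i1 i2). Qed.

Lemma summableZ c (f : T -> R) : summable_rv f -> summable_rv (fun w => c * f w).
Proof. by move=> i1; exact: (integrableZl measurableT c i1). Qed.

Lemma summable_sum I (s : seq I) (p : pred I) (f : I -> T -> R) :
  (forall i, p i -> summable_rv (f i)) ->
  summable_rv (fun w => \sum_(i <- s | p i) f i w).
Proof.
move=> h; have := @integrable_sum _ _ _ P _ measurableT _ s p
  (fun i => EFin \o f i) h.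
by apply: eq_integrable => // w _; rewrite /= sumEFin.
Qed.

Lemma ExD (f g : T -> R) : summable_rv f -> summable_rv g ->
  Ex (fun w => f w + g w) = Ex f + Ex g.
Proof. by move=> ? ?; exact: RintegralD. Qed.

Lemma ExZ c (f : T -> R) : summable_rv f -> Ex (fun w => c * f w) = c * Ex f.
Proof. by move=> ?; exact: RintegralZl. Qed.

Lemma Ex_cst c : Ex (fun=> c) = c.
Proof.
rewrite /Ex Rintegral_cst// -[RHS]mulr1; congr (_ * _).
have : fine (P [set: T]) = 1 by rewrite probability_setT.
exact: id.
Qed.

Lemma ExB (f g : T -> R) : summable_rv f -> summable_rv g ->
  Ex (fun w => f w - g w) = Ex f - Ex g.
Proof. by move=> ? ?; exact: RintegralB. Qed.

Lemma Ex_sum I (s : seq I) (p : pred I) (f : I -> T -> R) :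
  (forall i, p i -> summable_rv (f i)) ->
  Ex (fun w => \sum_(i <- s | p i) f i w) = \sum_(i <- s | p i) Ex (f i).
Proof.
move=> h; elim: s => [|i s IH].
  rewrite big_nil -[RHS](Ex_cst 0); apply: eq_Rintegral => w _.
  by rewrite big_nil.
rewrite big_cons; case: ifPn => pi.
  rewrite -IH -ExD ?h//; last exact: summable_sum.
  by apply: eq_Rintegral => w _; rewrite big_cons pi.
by rewrite -IH; apply: eq_Rintegral => w _; rewrite big_cons (negbTE pi).
Qed.

Lemma Ex_le (f g : T -> R) : summable_rv f -> summable_rv g -> (forall w, f w <= g w) ->
  Ex f <= Ex g.
Proof. by move=> ? ? ?; exact: le_Rintegral. Qed.

Lemma eq_Ex (f g : T -> R) : (forall w, f w = g w) -> Ex f = Ex g.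
Proof. by move=> h; apply: eq_Rintegral => w _; exact: h. Qed.


Lemma Ex_norm_le (f g : T -> R) : summable_rv f -> summable_rv g ->
  (forall w, `|f w| <= g w) -> `|Ex f| <= Ex g.
Proof.
move=> i1 i2 h; apply: (le_trans (le_normr_Rintegral measurableT i1)).
apply: Ex_le => //; apply: summable_le i2 _ => //.
  by apply: measurableT_comp => //; exact: summable_meas.
by move=> w; rewrite normr_id.
Qed.

Lemma Ex_norm_le_cst (f : T -> R) c : measurable_fun setT f ->
  (forall w, `|f w| <= c) -> `|Ex f| <= c.
Proof.
move=> mf h; rewrite -[leRHS]Ex_cst; apply: Ex_norm_le => //.
- exact: summable_bounded h.
- exact: summable_cst.
Qed.

Lemma summable_indic A : measurable A -> summable_rv \1_A.
Proof.
move=> mA; apply: (@summable_bounded _ 1); first exact: measurable_indic.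
by move=> w; rewrite indicE; case: (_ \in _); rewrite ?normr1 ?normr0.
Qed.

Lemma Ex_indic A : measurable A -> Ex \1_A = Pr A.
Proof.
by move=> mA; rewrite /Ex /Rintegral integral_indic// setIT.
Qed.

Lemma PrE A : measurable A -> P A = (Pr A)%:E.
Proof. by move=> mA; rewrite /Pr fineK// fin_num_measure. Qed.

Lemma Pr_ge0 A : 0 <= Pr A.
Proof. exact: fine_ge0. Qed.

Lemma Pr_le A B : measurable A -> measurable B -> A `<=` B -> Pr A <= Pr B.
Proof.
by move=> mA mB AB; rewrite -lee_fin -!PrE//; apply: le_measure; rewrite ?inE.
Qed.

Lemma Pr_le1 A : measurable A -> Pr A <= 1.
Proof. by move=> mA; rewrite -lee_fin -PrE//; exact: probability_le1. Qed.

Lemma Pr_setU A B : measurable A -> measurable B ->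
  Pr (A `|` B) <= Pr A + Pr B.
Proof.
move=> mA mB; rewrite -lee_fin EFinD -!PrE//; last exact: measurableU.
exact: measureU2.
Qed.

(** Markov's inequality in the form used for all tail bounds. *)
Lemma Pr_le_Ex A (f : T -> R) : measurable A -> summable_rv f -> (forall w, 0 <= f w) ->
  (forall w, A w -> 1 <= f w) -> Pr A <= Ex f.
Proof.
move=> mA If f0 Af; rewrite -Ex_indic//; apply: Ex_le => //.
  exact: summable_indic.
move=> w; rewrite indicE; case: (boolP (w \in A)) => [/set_mem/Af//|_].
exact: f0.
Qed.

Lemma measurable_norm_le (f : T -> R) r : measurable_fun setT f ->
  measurable [set w | `|f w| <= r].
Proof.
move=> mf; rewrite (_ : [set w | _] = (fun w => `|f w|) @^-1` `]-oo, r]).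
  have m : measurable_fun setT (fun w => `|f w|) by exact: measurableT_comp.
  by rewrite -[X in measurable X]setTI; exact: m.
by apply/seteqP; split => w /=; rewrite in_itv.
Qed.

End expectation.

Section independence.
Context (R : realType) (d : measure_display) (T : measurableType d).
Context (P : probability T R).

Definition indep2 (U V : T -> R) := forall A B : set R,
  measurable A -> measurable B ->
  P (U @^-1` A `&` V @^-1` B) = (P (U @^-1` A) * P (V @^-1` B))%E.

Lemma meas_lincomb (J : eqType) (s : seq J) (a : J -> R) (X : J -> T -> R) :
  (forall j, measurable_fun setT (X j)) ->
  measurable_fun setT (fun w => \sum_(j <- s) a j * X j w).
Proof. by move=> mX; apply: measurable_sum => j; exact: measurable_funM. Qed.

(** Sets that only involve coordinates other than [j] form a pi-system, so the
    product rule for rectangles extends to the sigma-algebra they generate;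
    linear combinations of these coordinates are measurable for it. *)
Lemma indep2_lincomb (J : finType) (X : J -> {RV P >-> R}) (s : seq J) (j : J)
    (a : J -> R) : jointly_independent X -> j \notin s ->
  indep2 (fun w => \sum_(i <- s) a i * X i w) (X j).
Proof.
move=> hX js A B mA mB.
pose G : set (set T) := [set E | exists (K : {set J}) (C : J -> set R),
  [/\ j \notin K, (forall i, measurable (C i)) &
   E = \bigcap_(i in [set` K]) (X i @^-1` C i)]].
have GT : G setT.
  exists finset.set0, (fun=> setT); split => //; first by rewrite inE.
  by apply/seteqP; split => // w _ i /=; rewrite inE.
have Gm : G `<=` @measurable _ T.
  move=> _ [K [C [_ mC ->]]]; apply: fin_bigcap_measurable => // i _.
  by rewrite -[X in measurable X]setTI; exact: measurable_funP.
have GI : setI_closed G.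
  move=> _ _ [K [C [jK mC ->]]] [K' [C' [jK' mC' ->]]].
  exists (K :|: K')%SET, (fun i => (if i \in K then C i else setT) `&`
                            (if i \in K' then C' i else setT)); split.
  - by rewrite inE negb_or jK jK'.
  - by move=> i; apply: measurableI; case: ifP.
  - apply/seteqP; split => [w [h h'] i /= _|w h].
      by split; [case: ifPn => // /h|case: ifPn => // /h'].
    split => i /= iK; have := h i; rewrite /= !inE iK ?orbT /=.
      by move=> /(_ isT)[].
    by move=> /(_ isT)[].
pose Vj := X j @^-1` B.
have mV : measurable Vj.
  by rewrite -[X in measurable X]setTI; exact: measurable_funP.
pose m1 := mrestr P mV.
pose m2 := mscale (NngNum (fine_ge0 (measure_ge0 P Vj))) P.
have m12 E : G E -> m1 E = m2 E.
  move=> [K [C [jK mC ->]]].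
  rewrite /m1 /m2 /mrestr /mscale /=.
  rewrite [X in (X * _)%E](_ : _ = P Vj); last by rewrite fineK// fin_num_measure.
  rewrite hX//.
  pose C' := fun i => if i == j then B else C i.
  have -> : \bigcap_(i in [set` K]) (X i @^-1` C i) `&` Vj =
      \bigcap_(i in [set` (j |: K)%SET]) (X i @^-1` C' i).
    apply/seteqP; split => [w [h hj] i /=|w h].
      rewrite /C' !inE; case: eqVneq => [->//|_ /=]; exact: h.
    split => [i /= iK|].
      have := h i; rewrite /= /C' !inE iK orbT => /(_ isT).
      by case: eqVneq => // ij; move: jK; rewrite -ij iK.
    by have := h j; rewrite /= /C' !inE eqxx => /(_ isT).
  rewrite hX; last by move=> i; rewrite /C'; case: ifP.
  rewrite big_setU1//= /C' eqxx; congr (_ * _)%E.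
  by apply: eq_bigr => i iK; case: eqVneq => // ij; move: jK; rewrite -ij iK.
have key E : <<s G >> E -> m1 E = m2 E.
  apply: (g_sigma_algebra_measure_unique G Gm (fun=> setT)) => //.
  - by rewrite bigcup_const//; exists 0%N.
  - move=> k; change (P (setT `&` Vj) < +oo)%E.
    by rewrite setTI (le_lt_trans (probability_le1 P mV))// ltry.
have mXG i : i \in s ->
    measurable_fun (setT : set (g_sigma_algebraType G)) (X i : T -> R).
  move=> is_ _ C mC; rewrite setTI; apply: sub_sigma_algebra.
  exists [set i]%SET, (fun=> C); split => //.
    by rewrite inE; apply: contraNneq js => ->.
  apply/seteqP; split => [w /= h k|w /=]; first by rewrite /= inE => /eqP ->.
  by apply; rewrite /= inE.
have mS : measurable_fun (setT : set (g_sigma_algebraType G))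
    ((fun w => \sum_(i <- s) a i * X i w) : T -> R).
  have -> : (fun w => \sum_(i <- s) a i * X i w) =
     (fun w => \sum_(i <- s) (if i \in s then a i * X i w else 0)).
    by apply/funext => w; apply: eq_big_seq => i ->.
  apply: (@measurable_sum _ (g_sigma_algebraType G)) => i.
  case: (boolP (i \in s)) => [/mXG h|_]; last exact: measurable_cst.
  exact: (@measurable_funM _ (g_sigma_algebraType G)).
have := key ((fun w => \sum_(i <- s) a i * X i w) @^-1` A).
have := mS measurableT A mA; rewrite setTI => h /(_ h).
rewrite /m1 /m2 /mrestr /mscale /= => ->.
rewrite muleC; congr (_ * _)%E; by rewrite fineK// fin_num_measure.
Qed.

End independence.

Lemma measurable_preimage d d' (T : measurableType d) (T' : measurableType d')
    (f : T -> T') (B : set T') :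
  measurable_fun setT f -> measurable B -> measurable (f @^-1` B).
Proof. by move=> mf mB; rewrite -[X in measurable X]setTI; exact: mf. Qed.

Section pair_independence.
Context (R : realType) (d : measure_display) (T : measurableType d).
Context (P : probability T R).

Definition mkRV (f : T -> R) (mf : measurable_fun setT f) : {RV P >-> R} :=
  HB.pack_for {mfun T >-> R} f (isMeasurableFun.Build _ _ _ _ f mf).

Lemma indep2_product (U V : {RV P >-> R}) (E : set (R * R)) :
  indep2 P U V -> measurable E ->
  P ((fun w => (U w, V w)) @^-1` E) =
  (distribution P U \x distribution P V)%E E.
Proof.
move=> hUV mE.
have mUV : measurable_fun setT (fun w => (U w, V w)).
  by apply/measurable_fun_pairP; split; exact: measurable_funP.
have := @product_measure_unique _ _ _ _ R (distribution P U) (distribution P V)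
  (distribution P (HB.pack_for {mfun T >-> (R * R)%type} (fun w => (U w, V w))
     (isMeasurableFun.Build _ _ _ _ _ mUV))) _ E mE.
move=> -> // A B mA mB; exact: (hUV A B mA mB).
Qed.

(** Conditioning on [U]: for each fixed value [u] the event on [V] has
    probability at most [c]. *)
Lemma indep2_peel (U V : T -> R) (B : set R) (E : set (R * R)) (c : R) :
  measurable_fun setT U -> measurable_fun setT V ->
  indep2 P U V -> measurable B -> measurable E ->
  (forall u, Pr P [set w | E (u, V w)] <= c) ->
  Pr P [set w | B (U w) /\ E (U w, V w)] <= Pr P (U @^-1` B) * c.
Proof.
move=> mU mV hUV mB mE hc.
pose U' := mkRV mU; pose V' := mkRV mV.
have mUV : measurable_fun setT (fun w => (U w, V w)).
  by apply/measurable_fun_pairP.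
have mUB : measurable (U @^-1` B).
  exact: (measurable_preimage mU).
have mEB : measurable ((B `*` setT) `&` E).
  by apply: measurableI => //; exact: measurableX.
have mW : measurable [set w | B (U w) /\ E (U w, V w)].
  rewrite (_ : [set w | _] = (fun w => (U w, V w)) @^-1` ((B `*` setT) `&` E)).
    exact: (measurable_preimage mUV).
  by apply/seteqP; split => w /= => [[? ?]|[[? _] ?]].
rewrite -lee_fin EFinM -!PrE//.
have -> : [set w | B (U w) /\ E (U w, V w)] =
    (fun w => (U' w, V' w)) @^-1` ((B `*` setT) `&` E).
  by apply/seteqP; split => w /= => [[? ?]|[[? _] ?]].
rewrite (@indep2_product U' V')// /product_measure1.
have c0 : 0 <= c by apply: le_trans (hc 0); exact: Pr_ge0.
apply: (@le_trans _ _ (\int[distribution P U']_u ((c * \1_B u)%:E))%E).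
  apply: ge0_le_integral => //.
  - exact: measurable_fun_xsection.
  - by apply/measurable_EFinP; apply: measurable_funM => //; exact: measurable_indic.
  move=> u _ /=; rewrite indicE.
  case: (boolP (u \in B)) => uB /=.
    rewrite mulr1.
    have mx : measurable (xsection ((B `*` setT) `&` E) u).
      exact: measurable_xsection.
    rewrite /distribution /pushforward PrE; last first.
      exact: (measurable_preimage mV).
    rewrite lee_fin; apply: le_trans (hc u).
    have mxE : measurable [set w | E (u, V w)].
      rewrite (_ : [set w | _] = V @^-1` xsection E u); last first.
        by apply/seteqP; split => w /=; rewrite /xsection /= inE.
      by apply: (measurable_preimage mV); exact: measurable_xsection.
    apply: Pr_le => //.
      exact: (measurable_preimage mV).
    by move=> w /=; rewrite /xsection /= inE /= => -[].
  rewrite mulr0 (_ : xsection _ _ = set0) ?measure0//.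
  apply/seteqP; split => v //=; rewrite /xsection /= inE /= => -[[Bu _] _].
  by move: uB; rewrite notin_setE.
under eq_integral do rewrite EFinM.
rewrite ge0_integralZl//; last first.
  by apply/measurable_EFinP; exact: measurable_indic.
by rewrite integral_indic// setIT muleC.
Qed.


Lemma dist_integrable (V : {RV P >-> R}) : summable_rv P V ->
  (distribution P V).-integrable setT (EFin \o id).
Proof.
move=> /integrableP[_ iV]; apply/integrableP; split.
  exact/measurable_EFinP.
rewrite ge0_integral_distribution//.
by apply: measurableT_comp => //; exact/measurable_EFinP.
Qed.

Lemma dist_integral (V : {RV P >-> R}) : summable_rv P V ->
  (\int[distribution P V]_v v%:E = (Ex P V)%:E)%E.
Proof.
move=> iV; rewrite (@integral_distribution _ _ _ _ _ _ V (fun v => v%:E))//.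
  by rewrite /Ex /Rintegral fineK//; exact: integrable_fin_num.
by apply/measurable_EFinP; exact: measurable_id.
Qed.

(** The joint law of an independent pair is the product of the two laws, so
    Fubini's theorem separates the factors. *)
Lemma indep2_ExM (U V : T -> R) :
  measurable_fun setT U -> measurable_fun setT V ->
  indep2 P U V -> summable_rv P U -> summable_rv P V ->
  summable_rv P (fun w => U w * V w) /\
  Ex P (fun w => U w * V w) = Ex P U * Ex P V.
Proof.
move=> mU mV hUV iU iV.
pose U' := mkRV mU; pose V' := mkRV mV.
have mp : measurable_fun setT (fun z : R * R => (z.1 * z.2)%:E).
  by apply/measurable_EFinP; apply: measurable_funM.
have mUV : measurable_fun setT (fun w => (U w, V w)).
  by apply/measurable_fun_pairP.
pose W := HB.pack_for {mfun T >-> (R * R)%type} (fun w => (U w, V w))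
     (isMeasurableFun.Build _ _ _ _ _ mUV).
have dE E : measurable E ->
    distribution P W E = (distribution P U' \x distribution P V')%E E.
  by move=> mE; exact: (@indep2_product U' V').
have iUV : (distribution P U' \x distribution P V')%E.-integrable setT
    (fun z : R * R => (z.1 * z.2)%:E).
  apply/integrable12ltyP => //=.
  have -> : (\int[distribution P U']_x \int[distribution P V']_y `|x * y|%:E =
     \int[distribution P U']_x (`|x|%:E * \int[distribution P V']_y `|y|%:E))%E.
    apply: eq_integral => x _; rewrite -ge0_integralZl//.
      by apply: eq_integral => y _; rewrite normrM EFinM.
    by apply/measurable_EFinP; exact: normr_measurable.
  have [_] := integrableP _ _ _ (@dist_integrable U' iU).
  have [_] := integrableP _ _ _ (@dist_integrable V' iV).
  move=> hV hU; rewrite ge0_integralZr//.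
  - apply: lte_mul_pinfty => //; first exact: integral_ge0.
    by rewrite ge0_fin_numE//; exact: integral_ge0.
  - by apply/measurable_EFinP; exact: normr_measurable.
  - exact: integral_ge0.
have EUV : (\int[distribution P W]_z (z.1 * z.2)%:E = (Ex P U * Ex P V)%:E)%E.
  rewrite (_ : (\int[distribution P W]_z (z.1 * z.2)%:E)%E =
    (\int[distribution P U' \x distribution P V']_z (z.1 * z.2)%:E)%E); last first.
    by apply: eq_measure_integral => E mE _; exact: dE.
  rewrite -integral12_prod_meas1//= /fubini_F /=.
  rewrite (_ : (\int[distribution P U']_x \int[distribution P V']_y (x * y)%:E)%E =
     (\int[distribution P U']_x ((Ex P V)%:E * x%:E))%E); last first.
    apply: eq_integral => x _.
    under eq_integral do rewrite EFinM.
    rewrite integralZl//; last exact: (@dist_integrable V').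
    by rewrite (@dist_integral V')// muleC.
  rewrite integralZl//; last exact: (@dist_integrable U').
  by rewrite (@dist_integral U')// -EFinM mulrC.
have sUV : summable_rv P (fun w => U w * V w).
  apply/integrableP; split.
    by apply/measurable_EFinP; apply: measurable_funM.
  have [_] := integrableP _ _ _ iUV; apply: le_lt_trans.
  rewrite (_ : (\int[distribution P U' \x distribution P V']_z `|(z.1 * z.2)%:E|)%E =
     (\int[distribution P W]_z `|(z.1 * z.2)%:E|)%E); last first.
    by apply: eq_measure_integral => E mE _; exact/esym/dE.
  rewrite ge0_integral_distribution//.
  by apply: measurableT_comp.
split => //.
rewrite /Ex /Rintegral -(@integral_distribution _ _ _ _ _ _ W
  (fun z => (z.1 * z.2)%:E))// EUV//.
Qed.

End pair_independence.

(** * Elementary inequalities *)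

Section elementary_inequalities.
Context (R : realType).
Implicit Types x y u : R.

(** Most inequalities of this section are an earlier one integrated from 0. *)
Lemma ge0_of_derive (f f' : R -> R) :
  (forall x, is_derive x 1 f (f' x)) -> f 0 = 0 ->
  (forall x, 0 <= x -> 0 <= f' x) -> forall x, 0 <= x -> 0 <= f x.
Proof.
move=> df f0 f'0 x x0; case: (eqVneq x 0) => [->|xn0]; first by rewrite f0.
have xgt : 0 < x by rewrite lt_neqAle eq_sym xn0.
have cf : {within `[0, x], continuous f}.
  by apply: derivable_within_continuous => y _; exact: ex_derive.
have [c] := MVT xgt (fun y _ => df y) cf.
rewrite in_itv /= => /andP[c0 _]; rewrite f0 !subr0 => ->.
by apply: mulr_ge0 => //; apply: f'0; exact: ltW.
Qed.

Lemma sin_le_id x : 0 <= x -> sin x <= x.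
Proof.
move=> x0; rewrite -subr_ge0.
apply: (@ge0_of_derive (fun x => x - sin x) (fun x => 1 - cos x)) => //.
by rewrite sin0 subr0.
Qed.

Lemma cos_ge_quad x : 1 - x ^+ 2 / 2 <= cos x.
Proof.
wlog x0 : x / 0 <= x.
  move=> h; case: (leP 0 x) => [|/ltW]; first exact: h.
  by rewrite -oppr_ge0 -[cos x]cosN -[x ^+ 2]sqrrN; exact: h.
rewrite -subr_ge0.
apply: (@ge0_of_derive (fun x => cos x - (1 - x ^+ 2 / 2)) (fun x => x - sin x)) => //.
- move=> y; apply: is_derive_eq; rewrite /GRing.scale /=; by field.
- by rewrite cos0 expr0n /= mul0r subr0 subrr.
- by move=> y y0; rewrite subr_ge0 sin_le_id.
Qed.

Lemma sin_ge_cubic x : 0 <= x -> x - x ^+ 3 / 6 <= sin x.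
Proof.
move=> x0; rewrite -subr_ge0.
apply: (@ge0_of_derive (fun x => sin x - (x - x ^+ 3 / 6))
   (fun x => cos x - (1 - x ^+ 2 / 2))) => //.
- move=> y; apply: is_derive_eq; rewrite /GRing.scale /=; by field.
- by rewrite sin0 expr0n /= mul0r !subr0.
- by move=> y y0; rewrite subr_ge0 cos_ge_quad.
Qed.

Lemma cos_le_quartic x : cos x <= 1 - x ^+ 2 / 2 + x ^+ 4 / 24.
Proof.
wlog x0 : x / 0 <= x.
  move=> h; case: (leP 0 x) => [|/ltW]; first exact: h.
  rewrite -oppr_ge0 -[cos x]cosN -[x ^+ 2]sqrrN => /h.
  by rewrite (_ : (- x) ^+ 4 = x ^+ 4)//; ring.
rewrite -subr_ge0.
apply: (@ge0_of_derive (fun x => 1 - x ^+ 2 / 2 + x ^+ 4 / 24 - cos x)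
   (fun x => sin x - (x - x ^+ 3 / 6))) => //.
- move=> y; apply: is_derive_eq; rewrite /GRing.scale /=; by field.
- by rewrite cos0 !expr0n /= !mul0r subr0 addr0 subrr.
- by move=> y y0; rewrite subr_ge0 sin_ge_cubic.
Qed.

Lemma sin_sub_le x : `|sin x - x| <= `|x| ^+ 3.
Proof.
wlog x0 : x / 0 <= x.
  move=> h; case: (leP 0 x) => [|/ltW]; first exact: h.
  rewrite -oppr_ge0 => /h; rewrite sinN.
  by rewrite (_ : - sin x - - x = - (sin x - x)) ?normrN//; ring.
rewrite [X in X ^+ 3]ger0_norm// ler_norml; apply/andP; split.
  have := sin_ge_cubic x0; have : 0 <= x ^+ 3 by exact: exprn_ge0.
  lra.
have := sin_le_id x0; have : 0 <= x ^+ 3 by exact: exprn_ge0.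
lra.
Qed.

Lemma expRN_le_quad u : 0 <= u -> expR (- u) <= 1 - u + u ^+ 2 / 2.
Proof.
move=> u0; rewrite -subr_ge0.
apply: (@ge0_of_derive (fun x => 1 - x + x ^+ 2 / 2 - expR (- x))
   (fun x => expR (- x) - (1 - x))) => //.
- move=> y; apply: is_derive_eq; rewrite /GRing.scale /=; by field.
- by rewrite oppr0 expR0 expr0n /= mul0r !addr0 subrr.
- by move=> y y0; rewrite subr_ge0; have := expR_ge1Dx (- y).
Qed.

End elementary_inequalities.

(** * Characteristic functions of linear combinations *)

Section characteristic_function.
Context (R : realType) (e : R) (e0 : 0 < e) (e1 : e <= 1).
Implicit Types x t : R.

Lemma powR2e_small x (n : nat) : `|x| <= 1 -> (2 < n)%N ->
  `|x| ^+ n <= `|x| `^ (2 + e).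
Proof.
move=> x1 n3; case: (eqVneq x 0) => [->|xn0].
  by rewrite normr0 expr0n gtn_eqF ?powR_ge0// (leq_trans _ n3).
rewrite -powR_mulrn//; apply: ger_powR; first by rewrite normr_gt0 xn0.
have : 3%:R <= n%:R :> R by rewrite ler_nat.
by have := e1; lra.
Qed.

Lemma powR2e_big x : 1 <= `|x| -> x ^+ 2 <= `|x| `^ (2 + e).
Proof.
move=> x1; rewrite -[x ^+ 2]real_normK ?num_real// -powR_mulrn//.
by apply: ler_powR => //; have := e0; lra.
Qed.

(** The remainder is of order [x ^ 4] near 0 and of order [x ^ 2] at infinity;
    the exponent [2 + e] lies in between and serves for both. *)
Lemma cos_taylor x : `|cos x - 1 + x ^+ 2 / 2| <= `|x| `^ (2 + e).
Proof.
have h1 := cos_ge_quad x; rewrite ger0_norm; last by lra.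
case: (leP `|x| 1) => x1.
  have := powR2e_small x1 (isT : (2 < 4)%N); have := cos_le_quartic x.
  rewrite (_ : `|x| ^+ 4 = x ^+ 4); last first.
    by rewrite -normrX ger0_norm// exprn_even_ge0.
  have : 0 <= x ^+ 4 by rewrite exprn_even_ge0.
  lra.
have := powR2e_big (ltW x1); have := cos_le1 x; have := sqr_ge0 x.
lra.
Qed.

Lemma sin_taylor x : `|sin x - x| <= 2 * `|x| `^ (2 + e).
Proof.
case: (leP `|x| 1) => x1.
  have := powR2e_small x1 (isT : (2 < 3)%N); have := sin_sub_le x.
  have := powR_ge0 `|x| (2 + e); lra.
have h := powR2e_big (ltW x1).
have h2 : `|x| <= x ^+ 2.
  by rewrite -[x ^+ 2]real_normK ?num_real// ler_eXnr// ltW.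
have := sin_max x; have := ler_normB (sin x) x; lra.
Qed.

Lemma gauss_taylor t : `|expR (- (t ^+ 2 / 2)) - 1 + t ^+ 2 / 2| <= `|t| `^ (2 + e).
Proof.
have u0 : 0 <= t ^+ 2 / 2 by rewrite divr_ge0// sqr_ge0.
have h1 := expR_ge1Dx (- (t ^+ 2 / 2)); rewrite ger0_norm; last by lra.
case: (leP `|t| 1) => t1.
  have := powR2e_small t1 (isT : (2 < 4)%N); have := expRN_le_quad u0.
  rewrite (_ : `|t| ^+ 4 = t ^+ 4); last first.
    by rewrite -normrX ger0_norm// exprn_even_ge0.
  have : 0 <= t ^+ 4 by rewrite exprn_even_ge0.
  rewrite (_ : (t ^+ 2 / 2) ^+ 2 / 2 = t ^+ 4 / 8); last by field.
  lra.
have := powR2e_big (ltW t1).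
have : expR (- (t ^+ 2 / 2)) <= 1 by rewrite expR_le1; lra.
lra.
Qed.

Context (d : measure_display) (T : measurableType d) (P : probability T R).

(** Mean and variance make the characteristic function agree to second order
    with the Gaussian one; the moment of order [2 + e] bounds the remainder. *)
Record normalized (C : R) (Y : T -> R) : Prop := Normalized {
  normalized_meas : measurable_fun setT Y;
  normalized_L1 : summable_rv P Y;
  normalized_L2 : summable_rv P (fun w => Y w ^+ 2);
  normalized_Le : summable_rv P (fun w => `|Y w| `^ (2 + e));
  normalized_mean : Ex P Y = 0;
  normalized_var : Ex P (fun w => Y w ^+ 2) = 1;
  normalized_mom : Ex P (fun w => `|Y w| `^ (2 + e)) <= C }.

Lemma measurable_cosT (f : T -> R) : measurable_fun setT f ->
  measurable_fun setT (fun w => cos (f w)).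
Proof.
move=> mf; apply: (@measurableT_comp _ _ _ _ _ _ cos) => //.
by apply: continuous_measurable_fun; exact: continuous_cos.
Qed.

Lemma measurable_sinT (f : T -> R) : measurable_fun setT f ->
  measurable_fun setT (fun w => sin (f w)).
Proof.
move=> mf; apply: (@measurableT_comp _ _ _ _ _ _ sin) => //.
by apply: continuous_measurable_fun; exact: continuous_sin.
Qed.

Lemma Ex_cos_normalized C Y t : normalized C Y ->
  `|Ex P (fun w => cos (t * Y w)) - expR (- (t ^+ 2 / 2))|
    <= (C + 1) * `|t| `^ (2 + e).
Proof.
case=> mY _ i2 ie _ v2 vC.
have mc : measurable_fun setT (fun w => cos (t * Y w)).
  by apply: measurable_cosT; exact: measurable_funM.
have ic : summable_rv P (fun w => cos (t * Y w)).
  by apply: summable_bounded mc _ => w; exact: cos_max.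
have i3 : summable_rv P (fun w => (t ^+ 2 / 2) * Y w ^+ 2) by exact: summableZ.
have i4 : summable_rv P (fun w => cos (t * Y w) + (- 1)).
  by apply: summableD => //; exact: summable_cst.
have E1 : Ex P (fun w => cos (t * Y w) + (- 1) + (t ^+ 2 / 2) * Y w ^+ 2) =
    Ex P (fun w => cos (t * Y w)) - 1 + t ^+ 2 / 2.
  by rewrite ExD// ExD// ?ExZ// ?Ex_cst ?v2 ?mulr1//; exact: summable_cst.
have E2 : `|Ex P (fun w => cos (t * Y w) + (- 1) + (t ^+ 2 / 2) * Y w ^+ 2)| <=
    `|t| `^ (2 + e) * C.
  apply: (@le_trans _ _ (Ex P (fun w => `|t| `^ (2 + e) * `|Y w| `^ (2 + e)))).
    apply: Ex_norm_le; [exact: summableD|exact: summableZ|move=> w].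
    rewrite -powRM// -normrM; apply: le_trans (cos_taylor (t * Y w)).
    by rewrite exprMn -[t ^+ 2 * _ / 2]mulrAC.
  by rewrite ExZ// ler_wpM2l// powR_ge0.
have := gauss_taylor t; move: E2; rewrite E1.
set A := Ex P _; set B := expR _; set p := `|t| `^ _; set q := t ^+ 2 / 2.
move=> h1 h2; rewrite (_ : A - B = (A - 1 + q) - (B - 1 + q)); last by ring.
by apply: (le_trans (ler_normB _ _)); rewrite mulrDl mul1r (mulrC C) lerD.
Qed.

Lemma Ex_sin_normalized C Y t : normalized C Y ->
  `|Ex P (fun w => sin (t * Y w))| <= 2 * C * `|t| `^ (2 + e).
Proof.
case=> mY i1 _ ie v1 _ vC.
have mc : measurable_fun setT (fun w => sin (t * Y w)).
  by apply: measurable_sinT; exact: measurable_funM.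
have ic : summable_rv P (fun w => sin (t * Y w)).
  by apply: summable_bounded mc _ => w; exact: sin_max.
have it : summable_rv P (fun w => t * Y w) by exact: summableZ.
have -> : Ex P (fun w => sin (t * Y w)) = Ex P (fun w => sin (t * Y w) - t * Y w).
  by rewrite ExB// ExZ// v1 mulr0 subr0.
apply: (@le_trans _ _ (Ex P (fun w => 2 * `|t| `^ (2 + e) * `|Y w| `^ (2 + e)))).
  apply: Ex_norm_le => [||w].
  - rewrite (_ : (fun w => _) = (fun w => sin (t * Y w) + (- t) * Y w)).
      by apply: summableD => //; exact: summableZ.
    by apply/funext => w; rewrite mulNr.
  - exact: summableZ.
  - by rewrite -mulrA -powRM// -normrM; exact: sin_taylor.
by rewrite ExZ// -!mulrA [C * _]mulrC !mulrA ler_wpM2l.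
Qed.

End characteristic_function.

Section family.
Context (R : realType) (e : R) (e0 : 0 < e) (e1 : e <= 1) (C : R).
Context (d : measure_display) (T : measurableType d) (P : probability T R).
Context (J : finType) (X : J -> {RV P >-> R}).
Hypotheses (hX : jointly_independent X) (nX : forall j, normalized e P C (X j)).

Lemma indep2_comp (f g : R -> R) (U V : T -> R) :
  measurable_fun setT f -> measurable_fun setT g -> indep2 P U V ->
  indep2 P (fun w => f (U w)) (fun w => g (V w)).
Proof.
move=> mf mg h A B mA mB.
exact: (h _ _ (measurable_preimage mf mA) (measurable_preimage mg mB)).
Qed.

(** The addition formulas for cos and sin let the variables be integrated one
    at a time without complex numbers. *)
Lemma Ex_cos_lincomb (s : seq J) (t : J -> R) (a : R) : uniq s ->
  `|Ex P (fun w => cos (a + \sum_(i <- s) t i * X i w)) -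
    cos a * expR (- \sum_(i <- s) t i ^+ 2 / 2)| <=
  (3 * C + 1) * \sum_(i <- s) `|t i| `^ (2 + e).
Proof.
elim: s a => [|j s IH] a.
  move=> _; rewrite !big_nil mulr0 oppr0 expR0 mulr1.
  rewrite (@eq_Ex _ _ _ P _ (fun=> cos a)) ?Ex_cst ?subrr ?normr0//.
  by move=> w; rewrite big_nil addr0.
rewrite /= => /andP[js us].
have mX i : measurable_fun setT (X i : T -> R) by exact: measurable_funP.
pose S w := \sum_(i <- s) t i * X i w.
have mS : measurable_fun setT S by exact: meas_lincomb.
have hS : indep2 P S (X j) by exact: indep2_lincomb.
have mcosR (b : R) : measurable_fun setT (fun u : R => cos (b + u)).
  by apply: measurable_cosT; exact: measurable_funD.
have msinR (b : R) : measurable_fun setT (fun u : R => sin (b + u)).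
  by apply: measurable_sinT; exact: measurable_funD.
have mcosM (b : R) : measurable_fun setT (fun u : R => cos (b * u)).
  by apply: measurable_cosT; exact: measurable_funM.
have msinM (b : R) : measurable_fun setT (fun u : R => sin (b * u)).
  by apply: measurable_sinT; exact: measurable_funM.
have bd (f : R -> R) (V : T -> R) : measurable_fun setT f ->
   measurable_fun setT V -> (forall u, `|f u| <= 1) ->
   summable_rv P (fun w => f (V w)).
  move=> mf mV f1; apply: (@summable_bounded _ _ _ _ _ 1) => //.
  exact: (measurableT_comp mf mV).
have i1 := bd _ _ (mcosR a) mS (fun u => cos_max _).
have i2 := bd _ _ (msinR a) mS (fun u => sin_max _).
have i3 := bd _ _ (mcosM (t j)) (mX j) (fun u => cos_max _).
have i4 := bd _ _ (msinM (t j)) (mX j) (fun u => sin_max _).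
have [i13 e13] := indep2_ExM (summable_meas i1) (summable_meas i3)
   (indep2_comp (mcosR a) (mcosM (t j)) hS) i1 i3.
have [i24 e24] := indep2_ExM (summable_meas i2) (summable_meas i4)
   (indep2_comp (msinR a) (msinM (t j)) hS) i2 i4.
have -> : Ex P (fun w => cos (a + \sum_(i <- j :: s) t i * X i w)) =
   Ex P (fun w => cos (a + S w)) * Ex P (fun w => cos (t j * X j w)) -
   Ex P (fun w => sin (a + S w)) * Ex P (fun w => sin (t j * X j w)).
  rewrite -e13 -e24 -ExB//; apply: eq_Ex => w.
  rewrite big_cons -/(S w) -cosD; congr cos; ring.
rewrite !big_cons opprD expRD.
have := Ex_cos_normalized e0 e1 (t j) (nX j).
have := Ex_sin_normalized e0 e1 (t j) (nX j).
have := IH a us; rewrite -/S.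
have : `|Ex P (fun w => cos (a + S w))| <= 1.
  by apply: Ex_norm_le_cst (summable_meas i1) _ => w; exact: cos_max.
have : `|Ex P (fun w => sin (a + S w))| <= 1.
  by apply: Ex_norm_le_cst (summable_meas i2) _ => w; exact: sin_max.
have g1 : expR (- (t j ^+ 2 / 2)) <= 1.
  by rewrite expR_le1 oppr_le0 divr_ge0// sqr_ge0.
have g0 := expR_ge0 (- (t j ^+ 2 / 2)).
move: g0 g1.
set c1 := Ex P _; set c2 := Ex P _; set c3 := Ex P _; set c4 := Ex P _.
set g := expR _; set G := expR _; set p := `|t j| `^ _; set q := \sum_(_ <- _) _.
move=> g0 g1 h1 h2 h3 h4 h5.
rewrite (_ : _ - _ = c2 * (c4 - g) - c1 * c3 + g * (c2 - cos a * G)); last by ring.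
apply: (@le_trans _ _ ((C + 1) * p + 2 * C * p + (3 * C + 1) * q)); last by lra.
apply: (le_trans (ler_normD _ _)); apply: lerD.
  apply: (le_trans (ler_normB _ _)); rewrite !normrM; apply: lerD.
    by apply: le_trans h5; rewrite ler_piMl.
  by apply: le_trans h4; rewrite ler_piMl.
rewrite normrM; apply: le_trans h3; rewrite ler_piMl//.
by rewrite ger0_norm.
Qed.

End family.

(** * Anticoncentration from lacunary coefficients *)

Section anticoncentration.
Context (R : realType) (d : measure_display) (T : measurableType d).
Context (P : probability T R).

(** A variable with unit variance whose square is uniformly integrable cannot
    put almost all its mass in one interval of length 1: its variance would come
    from a rare event. *)
Lemma normalized_spread (e C A q : R) (Y : T -> R) (y : R) :
  0 < e -> normalized e P C Y -> 0 < A -> C <= A `^ e / 8 ->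
  0 <= q -> q <= 1 / 4 -> q * A ^+ 2 <= 1 / 8 ->
  Pr P [set w | `|Y w - y| <= 1 / 2] <= 1 - q.
Proof.
move=> e0 [mY i1 i2 ie v1 v2 vC] A0 hA q0 q4 qA.
rewrite leNgt; apply/negP => hq.
pose U := [set w | `|Y w - y| <= 1 / 2].
have mU : measurable U.
  by apply: measurable_norm_le; exact: measurable_funB.
have iU := summable_indic P mU.
have pA : 0 < A `^ e by exact: powR_gt0.
pose k := 2 * A ^+ 2 + 2 * y ^+ 2.
have k0 : 0 <= k by rewrite /k; have := sqr_ge0 y; have := sqr_ge0 A; lra.
have pt w : (Y w) ^+ 2 + (- (2 * y)) * Y w <=
   (1 / 4 + k - y ^+ 2) + (- k) * \1_U w + 2 / A `^ e * `|Y w| `^ (2 + e).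
  have p0 : 0 <= 2 / A `^ e * `|Y w| `^ (2 + e).
    by rewrite mulr_ge0 ?powR_ge0// divr_ge0// ltW.
  rewrite indicE; case: (boolP (w \in U)) => [/set_mem|_] /=.
    rewrite /U /= => h.
    have : (Y w - y) ^+ 2 <= 1 / 4.
      rewrite -[_ ^+ 2]real_normK ?num_real//.
      have := normr_ge0 (Y w - y); nra.
    rewrite mulr1; lra.
  have : (Y w) ^+ 2 <= A ^+ 2 + `|Y w| `^ (2 + e) / A `^ e.
    have := normr_ge0 (Y w); case: (leP `|Y w| A) => YA Y0.
      apply: ler_wpDr; first by rewrite divr_ge0 ?powR_ge0.
      by rewrite -[_ ^+ 2]real_normK ?num_real// lerXn2r// ?nnegrE// ltW.
    apply: ler_wpDl; first exact: sqr_ge0.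
    have Yn : `|Y w| != 0 by rewrite gt_eqF// (lt_trans A0).
    rewrite powRD; last by rewrite Yn implybT.
    rewrite powR_mulrn// real_normK ?num_real// -mulrA ler_peMr ?sqr_ge0//.
    rewrite ler_pdivlMr// mul1r.
    by apply: ge0_ler_powR; rewrite ?nnegrE// ltW.
  have := sqr_ge0 (Y w + y); rewrite /k mulr0 mulrAC -mulrA.
  lra.
have il : summable_rv P (fun w => (Y w) ^+ 2 + (- (2 * y)) * Y w).
  by apply: summableD => //; exact: summableZ.
have ir1 : summable_rv P (fun w => (1 / 4 + k - y ^+ 2) + (- k) * \1_U w).
  by apply: summableD; [exact: summable_cst|exact: summableZ].
have ir2 : summable_rv P (fun w => 2 / A `^ e * `|Y w| `^ (2 + e)).
  exact: summableZ.
have := Ex_le il (summableD ir1 ir2) pt.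
have iZ1 : summable_rv P (fun w => - (2 * y) * Y w) by exact: summableZ.
have iZ2 : summable_rv P (fun w => - k * \1_U w) by exact: summableZ.
rewrite (ExD i2 iZ1) (ExD ir1 ir2) (ExD (summable_cst P _) iZ2) !ExZ// Ex_cst.
rewrite v1 v2 mulr0 addr0 Ex_indic//.
have : 2 / A `^ e * Ex P (fun w => `|Y w| `^ (2 + e)) <= 1 / 4.
  apply: (@le_trans _ _ (2 / A `^ e * (A `^ e / 8))).
    by rewrite ler_wpM2l ?(le_trans vC)// divr_ge0// ltW.
  by rewrite le_eqVlt; apply/orP; left; apply/eqP; field; rewrite gt_eqF.
set p := Pr P U in hq *.
have hk : k * (1 - p) <= k * q by rewrite ler_wpM2l// lerBlDl -lerBlDr ltW.
have : k * q = 2 * (q * A ^+ 2) + 2 * (q * y ^+ 2) by rewrite /k; ring.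
have : q * y ^+ 2 <= 1 / 4 * y ^+ 2 by rewrite ler_wpM2r// sqr_ge0.
have := sqr_ge0 y.
lra.
Qed.

Lemma Pr_gt_le (Y : T -> R) (M : R) : measurable_fun setT Y -> 0 < M ->
  summable_rv P (fun w => Y w ^+ 2) ->
  Pr P [set w | M < `|Y w|] <= Ex P (fun w => Y w ^+ 2) / M ^+ 2.
Proof.
move=> mY M0 i2; have M2 : 0 < M ^+ 2 by rewrite exprn_gt0.
rewrite mulrC -ExZ//; apply: Pr_le_Ex => [||w|w /= h].
- rewrite (_ : [set w | _] = ~` [set w | `|Y w| <= M]).
    by apply: measurableC; exact: measurable_norm_le.
  by apply/seteqP; split => w /=; rewrite ltNge => /negP.
- exact: summableZ.
- by rewrite mulr_ge0 ?invr_ge0 ?sqr_ge0.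
rewrite mulrC ler_pdivlMr// mul1r -[leRHS]real_normK ?num_real//.
by rewrite lerXn2r ?nnegrE ?ltW// (lt_trans M0).
Qed.

Context (J : finType).

Lemma jointly_independent_comp (X Y : J -> {RV P >-> R}) (f : R -> R) :
  measurable_fun setT f -> (forall j w, Y j w = f (X j w)) ->
  jointly_independent X -> jointly_independent Y.
Proof.
move=> mf hY hX K B mB.
have E j : Y j @^-1` B j = X j @^-1` (f @^-1` B j).
  by apply/seteqP; split => w /=; rewrite hY.
under eq_bigcapr do rewrite E.
rewrite hX; first by apply: eq_bigr => j _; rewrite E.
by move=> j; exact: measurable_preimage.
Qed.

Lemma indep2_sym (U V : T -> R) : indep2 P U V -> indep2 P V U.
Proof. by move=> h A B mA mB; rewrite setIC h// muleC. Qed.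

Section lacunary.
Context (Y : J -> {RV P >-> R}) (a : J -> R) (M c r : R).
Hypotheses (hY : jointly_independent Y) (c0 : 0 <= c) (r0 : 0 < r).
Hypothesis M0 : 0 <= M.
Hypothesis Yc : forall j y, Pr P [set w | `|Y j w - y| <= 1 / 2] <= c.
Hypothesis YM : forall j w, `|Y j w| <= M.

Fixpoint lacunary (L : seq J) : bool :=
  if L is j :: L' then
    (r + M * \sum_(i <- L') `|a i| <= `|a j| / 2) && lacunary L'
  else true.

Lemma measurable_affine_ball (y b : R) :
  measurable [set z : R * R | `|y + b * z.1 + z.2| <= r].
Proof.
have m : measurable_fun setT (fun z : R * R => `|y + b * z.1 + z.2|).
  apply: measurableT_comp => //; apply: measurable_funD => //.
  apply: measurable_funD => //; exact: measurable_funM.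
rewrite (_ : [set z | _] = (fun z : R * R => `|y + b * z.1 + z.2|) @^-1` `]-oo, r]).
  exact: (measurable_preimage m).
by apply/seteqP; split => w /=; rewrite in_itv.
Qed.

Let mS s : measurable_fun setT (fun w => \sum_(i <- s) a i * Y i w).
Proof. by apply: meas_lincomb => j; exact: measurable_funP. Qed.

(** [Y j] is independent of the rest of the sum, so it can be frozen. *)
Lemma peel_step (L : seq J) (j : J) (B : set R) (y c' : R) :
  measurable B -> j \notin L ->
  (forall w, `|y + \sum_(i <- j :: L) a i * Y i w| <= r -> B (Y j w)) ->
  (forall z, Pr P [set w | `|z + \sum_(i <- L) a i * Y i w| <= r] <= c') ->
  Pr P [set w | `|y + \sum_(i <- j :: L) a i * Y i w| <= r] <=
    Pr P (Y j @^-1` B) * c'.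
Proof.
move=> mB jL hB hc.
pose E := [set z : R * R | `|y + a j * z.1 + z.2| <= r].
apply: (@le_trans _ _ (Pr P [set w | B (Y j w) /\ E (Y j w, \sum_(i <- L) a i * Y i w)])).
  rewrite le_eqVlt; apply/orP; left; apply/eqP; congr (Pr P).
  apply/seteqP; split => w /=; rewrite big_cons addrA /E /=; last by case.
  by move=> h; split => //; apply: hB; rewrite big_cons addrA.
apply: (indep2_peel (measurable_funP (Y j)) (mS L)) => //.
- by apply: indep2_sym; exact: indep2_lincomb.
- exact: measurable_affine_ball.
- by move=> u; rewrite /E /=; exact: hc.
Qed.

(** Each lacunary coefficient dominates the later ones, so a small value of the
    sum forces its variable into an interval of length 1, whatever the previous
    variables are; the later variables stay free. *)
Lemma lacunary_small_ball (L : seq J) (y : R) : uniq L -> lacunary L ->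
  Pr P [set w | `|y + \sum_(i <- L) a i * Y i w| <= r] <= c ^+ size L.
Proof.
elim: L y => [|j L IH] y /=.
  move=> _ _; rewrite expr0; apply: Pr_le1.
  by apply: measurable_norm_le; apply: measurable_funD => //; exact: mS.
move=> /andP[jL uL] /andP[haj hL].
have aj0 : 0 < `|a j|.
  have : 0 <= M * \sum_(i <- L) `|a i|.
    by apply: mulr_ge0 => //; exact: sumr_ge0.
  move: haj; set S := M * _ => h1 h2.
  have : 0 < `|a j| / 2 by apply: lt_le_trans h1; rewrite ltr_pwDl.
  by rewrite pmulr_lgt0.
have mB : measurable [set u : R | `|u - (- y / a j)| <= 1 / 2].
  by apply: measurable_norm_le; exact: measurable_funB.
rewrite exprS; apply: (le_trans (peel_step mB jL _ (fun z => IH z uL hL))).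
  move=> w h /=.
  have hS : `|\sum_(i <- L) a i * Y i w| <= M * \sum_(i <- L) `|a i|.
    apply: (le_trans (ler_norm_sum _ _ _)); rewrite mulr_sumr.
    by apply: ler_sum => i _; rewrite normrM mulrC ler_wpM2r.
  have h2 : `|y + a j * Y j w| <= `|a j| / 2.
    apply: le_trans haj; move: h; rewrite big_cons addrA => h.
    rewrite (_ : y + _ = y + a j * Y j w + \sum_(i <- L) a i * Y i w -
       \sum_(i <- L) a i * Y i w); last by ring.
    by apply: (le_trans (ler_normB _ _)); exact: lerD.
  rewrite -(ler_pM2l aj0) -normrM.
  rewrite (_ : a j * _ = y + a j * Y j w); first by lra.
  by field; rewrite -normr_gt0.
by rewrite ler_wpM2r ?exprn_ge0// Yc.
Qed.

Lemma lacunary_small_ball_cat (K L : seq J) (y : R) : uniq (K ++ L) ->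
  lacunary L ->
  Pr P [set w | `|y + \sum_(i <- K ++ L) a i * Y i w| <= r] <= c ^+ size L.
Proof.
elim: K y => [|j K IH] y; first exact: lacunary_small_ball.
rewrite cat_cons => /= /andP[jL uL] hL.
apply: (le_trans (peel_step measurableT jL _ (fun z => IH z uL hL))) => //.
by rewrite ler_piMl ?exprn_ge0// Pr_le1// preimage_setT.
Qed.

End lacunary.
End anticoncentration.

Section linear_combinations.
Context (R : realType) (e C : R).
Context (d : measure_display) (T : measurableType d) (P : probability T R).
Context (J : finType) (X : J -> {RV P >-> R}).
Hypotheses (hX : jointly_independent X) (nX : forall j, normalized e P C (X j)).

Definition lincomb (a : J -> R) (w : T) : R := \sum_j a j * X j w.

Lemma measurable_lincomb a : measurable_fun setT (lincomb a).
Proof. by apply: meas_lincomb => j; exact: measurable_funP. Qed.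

Lemma second_moment_seq (s : seq J) (a : J -> R) : uniq s ->
  let S w := \sum_(i <- s) a i * X i w in
  [/\ summable_rv P S, Ex P S = 0, summable_rv P (fun w => S w ^+ 2) &
      Ex P (fun w => S w ^+ 2) = \sum_(i <- s) a i ^+ 2].
Proof.
elim: s => [|j s IH] /=.
  move=> _; rewrite big_nil.
  rewrite (_ : (fun w : T => \sum_(i <- [::]) a i * X i w) = fun=> 0); last first.
    by apply/funext => w; rewrite big_nil.
  rewrite (_ : (fun w : T => (\sum_(i <- [::]) a i * X i w) ^+ 2) = fun=> 0); last first.
    by apply/funext => w; rewrite big_nil expr0n.
  by split; rewrite ?Ex_cst//; exact: summable_cst.
move=> /andP[js us]; have [i1 E1 i2 E2] := IH us.
set S := fun w => \sum_(i <- s) a i * X i w in i1 E1 i2 E2 *.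
have mX : measurable_fun setT (X j : T -> R) by exact: measurable_funP.
have hS : indep2 P S (X j) by exact: indep2_lincomb.
have [_ iX iX2 _ v1 v2 _] := nX j.
have [iSX ESX] := indep2_ExM (summable_meas i1) mX hS i1 iX.
rewrite (_ : (fun w : T => \sum_(i <- j :: s) a i * X i w) =
   fun w => a j * X j w + S w); last by apply/funext => w; rewrite big_cons.
rewrite (_ : (fun w : T => (\sum_(i <- j :: s) a i * X i w) ^+ 2) =
   fun w => a j ^+ 2 * X j w ^+ 2 + (2 * a j) * (S w * X j w) + S w ^+ 2); last first.
  by apply/funext => w; rewrite big_cons -/(S w); ring.
have j1 : summable_rv P (fun w => a j * X j w) by exact: summableZ.
have j2 : summable_rv P (fun w => a j ^+ 2 * X j w ^+ 2) by exact: summableZ.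
have j3 : summable_rv P (fun w => 2 * a j * (S w * X j w)) by exact: summableZ.
split.
- exact: summableD.
- by rewrite ExD// ExZ// v1 E1 mulr0 addr0.
- by apply: summableD => //; exact: summableD.
rewrite ExD//; last exact: summableD.
rewrite (ExD j2 j3) !ExZ// ESX E1 E2 v2 mul0r mulr0 addr0 mulr1.
by rewrite big_cons.
Qed.

Lemma lincomb_second_moment a :
  summable_rv P (fun w => lincomb a w ^+ 2) /\
  Ex P (fun w => lincomb a w ^+ 2) = \sum_j a j ^+ 2.
Proof.
have [_ _ h1 h2] := @second_moment_seq (index_enum J) a (index_enum_uniq J).
by split.
Qed.

Lemma Pr_lincomb_gt a M : 0 < M ->
  Pr P [set w | M < `|lincomb a w|] <= (\sum_j a j ^+ 2) / M ^+ 2.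
Proof.
move=> M0; have [i2 <-] := lincomb_second_moment a.
by apply: Pr_gt_le => //; exact: measurable_lincomb.
Qed.

Definition truncate (M x : R) : R := if `|x| <= M then x else 0.

Lemma measurable_truncate M : measurable_fun setT (truncate M).
Proof.
apply: measurable_fun_ifT => //.
by apply: measurable_fun_ler => //; exact: measurableT_comp.
Qed.

Lemma measurable_gt_norm (f : T -> R) M : measurable_fun setT f ->
  measurable [set w | M < `|f w|].
Proof.
move=> mf; rewrite (_ : [set w | _] = ~` [set w | `|f w| <= M]).
  by apply: measurableC; exact: measurable_norm_le.
by apply/seteqP; split => w /=; rewrite ltNge => /negP.
Qed.

Lemma Pr_exists_gt (s : seq J) M : 0 < M ->
  measurable [set w | has (fun j => M < `|X j w|) s] /\
  Pr P [set w | has (fun j => M < `|X j w|) s] <= (size s)%:R / M ^+ 2.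
Proof.
move=> M0; elim: s => [|j s [m IH]] /=.
  rewrite (_ : [set w | _] = set0); last by apply/seteqP; split.
  by split; rewrite // mul0r /Pr measure0.
have mj : measurable [set w | M < `|X j w|].
  by apply: measurable_gt_norm; exact: measurable_funP.
rewrite (_ : [set w | _] = [set w | M < `|X j w|] `|`
   [set w | has (fun j => M < `|X j w|) s]); last first.
  by apply/seteqP; split => w /= /orP.
split; first exact: measurableU.
apply: (le_trans (Pr_setU P mj m)).
rewrite -add1n natrD mulrDl lerD//.
have [mY _ i2 _ _ v2 _] := nX j.
by rewrite -v2; exact: Pr_gt_le.
Qed.

(** Lacunarity only beats bounded variables, hence the truncation at [M]. The
    coefficients outside the chain [L] are frozen and merely shift the sum. *)
Lemma lincomb_small_ball (a : J -> R) (K L : seq J) (M q r : R) :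
  perm_eq (K ++ L) (index_enum J) ->
  (forall j y, Pr P [set w | `|X j w - y| <= 1 / 2] <= 1 - q) -> q <= 1 ->
  0 < M -> 1 / M ^+ 2 <= q / 2 -> 0 < r -> lacunary a M r L ->
  Pr P [set w | `|lincomb a w| <= r] <= (1 - q / 2) ^+ size L + #|J|%:R / M ^+ 2.
Proof.
move=> pKL hq q1 M0 Mq r0 hL.
have mY j : measurable_fun setT (fun w => truncate M (X j w)).
  exact: (measurableT_comp (measurable_truncate M)).
pose Y j := mkRV P (mY j).
have hY : jointly_independent Y.
  by apply: (jointly_independent_comp (measurable_truncate M) _ hX).
have tM x : `|truncate M x| <= M.
  by rewrite /truncate; case: ifP => // _; rewrite normr0 ltW.
have q20 : 0 <= 1 - q / 2 by lra.
have mgt j : measurable [set w | M < `|X j w|].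
  by apply: measurable_gt_norm; exact: measurable_funP.
have hYq j y : Pr P [set w | `|Y j w - y| <= 1 / 2] <= 1 - q / 2.
  have mb : measurable [set w | `|X j w - y| <= 1 / 2].
    by apply: measurable_norm_le; apply: measurable_funB => //; exact: measurable_funP.
  apply: (@le_trans _ _ (Pr P ([set w | `|X j w - y| <= 1 / 2] `|` [set w | M < `|X j w|]))).
    apply: Pr_le.
    - by apply: measurable_norm_le; apply: measurable_funB.
    - exact: measurableU.
    move=> w /=; rewrite /truncate; case: leP => h; first by left.
    by right.
  apply: (le_trans (Pr_setU P mb (mgt j))).
  have [mX _ i2 _ _ v2 _] := nX j.
  have := Pr_gt_le mX M0 i2; rewrite v2.
  have := hq j y; lra.
have uKL : uniq (K ++ L) by rewrite (perm_uniq pKL) index_enum_uniq.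
have [mE PE] := Pr_exists_gt (index_enum J) M0.
have mS : measurable [set w | `|0 + \sum_(i <- K ++ L) a i * Y i w| <= r].
  apply: measurable_norm_le; apply: measurable_funD => //.
  by apply: meas_lincomb => j; exact: measurable_funP.
have := lacunary_small_ball_cat hY q20 r0 (ltW M0) hYq (fun j w => tM (X j w)) 0 uKL hL.
move=> hb.
apply: (@le_trans _ _ (Pr P ([set w | `|0 + \sum_(i <- K ++ L) a i * Y i w| <= r] `|`
   [set w | has (fun j => M < `|X j w|) (index_enum J)]))).
  apply: Pr_le.
  - exact: measurable_norm_le (measurable_lincomb a).
  - exact: measurableU.
  move=> w /= h; case: (boolP (has _ _)) => [|/hasPn hn]; [by right|left].
  rewrite add0r (perm_big _ pKL) /=; move: h; rewrite /lincomb.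
  rewrite (eq_bigr (fun i => a i * truncate M (X i w)))// => i _.
  have := hn i (mem_index_enum i).
  by rewrite -leNgt /truncate => ->.
apply: (le_trans (Pr_setU P mS mE)); apply: lerD => //.
apply: le_trans PE _; rewrite (_ : size (index_enum J) = #|J|)//.
by rewrite cardT enumT.
Qed.

End linear_combinations.

(** * Sign functions as mixtures of cosines *)

Section trigonometric_mixtures.
Context (R : realType).

(** Convex combinations of cosines: the weights add up to one, so replacing the
    characteristic function by an approximation up to frequency [D] changes
    expectations by no more than the error of the approximation. *)
Inductive trig_mix (D : R) : (R -> R) -> Prop :=
| trig_mix_cos a k : `|k| <= D -> trig_mix D (fun x => cos (a + k * x))
| trig_mix_conv p f g : 0 <= p <= 1 -> trig_mix D f -> trig_mix D g ->
    trig_mix D (fun x => p * f x + (1 - p) * g x).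

Lemma trig_mix_le D D' f : D <= D' -> trig_mix D f -> trig_mix D' f.
Proof.
move=> DD'; elim=> [a k kD|p g h p01 _ Hg _ Hh].
  by apply: trig_mix_cos; exact: le_trans DD'.
exact: trig_mix_conv.
Qed.

Lemma trig_mixM D D' f g : trig_mix D f -> trig_mix D' g ->
  trig_mix (D + D') (fun x => f x * g x).
Proof.
elim=> [a k kD|p f1 f2 p01 _ H1 _ H2] hg; last first.
  rewrite (_ : (fun x => _) = fun x => p * (f1 x * g x) + (1 - p) * (f2 x * g x)).
    by apply: trig_mix_conv => //; [exact: H1|exact: H2].
  by apply/funext => x; ring.
elim: hg => [b l lD|p g1 g2 p01 _ H1 _ H2]; last first.
  rewrite (_ : (fun x => _) = fun x => p * (cos (a + k * x) * g1 x) +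
      (1 - p) * (cos (a + k * x) * g2 x)); first exact: trig_mix_conv.
  by apply/funext => x; ring.
rewrite (_ : (fun x => _) = fun x => 1 / 2 * cos ((a + b) + (k + l) * x) +
    (1 - 1 / 2) * cos ((a - b) + (k - l) * x)); last first.
  apply/funext => x.
  rewrite (_ : a + b + (k + l) * x = (a + k * x) + (b + l * x)); last by ring.
  rewrite (_ : a - b + (k - l) * x = (a + k * x) - (b + l * x)); last by ring.
  by move: (a + k * x) (b + l * x) => u v; rewrite cosD cosB; field.
apply: trig_mix_conv; first lra.
  by apply: trig_mix_cos; apply: (le_trans (ler_normD _ _)); exact: lerD.
by apply: trig_mix_cos; apply: (le_trans (ler_normB _ _)); exact: lerD.
Qed.

Lemma trig_mix_sin k : trig_mix `|k| (fun x => sin (k * x)).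
Proof.
rewrite (_ : (fun x => _) = fun x => cos (- (pi / 2) + k * x)).
  exact: trig_mix_cos.
by apply/funext => x; rewrite addrC cosBpihalf.
Qed.

Lemma trig_mix_cos0 k : trig_mix `|k| (fun x => cos (k * x)).
Proof.
rewrite (_ : (fun x => _) = fun x => cos (0 + k * x)); first exact: trig_mix_cos.
by apply/funext => x; rewrite add0r.
Qed.

Lemma trig_mix_cosX k m : trig_mix (m%:R * `|k|) (fun x => cos (k * x) ^+ m).
Proof.
elim: m => [|m IH].
  rewrite (_ : (fun x => _) = fun x => cos (0 + 0 * x)).
    by apply: trig_mix_cos; rewrite normr0 mul0r.
  by apply/funext => x; rewrite mul0r addr0 cos0.
rewrite (_ : m.+1%:R * `|k| = `|k| + m%:R * `|k|); last by rewrite -natr1; ring.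
rewrite (_ : (fun x => _) = fun x => cos (k * x) * cos (k * x) ^+ m).
  by apply: trig_mixM => //; exact: trig_mix_cos0.
by apply/funext => x; rewrite exprS.
Qed.

Lemma trig_mix_max D f : trig_mix D f -> forall x, `|f x| <= 1.
Proof.
elim=> [a k _ x|p f1 f2 /andP[p0 p1] _ H1 _ H2 x]; first exact: cos_max.
apply: (le_trans (ler_normD _ _)); rewrite !normrM (ger0_norm p0).
have q0 : 0 <= 1 - p by lra.
rewrite (ger0_norm q0); have := H1 x; have := H2 x; nra.
Qed.

Lemma trig_mix_meas D f : trig_mix D f -> measurable_fun setT f.
Proof.
elim=> [a k _|p f1 f2 _ _ H1 _ H2].
  apply: measurable_cosT; apply: measurable_funD => //; exact: measurable_funM.
by apply: measurable_funD; exact: measurable_funM.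
Qed.

(** The primitive of (1 - z^2)^m vanishing at 0, written through its reduction
    formula: this makes it visibly a mixture after the substitution z = sin. *)
Fixpoint sgn_poly (m : nat) (z : R) : R :=
  if m is m'.+1 then
    1 / (2 * m'%:R + 3) * (z * (1 - z ^+ 2) ^+ m'.+1) +
    (1 - 1 / (2 * m'%:R + 3)) * sgn_poly m' z
  else z.

Lemma sgn_poly0 m : sgn_poly m 0 = 0.
Proof. by elim: m => //= m ->; rewrite mul0r !mulr0 addr0. Qed.

Lemma sgn_polyN m z : sgn_poly m (- z) = - sgn_poly m z.
Proof. by elim: m => //= m ->; rewrite sqrrN; ring. Qed.

Lemma derive_sgn_poly m (z : R) : is_derive z 1 (sgn_poly m) ((1 - z ^+ 2) ^+ m).
Proof.
elim: m z => [|m IH] z /=; first by rewrite expr0; exact: is_derive_id.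
have d0 : 2 * m%:R + 3 != 0 :> R.
  by rewrite gt_eqF// ltr_wpDl// mulr_ge0.
have dX : is_derive z 1 (fun z : R => (1 - z ^+ 2) ^+ m.+1)
    (m.+1%:R * (1 - z ^+ 2) ^+ m * (- (2 * z))).
  have d2 : is_derive z 1 (fun z : R => 1 - z ^+ 2) (- (2 * z)).
    by apply: is_derive_eq; rewrite /GRing.scale /=; ring.
  have -> : (fun z : R => (1 - z ^+ 2) ^+ m.+1) = (fun z : R => 1 - z ^+ 2) ^+ m.+1.
    by apply/funext => x; rewrite fctE.
  by apply: is_derive_eq; rewrite /GRing.scale /=.
apply: is_derive_eq; rewrite /GRing.scale /=.
rewrite !exprS -[m.+1%:R]natr1; set u := (1 - _) ^+ m.
by field.
Qed.

Lemma sgn_poly_gap m (z : R) : 0 <= z <= 1 ->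
  0 <= sgn_poly m 1 - sgn_poly m z <= (1 - z ^+ 2) ^+ m.
Proof.
move=> /andP[z0 z1].
have cf : {within `[z, 1], continuous (sgn_poly m)}.
  apply: derivable_within_continuous => y _; exact: (@ex_derive _ _ _ _ _ _ _ (derive_sgn_poly m y)).
have [c] := MVT_segment z1 (fun y _ => derive_sgn_poly m y) cf.
rewrite in_itv /= => /andP[zc c1] ->.
have c2 : 0 <= 1 - c ^+ 2 by rewrite subr_ge0 expr_le1// (le_trans z0).
have h1 : (1 - c ^+ 2) ^+ m <= (1 - z ^+ 2) ^+ m.
  apply: lerXn2r; rewrite ?nnegrE//; last by rewrite lerB// lerXn2r ?nnegrE// (le_trans z0).
  by rewrite subr_ge0 expr_le1.
have h0 : 0 <= (1 - c ^+ 2) ^+ m by exact: exprn_ge0.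
apply/andP; split; first by rewrite mulr_ge0// subr_ge0.
apply: le_trans h1; rewrite ler_piMr//; lra.
Qed.

Lemma sgn_poly1_ge m : 1 / (m%:R + 1) <= sgn_poly m 1.
Proof.
elim: m => [|m IH] /=; first by rewrite add0r divr1.
rewrite expr1n subrr exprS mul0r !mulr0 add0r.
have m0 : 0 <= m%:R :> R by [].
apply: le_trans (ler_wpM2l _ IH); last first.
  by rewrite subr_ge0 ler_pdivrMr; lra.
rewrite -natr1 -subr_ge0.
rewrite (_ : _ - _ = 1 / ((2 * m%:R + 3) * (m%:R + 1 + 1))).
  by rewrite divr_ge0// mulr_ge0 ?mulr_ge0//; lra.
by field; rewrite !gt_eqF//; lra.
Qed.

Lemma trig_mix_sgn_poly k m :
  trig_mix ((2 * m%:R + 1) * `|k|) (fun x => sgn_poly m (sin (k * x))).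
Proof.
elim: m => [|m IH] /=; first by rewrite mulr0 add0r mul1r; exact: trig_mix_sin.
have m0 : 0 <= m%:R :> R by [].
apply: trig_mix_conv.
- by apply/andP; split; [rewrite divr_ge0//; lra|rewrite ler_pdivrMr; lra].
- rewrite (_ : (2 * m.+1%:R + 1) * `|k| = `|k| + (2 * m.+1)%:R * `|k|); last first.
    by rewrite natrM -natr1; ring.
  rewrite (_ : (fun x => _) = fun x => sin (k * x) * cos (k * x) ^+ (2 * m.+1)).
    by apply: trig_mixM; [exact: trig_mix_sin|exact: trig_mix_cosX].
  by apply/funext => x; rewrite exprM cos2sin2.
- by apply: trig_mix_le IH; rewrite ler_wpM2r// -natr1; lra.
Qed.

(** Normalized so as to approach the sign on [h <= |x| <= L]. *)
Definition smooth_sgn m (L x : R) := sgn_poly m (sin (L^-1 * x)) / sgn_poly m 1.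

(** For large [m] the derivative [(1 - z ^ 2) ^ m] of [sgn_poly m] is
    concentrated near 0, so its primitive is almost a step function. *)
Lemma smooth_sgn_near m (L h x : R) : 0 < h -> h <= `|x| -> `|x| <= L ->
  `|Num.sg x - smooth_sgn m L x| <= (m%:R + 1) * expR (- (m%:R * (h / (2 * L)) ^+ 2)).
Proof.
move=> h0; wlog x0 : x / 0 < x.
  move=> H hx xL; case: (ltgtP x 0) => [xn|xp|x0]; [|exact: H|]; last first.
    by move: hx; rewrite x0 normr0 => hx; lra.
  have := H (- x); rewrite oppr_gt0 normrN => /(_ xn hx xL).
  rewrite /smooth_sgn mulrN sinN sgn_polyN sgrN.
  by rewrite (_ : - Num.sg x - _ = - (Num.sg x - sgn_poly m (sin (L^-1 * x)) / sgn_poly m 1))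
     ?normrN//; ring.
rewrite (gtr0_norm x0) => hx xL.
have L0 : 0 < L by exact: lt_le_trans xL.
pose y := L^-1 * x; pose z := sin y.
have y0 : 0 < y by rewrite mulr_gt0 ?invr_gt0.
have y1 : y <= 1 by rewrite /y mulrC ler_pdivrMr// mul1r.
have yh : h / L <= y by rewrite /y mulrC ler_wpM2l// invr_ge0 ltW.
have zy : y / 2 <= z.
  have := sin_ge_cubic (ltW y0); rewrite -/z.
  have : y ^+ 3 <= y by rewrite exprS ler_piMr ?(ltW y0)// expr_le1// ltW.
  lra.
have z1 : z <= 1 by exact: sin_le1.
have hz : h / (2 * L) <= z.
  apply: le_trans zy; rewrite invfM mulrCA mulrC ler_wpM2r//; lra.
have hL0 : 0 <= h / (2 * L) by rewrite divr_ge0 ?mulr_ge0// ltW.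
have z0 : 0 <= z by exact: le_trans hz.
have [/andP[g0 g1]] : 0 <= sgn_poly m 1 - sgn_poly m z <= (1 - z ^+ 2) ^+ m.
  by apply: sgn_poly_gap; rewrite z0.
have q1 := sgn_poly1_ge m; set q := sgn_poly m 1 in g0 g1 q1 *.
have m0 : 0 <= m%:R :> R by [].
have q0 : 0 < q by apply: lt_le_trans q1; rewrite divr_gt0//; lra.
rewrite gtr0_sg// /smooth_sgn -/y -/z -/q.
rewrite (_ : 1 - _ = (q - sgn_poly m z) / q); last by field; rewrite gt_eqF.
rewrite ger0_norm ?divr_ge0 ?(ltW q0)// mulrC.
apply: ler_pM => //; first by rewrite invr_ge0 ltW.
  rewrite invf_ple ?posrE//; last lra.
apply: (le_trans g1).
have z2 : z ^+ 2 <= 1 by rewrite expr_le1.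
rewrite -[X in expR X]mulrN expRM_natl.
apply: lerXn2r; rewrite ?nnegrE ?expR_ge0 ?subr_ge0//.
apply: le_trans (expR_ge1Dx _); rewrite lerB// lerXn2r ?nnegrE//.
Qed.

Lemma smooth_sgn_max m (L x : R) : `|smooth_sgn m L x| <= 1.
Proof.
have m0 : 0 <= m%:R :> R by [].
have q0 : 0 < sgn_poly m 1.
  by apply: lt_le_trans (sgn_poly1_ge m); rewrite divr_gt0//; lra.
rewrite /smooth_sgn normrM normfV (gtr0_norm q0) ler_pdivrMr// mul1r.
have := sin_le1 (L^-1 * x); have := sin_geN1 (L^-1 * x).
move: (sin _) => z.
have H u : 0 <= u <= 1 -> `|sgn_poly m u| <= sgn_poly m 1.
  move=> u01; have /andP[g0 _] := sgn_poly_gap m u01.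
  move: u01 => /andP[u0 u1].
  have [c] := MVT_segment u0 (fun y _ => derive_sgn_poly m y)
    (derivable_within_continuous (fun y _ => @ex_derive _ _ _ _ _ _ _ (derive_sgn_poly m y))).
  rewrite in_itv /= sgn_poly0 !subr0 => /andP[c0 cu] E.
  rewrite ger0_norm; first by rewrite -subr_ge0.
  rewrite E mulr_ge0// exprn_ge0// subr_ge0 expr_le1//.
  exact: le_trans u1.
move=> zN1 z1; case: (leP 0 z) => z0; first by apply: H; rewrite z0.
by rewrite -normrN -sgn_polyN; apply: H; lra.
Qed.

End trigonometric_mixtures.

Section sign_correlation.
Context (R : realType) (d : measure_display) (T : measurableType d).
Context (P : probability T R).
Implicit Types (A B : T -> R) (L h p : R).

(** Up to frequency [D], the characteristic function of [(A, B)] is within [nu]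
    of that of the centred Gaussian pair with unit variances and correlation
    [rho]. *)
Definition gauss_pair A B (rho D nu : R) := forall a l m : R,
  `|l| <= D -> `|m| <= D ->
  `|Ex P (fun w => cos (a + (l * A w + m * B w))) -
    cos a * expR (- ((l ^+ 2 + m ^+ 2 + 2 * rho * l * m) / 2))| <= nu.

Lemma summable_le1 (f : T -> R) : measurable_fun setT f ->
  (forall w, `|f w| <= 1) -> summable_rv P f.
Proof. by move=> mf; exact: summable_bounded. Qed.

(** By bilinearity only two cosines have to be compared, and their product is
    the average of two values of the joint characteristic function. *)
Lemma trig_mix_compare A B A' B' rho D nu f g :
  measurable_fun setT A -> measurable_fun setT B ->
  measurable_fun setT A' -> measurable_fun setT B' ->
  gauss_pair A B rho D nu -> gauss_pair A' B' rho D nu ->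
  trig_mix D f -> trig_mix D g ->
  `|Ex P (fun w => f (A w) * g (B w)) - Ex P (fun w => f (A' w) * g (B' w))|
    <= 2 * nu.
Proof.
move=> mA mB mA' mB' h h' tf tg.
have mfc (u : R -> R) (V : T -> R) : trig_mix D u -> measurable_fun setT V ->
    measurable_fun setT (fun w => u (V w)).
  by move=> /trig_mix_meas mu mV; exact: (measurableT_comp mu mV).
have sm (u v : R -> R) (U V : T -> R) : trig_mix D u -> trig_mix D v ->
    measurable_fun setT U -> measurable_fun setT V ->
    summable_rv P (fun w => u (U w) * v (V w)).
  move=> tu tv mU mV; apply: summable_le1.
    by apply: measurable_funM; exact: mfc.
  move=> w; rewrite normrM; apply: mulr_ile1 => //.
    exact: trig_mix_max tu _.
  exact: trig_mix_max tv _.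
have conv (u1 u2 v : T -> R) p : summable_rv P (fun w => u1 w * v w) ->
    summable_rv P (fun w => u2 w * v w) ->
    Ex P (fun w => (p * u1 w + (1 - p) * u2 w) * v w) =
    p * Ex P (fun w => u1 w * v w) + (1 - p) * Ex P (fun w => u2 w * v w).
  move=> s1 s2; rewrite -!ExZ// -ExD; [|exact: summableZ..].
  by apply: eq_Ex => w; ring.
have mixb p (x1 x2 y1 y2 : R) : 0 <= p <= 1 -> `|x1 - y1| <= 2 * nu ->
    `|x2 - y2| <= 2 * nu ->
    `|p * x1 + (1 - p) * x2 - (p * y1 + (1 - p) * y2)| <= 2 * nu.
  move=> /andP[p0 p1] h1 h2; have q0 : 0 <= 1 - p by lra.
  rewrite (_ : _ - _ = p * (x1 - y1) + (1 - p) * (x2 - y2)); last by ring.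
  apply: (le_trans (ler_normD _ _)); rewrite !normrM (ger0_norm p0) (ger0_norm q0).
  nra.
elim: tf => [a k kD|p f1 f2 p01 t1 H1 t2 H2]; last first.
  by rewrite !conv; [exact: mixb|exact: sm..].
elim: tg => [b l lD|p g1 g2 p01 t1 H1 t2 H2]; last first.
  have tc : trig_mix D (fun x : R => cos (a + k * x)) by exact: trig_mix_cos.
  have sw (U V : T -> R) : Ex P (fun w => cos (a + k * U w) * (p * g1 (V w) + (1 - p) * g2 (V w))) =
     Ex P (fun w => (p * g1 (V w) + (1 - p) * g2 (V w)) * cos (a + k * U w)).
    by apply: eq_Ex => w; rewrite mulrC.
  have cm (u v : T -> R) : Ex P (fun w => u w * v w) = Ex P (fun w => v w * u w).
    by apply: eq_Ex => w; rewrite mulrC.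
  rewrite !sw (conv (fun w => g1 (B w)) (fun w => g2 (B w))
      (fun w => cos (a + k * A w))); [|exact: (sm g1 (fun x => cos (a + k * x)))
      |exact: (sm g2 (fun x => cos (a + k * x)))].
  rewrite (conv (fun w => g1 (B' w)) (fun w => g2 (B' w))
      (fun w => cos (a + k * A' w))); [|exact: (sm g1 (fun x => cos (a + k * x)))
      |exact: (sm g2 (fun x => cos (a + k * x)))].
  apply: mixb => //; rewrite ![Ex P (fun w => _ * cos _)]cm //.
have mc (c x y : R) (U V : T -> R) : measurable_fun setT U ->
    measurable_fun setT V -> summable_rv P (fun w => cos (c + (x * U w + y * V w))).
  move=> mU mV; apply: summable_le1; last by move=> w; exact: cos_max.
  apply: measurable_cosT; apply: measurable_funD => //.
  by apply: measurable_funD; exact: measurable_funM.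
have split_ (U V : T -> R) : measurable_fun setT U -> measurable_fun setT V ->
   Ex P (fun w => cos (a + k * U w) * cos (b + l * V w)) =
   1 / 2 * Ex P (fun w => cos ((a + b) + (k * U w + l * V w))) +
   1 / 2 * Ex P (fun w => cos ((a - b) + (k * U w + (- l) * V w))).
  move=> mU mV; rewrite -!ExZ; [|exact: mc..].
  rewrite -ExD; [|exact/summableZ/mc..].
  apply: eq_Ex => w.
  rewrite (_ : a + b + _ = (a + k * U w) + (b + l * V w)); last by ring.
  rewrite (_ : a - b + _ = (a + k * U w) - (b + l * V w)); last by ring.
  by move: (a + k * U w) (b + l * V w) => u v; rewrite cosD cosB; field.
rewrite !split_//.
have lD' : `|- l| <= D by rewrite normrN.
move: (h (a + b) k l kD lD) (h' (a + b) k l kD lD).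
move: (h (a - b) k (- l) kD lD') (h' (a - b) k (- l) kD lD').
set x1 := Ex P _; set x2 := cos _ * _; set x3 := Ex P _.
set x4 := Ex P _; set x5 := cos _ * _; set x6 := Ex P _.
move=> e1 e2 e3 e4.
rewrite (_ : _ - _ = 1 / 2 * ((x4 - x5) - (x6 - x5)) + 1 / 2 * ((x1 - x2) - (x3 - x2))); last by ring.
apply: (le_trans (ler_normD _ _)).
have n2 (x : R) : `|1 / 2 * x| = 1 / 2 * `|x| by rewrite normrM ger0_norm.
rewrite !n2.
have := ler_normB (x4 - x5) (x6 - x5); have := ler_normB (x1 - x2) (x3 - x2).
lra.
Qed.

Lemma measurable_sg A : measurable_fun setT A ->
  measurable_fun setT (fun w => Num.sg (A w)).
Proof.
move=> mA; rewrite (_ : (fun w => _) =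
    fun w => if 0 < A w then 1 else if A w < 0 then -1 else 0).
  apply: measurable_fun_ifT => //; first exact: measurable_fun_ltr.
  by apply: measurable_fun_ifT => //; exact: measurable_fun_ltr.
apply/funext => w; case: ltgtP => h.
- by rewrite gtr0_sg.
- by rewrite ltr0_sg.
- by rewrite -h sgr0.
Qed.

Lemma sg_max (x : R) : `|Num.sg x| <= 1.
Proof. by rewrite normr_sg; case: (x != 0). Qed.

Lemma measurable_smooth_sgn m L A : measurable_fun setT A ->
  measurable_fun setT (fun w => smooth_sgn m L (A w)).
Proof.
move=> mA; apply: measurable_funM => //.
have := trig_mix_meas (trig_mix_sgn_poly L^-1 m).
by move=> h; exact: (measurableT_comp h mA).
Qed.

Lemma smooth_sgn_error A m L h p : measurable_fun setT A -> 0 < h ->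
  Pr P [set w | `|A w| <= h] <= p -> Pr P [set w | L < `|A w|] <= p ->
  Ex P (fun w => `|Num.sg (A w) - smooth_sgn m L (A w)|) <=
    4 * p + (m%:R + 1) * expR (- (m%:R * (h / (2 * L)) ^+ 2)).
Proof.
move=> mA h0 hp Lp; set tau := _ * expR _.
have tau0 : 0 <= tau by rewrite mulr_ge0 ?expR_ge0// addr_ge0.
have m1 := measurable_norm_le h mA.
have m2 := measurable_gt_norm L mA.
have i1 := summable_indic P m1; have i2 := summable_indic P m2.
have j1 := summableZ 2 i1; have j2 := summableZ 2 i2.
apply: (@le_trans _ _ (Ex P (fun w => 2 * \1_[set w | `|A w| <= h] w +
    2 * \1_[set w | L < `|A w|] w + tau))).
  apply: Ex_le.
  - apply: (@summable_bounded _ _ _ _ _ 2).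
      apply: measurableT_comp => //; apply: measurable_funB.
        exact: measurable_sg.
      exact: measurable_smooth_sgn.
    move=> w; rewrite normr_id; apply: (le_trans (ler_normB _ _)).
    by have := sg_max (A w); have := smooth_sgn_max m L (A w); lra.
  - apply: summableD; last exact: summable_cst.
    exact: summableD.
  move=> w.
  have b2 : `|Num.sg (A w) - smooth_sgn m L (A w)| <= 2.
    apply: (le_trans (ler_normB _ _)).
    by have := sg_max (A w); have := smooth_sgn_max m L (A w); lra.
  have k1 : 0 <= \1_[set w | `|A w| <= h] w :> R by [].
  have k2 : 0 <= \1_[set w | L < `|A w|] w :> R by [].
  case: (leP `|A w| h) => Ah.
    have -> : \1_[set w | `|A w| <= h] w = 1 :> R by rewrite indicE mem_set.
    lra.
  case: (ltP L `|A w|) => LA.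
    have -> : \1_[set w | L < `|A w|] w = 1 :> R by rewrite indicE mem_set.
    lra.
  have := smooth_sgn_near m h0 (ltW Ah) LA; rewrite -/tau; lra.
rewrite (ExD (summableD j1 j2) (summable_cst P _)) Ex_cst (ExD j1 j2) !ExZ//.
rewrite !Ex_indic//; lra.
Qed.

Lemma sign_corr_smooth A B m L h p : measurable_fun setT A ->
  measurable_fun setT B -> 0 < h ->
  Pr P [set w | `|A w| <= h] <= p -> Pr P [set w | L < `|A w|] <= p ->
  Pr P [set w | `|B w| <= h] <= p -> Pr P [set w | L < `|B w|] <= p ->
  `|Ex P (fun w => Num.sg (A w) * Num.sg (B w)) -
    Ex P (fun w => smooth_sgn m L (A w) * smooth_sgn m L (B w))| <=
  2 * (4 * p + (m%:R + 1) * expR (- (m%:R * (h / (2 * L)) ^+ 2))).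
Proof.
move=> mA mB h0 pA1 pA2 pB1 pB2.
have mM (f g : T -> R) : measurable_fun setT f -> measurable_fun setT g ->
    (forall w, `|f w| <= 1) -> (forall w, `|g w| <= 1) ->
    summable_rv P (fun w => f w * g w).
  move=> mf mg f1 g1; apply: summable_le1; first exact: measurable_funM.
  by move=> w; rewrite normrM mulr_ile1.
have mE (V : T -> R) : measurable_fun setT V ->
    summable_rv P (fun w => `|Num.sg (V w) - smooth_sgn m L (V w)|).
  move=> mV; apply: (@summable_bounded _ _ _ _ _ 2).
    apply: measurableT_comp => //; apply: measurable_funB.
      exact: measurable_sg.
    exact: measurable_smooth_sgn.
  move=> w; rewrite normr_id; apply: (le_trans (ler_normB _ _)).
  by have := sg_max (V w); have := smooth_sgn_max m L (V w); lra.
have s1 : summable_rv P (fun w => Num.sg (A w) * Num.sg (B w)).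
  apply: mM; [exact: measurable_sg|exact: measurable_sg|move=> w; exact: sg_max..].
have s2 : summable_rv P (fun w => smooth_sgn m L (A w) * smooth_sgn m L (B w)).
  apply: mM; [exact: measurable_smooth_sgn|exact: measurable_smooth_sgn|move=> w; exact: smooth_sgn_max..].
have -> : forall x : R, 2 * x = x + x by move=> x; ring.
apply: le_trans (lerD (smooth_sgn_error m mA h0 pA1 pA2) (smooth_sgn_error m mB h0 pB1 pB2)).
rewrite -ExB// -ExD; [|exact: mE..].
apply: Ex_norm_le.
- have -> : (fun w => Num.sg (A w) * Num.sg (B w) - smooth_sgn m L (A w) * smooth_sgn m L (B w)) =
    fun w => Num.sg (A w) * Num.sg (B w) + (-1) * (smooth_sgn m L (A w) * smooth_sgn m L (B w)).
    by apply/funext => w; rewrite mulN1r.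
  by apply: summableD => //; exact: summableZ.
- by apply: summableD; exact: mE.
move=> w; set x := Num.sg _; set y := Num.sg _; set x' := smooth_sgn _ _ _; set y' := smooth_sgn _ _ _.
rewrite (_ : _ - _ = (x - x') * y + x' * (y - y')); last by ring.
apply: (le_trans (ler_normD _ _)); rewrite (normrM (x - x')) (normrM x').
have y1 : `|y| <= 1 by exact: sg_max.
have x1 : `|x'| <= 1 by exact: smooth_sgn_max.
by apply: lerD; [rewrite ler_piMr|rewrite ler_piMl].
Qed.

(** The signs are replaced by smooth ones, which see only the characteristic
    functions; [p] accounts for the values that are too small or too large for
    this replacement. *)
Lemma sign_corr_compare A B A' B' rho D nu m L h p :
  measurable_fun setT A -> measurable_fun setT B ->
  measurable_fun setT A' -> measurable_fun setT B' ->
  gauss_pair A B rho D nu -> gauss_pair A' B' rho D nu ->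
  0 < h -> 0 < L -> (2 * m%:R + 1) / L <= D ->
  (forall V, V \in [:: A; B; A'; B'] ->
    Pr P [set w | `|V w| <= h] <= p /\ Pr P [set w | L < `|V w|] <= p) ->
  `|Ex P (fun w => Num.sg (A w) * Num.sg (B w)) -
    Ex P (fun w => Num.sg (A' w) * Num.sg (B' w))| <=
  4 * (4 * p + (m%:R + 1) * expR (- (m%:R * (h / (2 * L)) ^+ 2))) +
  2 * nu * (m%:R + 1) ^+ 2.
Proof.
move=> mA mB mA' mB' g g' h0 L0 mD hp.
have [a1 a2] := hp A ltac:(rewrite !inE eqxx ?orbT//).
have [b1 b2] := hp B ltac:(rewrite !inE eqxx ?orbT//).
have [a3 a4] := hp A' ltac:(rewrite !inE eqxx ?orbT//).
have [b3 b4] := hp B' ltac:(rewrite !inE eqxx ?orbT//).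
have := sign_corr_smooth m mA mB h0 a1 a2 b1 b2.
have := sign_corr_smooth m mA' mB' h0 a3 a4 b3 b4.
have tm : trig_mix D (fun x => sgn_poly m (sin (L^-1 * x))).
  apply: trig_mix_le (trig_mix_sgn_poly _ _).
  by rewrite gtr0_norm ?invr_gt0.
have := trig_mix_compare mA mB mA' mB' g g' tm tm.
have m0 : 0 <= m%:R :> R by [].
have q1 := sgn_poly1_ge R m; set q := sgn_poly m 1 in q1.
have q0 : 0 < q by apply: lt_le_trans q1; rewrite divr_gt0//; lra.
have qi : q^-1 <= m%:R + 1.
  by rewrite invf_ple ?posrE//; lra.
have E (U V : T -> R) : measurable_fun setT U -> measurable_fun setT V ->
    Ex P (fun w => smooth_sgn m L (U w) * smooth_sgn m L (V w)) =
    q^-1 ^+ 2 * Ex P (fun w => sgn_poly m (sin (L^-1 * U w)) * sgn_poly m (sin (L^-1 * V w))).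
  move=> mU mV; rewrite -ExZ.
    by apply: eq_Ex => w; rewrite /smooth_sgn -/q; ring.
  apply: summable_le1.
    apply: measurable_funM.
      by have := trig_mix_meas tm => h1; exact: (measurableT_comp h1 mU).
    by have := trig_mix_meas tm => h1; exact: (measurableT_comp h1 mV).
  by move=> w; rewrite normrM mulr_ile1// (trig_mix_max tm).
rewrite (E _ _ mA mB) (E _ _ mA' mB').
set c1 := Ex P _; set c2 := Ex P _; set c3 := Ex P _; set c4 := Ex P _.
set t := expR _; set Q := q^-1 ^+ 2 => h1 h2 h3.
have Q0 : 0 <= Q by exact: sqr_ge0.
have QM : Q <= (m%:R + 1) ^+ 2.
  by rewrite /Q lerXn2r ?nnegrE ?invr_ge0 ?(ltW q0)//; lra.
have h4 : Q * `|c1 - c2| <= 2 * nu * (m%:R + 1) ^+ 2.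
  rewrite mulrC; apply: ler_pM => //.
rewrite (_ : c4 - c3 = (c4 - Q * c1) - (c3 - Q * c2) + Q * (c1 - c2)); last by ring.
apply: (le_trans (ler_normD _ _)); apply: lerD; last by rewrite normrM (ger0_norm Q0).
apply: (le_trans (ler_normB _ _)); lra.
Qed.

End sign_correlation.

(** * Sign changes of neighbouring values *)

Section sinusoid.
Context (R : realType) (k : nat) (k2 : (2 <= k)%N) (x y : R).

Definition wedge_angle : R := pi / k%:R.
Definition sinusoid (j : nat) : R :=
  cos (j%:R * wedge_angle) * x + sin (j%:R * wedge_angle) * y.

Let k0 : 0 < k%:R :> R. Proof. by rewrite ltr0n; lia. Qed.

Lemma sinusoid_opp : sinusoid k = - sinusoid 0.
Proof.
rewrite /sinusoid /wedge_angle mul0r cos0 sin0.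
rewrite (_ : k%:R * _ = pi); last by field; rewrite gt_eqF.
by rewrite cospi sinpi; ring.
Qed.

Lemma sin_wedge_ge0 (d : nat) : (d <= k)%N -> 0 <= sin (d%:R * wedge_angle).
Proof.
move=> dk; apply: sin_ge0_pi; apply/andP; split.
  by rewrite mulr_ge0// divr_ge0// ?pi_ge0// ltW.
rewrite /wedge_angle mulrCA ler_piMr ?pi_ge0// ler_pdivrMr// mul1r.
by rewrite ler_nat.
Qed.

Lemma sin_wedge_gt0 (d : nat) : (0 < d < k)%N -> 0 < sin (d%:R * wedge_angle).
Proof.
move=> /andP[d0 dk]; apply: sin_gt0_pi; apply/andP; split.
  by rewrite mulr_gt0 ?ltr0n// divr_gt0// pi_gt0.
rewrite /wedge_angle mulrCA gtr_pMr ?pi_gt0// ltr_pdivrMr// mul1r.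
by rewrite ltr_nat.
Qed.

(** A later value is a combination of two consecutive ones with coefficients of
    opposite signs, so after a sign change the new sign persists. *)
Lemma sinusoid_interp (i d : nat) :
  sin wedge_angle * sinusoid (i + d.+1) =
  sin (d.+1%:R * wedge_angle) * sinusoid i.+1 - sin (d%:R * wedge_angle) * sinusoid i.
Proof.
rewrite /sinusoid natrD -!natr1.
rewrite !mulrDl !mul1r.
move: (i%:R * wedge_angle) => u; move: (d%:R * wedge_angle) => v.
move: wedge_angle => w.
rewrite (_ : u + (v + w) = (u + v) + w); last by ring.
rewrite !(cosD, sinD).
have := cos2Dsin2 w.
move: (cos u) (sin u) (cos v) (sin v) (cos w) (sin w) => cu su cv sv cw sw h.
apply/eqP; rewrite -subr_eq0.
apply/eqP; transitivity (- sv * (cu * x + su * y) * (cw ^+ 2 + sw ^+ 2 - 1)).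
  by ring.
by rewrite h subrr mulr0.
Qed.

Lemma sinusoid_sign_after (i d : nat) : (i + d < k)%N ->
  sinusoid i * sinusoid i.+1 < 0 -> 0 < sinusoid (i + d.+1) * sinusoid i.+1.
Proof.
move=> idk hneg.
have s1 : 0 < sin wedge_angle.
  by have := @sin_wedge_gt0 1; rewrite mul1r; apply; lia.
have nz : sinusoid i.+1 != 0.
  by apply: contraTneq hneg => ->; rewrite mulr0 ltxx.
rewrite -(pmulr_rgt0 _ s1) mulrA sinusoid_interp.
rewrite [ltRHS](_ : _ = sin (d.+1%:R * wedge_angle) * sinusoid i.+1 ^+ 2 +
   sin (d%:R * wedge_angle) * (- (sinusoid i * sinusoid i.+1))); last by ring.
have p2 : 0 < sinusoid i.+1 ^+ 2 by rewrite lt_neqAle eq_sym sqrf_eq0 nz sqr_ge0.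
have p1 : 0 < - (sinusoid i * sinusoid i.+1) by rewrite oppr_gt0.
case: d idk => [|d] idk.
  by rewrite mul0r sin0 mul0r addr0 mul1r mulr_gt0.
apply: ltr_wpDl; first by rewrite mulr_ge0 ?(ltW p2)// sin_wedge_ge0//; lia.
by rewrite mulr_gt0// sin_wedge_gt0//; lia.
Qed.

(** By [sinusoid_sign_after] both later values have the sign acquired at the
    change. *)
Lemma sinusoid_one_change (i j : nat) : (i < j < k)%N ->
  sinusoid i * sinusoid i.+1 < 0 -> 0 < sinusoid j * sinusoid j.+1.
Proof.
move=> ijk hneg.
have h1 := @sinusoid_sign_after i (j - i.+1) _ hneg.
have h2 := @sinusoid_sign_after i (j - i) _ hneg.
have := h1 ltac:(lia); have := h2 ltac:(lia).
rewrite (_ : (i + (j - i).+1)%N = j.+1); last by lia.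
rewrite (_ : (i + (j - i.+1).+1)%N = j); last by lia.
set a := sinusoid j; set b := sinusoid j.+1; set c := sinusoid i.+1 => bc ac.
have c2 : 0 < c ^+ 2.
  rewrite lt_neqAle sqr_ge0 andbT eq_sym sqrf_eq0.
  by apply: contraTneq ac => ->; rewrite mulr0 ltxx.
rewrite -(pmulr_lgt0 _ c2) [ltRHS](_ : _ = (a * c) * (b * c)); last by ring.
exact: mulr_gt0.
Qed.

Lemma sinusoid_changes_le1 :
  (\sum_(0 <= j < k) (sinusoid j * sinusoid j.+1 < 0)%R <= 1)%N.
Proof.
case: (boolP (has (fun j => (sinusoid j * sinusoid j.+1 < 0)%R) (index_iota 0 k))); last first.
  move=> /hasPn h; rewrite big_seq big1// => j /h /negbTE -> //.
move=> /hasP[j]; rewrite mem_index_iota => /andP[_ jk] hj.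
rewrite (bigD1_seq j) ?iota_uniq ?mem_index_iota//= hj.
rewrite big_seq_cond big1// => i; rewrite mem_index_iota => /andP[/andP[_ ik] ij].
apply/eqP; rewrite eqb0 -leNgt.
have [ij'|ij'|e] := ltngtP i j; last by rewrite e eqxx in ij.
  rewrite leNgt; apply/negP => hi; have := @sinusoid_one_change i j _ hi.
  by rewrite ij' jk => /(_ isT); rewrite ltNge (ltW hj).
by apply: ltW; apply: (@sinusoid_one_change j) => //; rewrite ij'.
Qed.

(** The sign cannot stay constant because [sinusoid k = - sinusoid 0]. *)
Lemma sinusoid_changes_ge1 :
  (1 <= \sum_(0 <= j < k) (sinusoid j * sinusoid j.+1 <= 0)%R)%N.
Proof.
case: (boolP (has (fun j => (sinusoid j * sinusoid j.+1 <= 0)%R) (index_iota 0 k))).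
  move=> /hasP[j jk hj]; rewrite (bigD1_seq j) ?iota_uniq//= hj; lia.
move=> /hasPn h.
have pos j : (j <= k)%N -> (0 < j)%N -> 0 < sinusoid 0 * sinusoid j.
  elim: j => // j IH jk _.
  have := h j; rewrite mem_index_iota /= jk -ltNge => /(_ isT) hj.
  case: j IH jk hj => // j IH jk hj.
  have h0 := IH (ltnW jk) isT.
  have c2 : 0 < sinusoid j.+1 ^+ 2.
    rewrite lt_neqAle sqr_ge0 andbT eq_sym sqrf_eq0.
    by apply: contraTneq h0 => ->; rewrite mulr0 ltxx.
  rewrite -(pmulr_lgt0 _ c2).
  rewrite [ltRHS](_ : _ = (sinusoid 0 * sinusoid j.+1) *
    (sinusoid j.+1 * sinusoid j.+2)); last by ring.
  exact: mulr_gt0.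
have := pos k (leqnn k) ltac:(lia).
by rewrite sinusoid_opp mulrN oppr_gt0 ltNge -expr2 sqr_ge0.
Qed.

End sinusoid.

Section sign_change_probability.
Context (R : realType) (d : measure_display) (T : measurableType d).
Context (P : probability T R).
Implicit Types A B : T -> R.

Lemma measurable_lt0 A : measurable_fun setT A -> measurable [set w | A w < 0].
Proof.
move=> mA; rewrite (_ : [set w | _] = A @^-1` `]-oo, 0[).
  exact: measurable_preimage.
by apply/seteqP; split => w /=; rewrite in_itv.
Qed.

Lemma measurable_le0 A : measurable_fun setT A -> measurable [set w | A w <= 0].
Proof.
move=> mA; rewrite (_ : [set w | _] = A @^-1` `]-oo, 0]).
  exact: measurable_preimage.
by apply/seteqP; split => w /=; rewrite in_itv.
Qed.

Lemma sign_change_corr A B : measurable_fun setT A -> measurable_fun setT B ->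
  Pr P [set w | A w * B w < 0] <=
    (1 - Ex P (fun w => Num.sg (A w) * Num.sg (B w))) / 2 <=
  Pr P [set w | A w * B w <= 0].
Proof.
move=> mA mB.
have mAB : measurable_fun setT (fun w => A w * B w) by exact: measurable_funM.
have s1 : summable_rv P (fun w => Num.sg (A w) * Num.sg (B w)).
  apply: summable_le1; first by apply: measurable_funM; exact: measurable_sg.
  by move=> w; rewrite normrM mulr_ile1 ?sg_max.
have s2 : summable_rv P (fun w => 1 / 2 + (- (1 / 2)) * (Num.sg (A w) * Num.sg (B w))).
  by apply: summableD; [exact: summable_cst|exact: summableZ].
have -> : (1 - Ex P (fun w => Num.sg (A w) * Num.sg (B w))) / 2 =
    Ex P (fun w => 1 / 2 + (- (1 / 2)) * (Num.sg (A w) * Num.sg (B w))).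
  by rewrite (ExD (summable_cst P _) (summableZ _ s1)) Ex_cst ExZ//; field.
have m1 := measurable_lt0 mAB; have m2 := measurable_le0 mAB.
rewrite -!Ex_indic//; apply/andP; split; apply: Ex_le => //.
- exact: summable_indic.
- move=> w; rewrite -sgrM indicE; case: (boolP (w \in _)) => [/set_mem /= h|h].
    by rewrite ltr0_sg//; lra.
  have : Num.sg (A w * B w) <= 1 by rewrite (le_trans (ler_norm _))// sg_max.
  by rewrite /=; lra.
- exact: summable_indic.
- move=> w; rewrite -sgrM indicE; case: (boolP (w \in _)) => [/set_mem /= h|h].
    have : -1 <= Num.sg (A w * B w).
      by have := sg_max (A w * B w); rewrite ler_norml => /andP[].
    by lra.
  have : 0 < A w * B w by rewrite ltNge; apply/negP => h'; move/negP: h; apply; exact/mem_set.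
  by move=> h'; rewrite gtr0_sg//=; lra.
Qed.

Lemma sign_change_le_lt A B h p : measurable_fun setT A -> measurable_fun setT B ->
  0 < h -> Pr P [set w | `|A w| <= h] <= p -> Pr P [set w | `|B w| <= h] <= p ->
  Pr P [set w | A w * B w <= 0] <= Pr P [set w | A w * B w < 0] + 2 * p.
Proof.
move=> mA mB h0 pA pB.
have mAB : measurable_fun setT (fun w => A w * B w) by exact: measurable_funM.
have m1 := measurable_lt0 mAB; have m2 := measurable_le0 mAB.
have m3 := measurable_norm_le h mA; have m4 := measurable_norm_le h mB.
have m34 := measurableU _ _ m3 m4.
have := Pr_setU P m3 m4; have := Pr_setU P m1 m34.
have : Pr P [set w | A w * B w <= 0] <= Pr P ([set w | A w * B w < 0] `|`
    ([set w | `|A w| <= h] `|` [set w | `|B w| <= h])).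
  apply: Pr_le => //; first exact: measurableU.
  move=> w /=; rewrite le_eqVlt => /orP[|h1]; last by left.
  rewrite mulf_eq0 => /orP[|] /eqP ->; right; [left|right];
    by rewrite normr0 ltW.
lra.
Qed.

Section wedges.
Context (k : nat) (k2 : (2 <= k)%N) (Z0 Z1 : T -> R).
Hypotheses (mZ0 : measurable_fun setT Z0) (mZ1 : measurable_fun setT Z1).
Let X j w := sinusoid k (Z0 w) (Z1 w) j.
Context (m : nat) (h L D nu p : R).
Hypotheses (h0 : 0 < h) (L0 : 0 < L) (mD : (2 * m%:R + 1) / L <= D).
Hypothesis hp : forall j, (j <= k)%N ->
  Pr P [set w | `|X j w| <= h] <= p /\ Pr P [set w | L < `|X j w|] <= p.
Hypothesis hg : forall j, (j < k)%N ->
  gauss_pair P (X j) (X j.+1) (cos (wedge_angle R k)) D nu.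

Lemma measurable_sinusoid j : measurable_fun setT (X j).
Proof. by apply: measurable_funD; exact: measurable_funM. Qed.

Definition wedge_error : R :=
  12 * p + 2 * ((m%:R + 1) * expR (- (m%:R * (h / (2 * L)) ^+ 2))) +
  nu * (m%:R + 1) ^+ 2.

(** The characteristic function hypothesis is the same for all [k] pairs of
    neighbouring directions, so the sign changes are nearly equally likely;
    exactly one of them occurs, which determines their common probability
    without computing any Gaussian integral. *)
Lemma wedge_probability :
  1 / k%:R - wedge_error <= Pr P [set w | X 0 w * X 1 w < 0] /\
  Pr P [set w | X 0 w * X 1 w <= 0] <= 1 / k%:R + wedge_error.
Proof.
have mX := measurable_sinusoid.
have mXX j : measurable_fun setT (fun w => X j w * X j.+1 w).
  exact: measurable_funM.
set tau := (m%:R + 1) * expR (- (m%:R * (h / (2 * L)) ^+ 2)).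
have p0 : 0 <= p by have [a _] := hp (leq0n k); exact: le_trans (Pr_ge0 _ _) a.
pose lt_ j := Pr P [set w | X j w * X j.+1 w < 0].
pose le_ j := Pr P [set w | X j w * X j.+1 w <= 0].
pose c j := Ex P (fun w => Num.sg (X j w) * Num.sg (X j.+1 w)).
pose eta := 8 * p + 2 * tau + nu * (m%:R + 1) ^+ 2.
have lec j : lt_ j <= (1 - c j) / 2 <= le_ j by exact: sign_change_corr.
have lele j : (j < k)%N -> le_ j <= lt_ j + 2 * p.
  move=> jk; have [a _] := hp (ltnW jk); have [b _] := hp jk.
  exact: (sign_change_le_lt _ _ h0).
have cc j : (j < k)%N -> `|(1 - c j) / 2 - (1 - c 0) / 2| <= eta.
  move=> jk.
  have := @sign_corr_compare _ _ _ P (X 0) (X 1) (X j) (X j.+1) _ D nu m L h p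
     (mX 0) (mX 1) (mX j) (mX j.+1) (hg (ltnW k2)) (hg jk) h0 L0 mD.
  rewrite -/(c 0) -/(c j) -/tau => /(_ _) H.
  have {}H := H ltac:(by move=> V; rewrite !inE => /or4P[]/eqP->; apply: hp; lia).
  rewrite (_ : _ - _ = (c 0 - c j) / 2); last by field.
  rewrite normrM [X in _ * X]ger0_norm// ler_pdivrMr//.
  apply: le_trans H _; rewrite /eta; lra.
have ilt j : summable_rv P (\1_[set w | X j w * X j.+1 w < 0] : T -> R).
  by apply: summable_indic; exact: measurable_lt0.
have ile j : summable_rv P (\1_[set w | X j w * X j.+1 w <= 0] : T -> R).
  by apply: summable_indic; exact: measurable_le0.
have S1 : \sum_(0 <= j < k) lt_ j <= 1.
  rewrite (eq_bigr (fun j => Ex P \1_[set w | X j w * X j.+1 w < 0])); last first.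
    by move=> j _; rewrite Ex_indic//; exact: measurable_lt0.
  rewrite -Ex_sum// -[leRHS](Ex_cst P 1); apply: Ex_le.
  - exact: summable_sum.
  - exact: summable_cst.
  move=> w; have := sinusoid_changes_le1 k2 (Z0 w) (Z1 w).
  rewrite -(ler_nat R) natr_sum; apply: le_trans.
  apply: ler_sum => j _; rewrite indicE; case: (boolP (w \in _)) => // /set_mem /=.
  by rewrite /X => -> /=.
have S2 : 1 <= \sum_(0 <= j < k) le_ j.
  rewrite (eq_bigr (fun j => Ex P \1_[set w | X j w * X j.+1 w <= 0])); last first.
    by move=> j _; rewrite Ex_indic//; exact: measurable_le0.
  rewrite -Ex_sum// -[leLHS](Ex_cst P 1); apply: Ex_le.
  - exact: summable_cst.
  - exact: summable_sum.
  move=> w; have := sinusoid_changes_ge1 k2 (Z0 w) (Z1 w).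
  rewrite -(ler_nat R) natr_sum => /le_trans; apply.
  apply: ler_sum => j _; rewrite indicE; case: (boolP (w \in _)) => h1.
    by rewrite ler_nat leq_b1.
  have : ~ (X j w * X j.+1 w <= 0).
    by move=> h'; move/negP: h1; apply; exact/mem_set.
  by rewrite /X => /negP/negbTE ->.
have k0 : 0 < k%:R :> R by rewrite ltr0n; lia.
have sumc (x : R) : \sum_(0 <= j < k) x = k%:R * x.
  by rewrite big_const_nat iter_addr addr0 subn0 mulr_natl.
have kk : k%:R * (1 / k%:R) = 1 :> R by field; rewrite gt_eqF.
have U : (1 - c 0) / 2 <= 1 / k%:R + (2 * p + eta).
  rewrite -lerBlDr -(ler_pM2l k0) kk -sumc; apply: le_trans S1.
  rewrite big_nat_cond [leRHS]big_nat_cond; apply: ler_sum => j /andP[/andP[_ jk] _].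
  have := cc j jk; rewrite ler_norml => /andP[? ?].
  have /andP[? ?] := lec j; have := lele j jk; lra.
have V : 1 / k%:R - (2 * p + eta) <= (1 - c 0) / 2.
  rewrite lerBlDr -(ler_pM2l k0) kk -sumc; apply: (le_trans S2).
  rewrite big_nat_cond [leRHS]big_nat_cond; apply: ler_sum => j /andP[/andP[_ jk] _].
  have := cc j jk; rewrite ler_norml => /andP[? ?].
  have /andP[? ?] := lec j; have := lele j jk; lra.
have := lele 0%N (ltnW k2); have /andP[] := lec 0%N.
rewrite /wedge_error -/tau -/(lt_ 0%N) -/(le_ 0%N); rewrite /eta in U V.
move=> a1 a2 a3; split; lra.
Qed.

End wedges.

(** * Small balls from characteristic functions *)

(** Integrating the square of a Dirichlet sum shows that a variable cannot
    concentrate at scale 1/N if its characteristic function decays up to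
    frequency N. *)
Definition dirichlet2 (N : nat) (x : R) : R :=
  \sum_(0 <= i < N) \sum_(0 <= j < N) cos ((i%:R - j%:R) * x).

Lemma dirichlet2E N x : dirichlet2 N x =
  (\sum_(0 <= i < N) cos (i%:R * x)) ^+ 2 + (\sum_(0 <= i < N) sin (i%:R * x)) ^+ 2.
Proof.
rewrite /dirichlet2 !expr2 !mulr_suml -big_split /=.
apply: eq_bigr => i _; rewrite !mulr_sumr -big_split /=.
by apply: eq_bigr => j _; rewrite mulrBl cosB.
Qed.

Lemma dirichlet2_ge0 N x : 0 <= dirichlet2 N x.
Proof. by rewrite dirichlet2E addr_ge0 ?sqr_ge0. Qed.

Lemma dirichlet2_near N x : `|x| * N%:R <= 1 -> N%:R ^+ 2 / 4 <= dirichlet2 N x.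
Proof.
move=> xN; rewrite dirichlet2E.
have : N%:R / 2 <= \sum_(0 <= i < N) cos (i%:R * x).
  rewrite (_ : N%:R / 2 = \sum_(0 <= i < N) (1 / 2)); last first.
    by rewrite big_const_nat iter_addr addr0 subn0 -mulr_natl; field.
  rewrite big_nat_cond [leRHS]big_nat_cond; apply: ler_sum => i /andP[/andP[_ iN] _].
  apply: le_trans (cos_ge_quad _).
  have : `|i%:R * x| <= 1.
    rewrite normrM normr_nat mulrC; apply: le_trans xN.
    by rewrite ler_wpM2l// ler_nat ltnW.
  rewrite -[(i%:R * x) ^+ 2]real_normK ?num_real// => h1.
  have : `|i%:R * x| ^+ 2 <= 1 by rewrite expr_le1.
  lra.
have := sqr_ge0 (\sum_(0 <= i < N) sin (i%:R * x)).
have : 0 <= N%:R :> R by [].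
move: (\sum_(_ <= _ < _) _) (\sum_(_ <= _ < _) _) => a b; nra.
Qed.

Lemma gauss_le_geom (d1 : nat) : expR (- (d1%:R ^+ 2 / 2)) <= 2 * (1 / 2) ^+ d1 :> R.
Proof.
have h2 : 2 <= expR 1 :> R by have := expR_ge1Dx (1 : R); lra.
have h3 : expR (-1) <= 1 / 2 :> R.
  by rewrite expRN div1r lef_pV2 ?posrE ?expR_gt0.
case: d1 => [|d1]; first by rewrite expr0n /= mul0r oppr0 expR0 expr0; lra.
rewrite [in leRHS]exprS [leRHS](_ : _ = (1 / 2) ^+ d1); last by field.
apply: (@le_trans _ _ (expR (-1) ^+ d1)); last first.
  by apply: lerXn2r; rewrite ?nnegrE ?expR_ge0.
rewrite -expRM_natr ler_expR -natr1.
have : 0 <= d1%:R :> R by []. nra.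
Qed.

Lemma gauss_sum_le (N i : nat) :
  \sum_(0 <= j < N) expR (- ((i%:R - j%:R) ^+ 2 / 2)) <= 8 :> R.
Proof.
pose g (j : nat) : R := (1 / 2) ^+ (i - j) * (1 / 2) ^+ (j - i).
have hg j : expR (- ((i%:R - j%:R) ^+ 2 / 2)) <= 2 * g j.
  rewrite /g; case: (leqP j i) => ij.
    rewrite (_ : (j - i)%N = 0%N); last by lia.
    by rewrite expr0 mulr1 -natrB//; exact: gauss_le_geom.
  rewrite (_ : (i - j)%N = 0%N); last by lia.
  rewrite expr0 mul1r -sqrrN opprB -natrB ?(ltnW ij)//; exact: gauss_le_geom.
apply: (@le_trans _ _ (\sum_(0 <= j < N) 2 * g j)); first by apply: ler_sum.
rewrite -mulr_sumr.
suff : \sum_(0 <= j < N) g j <= 4 - 2 * (1 / 2) ^+ (N - i).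
  have h0 : 0 <= (1 / 2 : R) ^+ (N - i) by exact: exprn_ge0.
  lra.
elim: N => [|N IH]; first by rewrite big_geq// sub0n expr0; lra.
case: (leqP N i) => Ni.
  have : \sum_(0 <= j < N.+1) g j <= 2 * (1 / 2) ^+ (i - N).
    clear IH; elim: N Ni => [|N IH] Ni.
      rewrite big_nat1 /g sub0n expr0 mulr1 subn0.
      have h0 : 0 <= (1 / 2 : R) ^+ i by exact: exprn_ge0.
      lra.
    rewrite big_nat_recr//= {2}/g (_ : (N.+1 - i)%N = 0%N); last by lia.
    have := IH (ltnW Ni); rewrite (_ : (i - N)%N = (i - N.+1).+1); last by lia.
    rewrite exprS expr0; move: (\sum_(_ <= _ < _) _) ((1 / 2) ^+ _) => a b; lra.
  have : (1 / 2 : R) ^+ (i - N) <= 1 by apply: exprn_ile1; lra.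
  have : (1 / 2 : R) ^+ (N.+1 - i) <= 1 by apply: exprn_ile1; lra.
  move: (\sum_(_ <= _ < _) _) ((1 / 2) ^+ _) ((1 / 2) ^+ _) => a b c; lra.
rewrite big_nat_recr//= {2}/g (_ : (i - N)%N = 0%N); last by lia.
rewrite (_ : (N.+1 - i)%N = (N - i).+1); last by lia.
rewrite expr0 mul1r exprS; move: IH.
rewrite (_ : (N - i)%N = (N - i).-1.+1); last by lia.
rewrite !exprS; move: (\sum_(_ <= _ < _) _) ((1 / 2) ^+ _) => a b; lra.
Qed.

End sign_change_probability.

Section small_ball.
Context (R : realType) (d : measure_display) (T : measurableType d).
Context (P : probability T R).

Let gs (i j : nat) : R := expR (- ((i%:R - j%:R) ^+ 2 / 2)).

(** Markov's inequality for the product of two squared Dirichlet sums. Expanding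
    it leaves the characteristic function at differences of indices, whose
    Gaussian part decays so fast that the double sums are only of order
    [N * N']. *)
Lemma small_ball (A B : T -> R) (N N' : nat) (nu : R) (E : set T) :
  measurable_fun setT A -> measurable_fun setT B -> measurable E ->
  (0 < N)%N -> (0 < N')%N ->
  (forall w, E w -> N%:R ^+ 2 / 4 <= dirichlet2 N (A w)) ->
  (forall w, E w -> N'%:R ^+ 2 / 4 <= dirichlet2 N' (B w)) ->
  (forall i j i' j', (i < N)%N -> (j < N)%N -> (i' < N')%N -> (j' < N')%N ->
    `|Ex P (fun w => cos ((i%:R - j%:R) * A w + (i'%:R - j'%:R) * B w))| <=
      gs i j * gs i' j' + nu) ->
  Pr P E <= 1024 / (N%:R * N'%:R) + 16 * nu.
Proof.
move=> mA mB mE N0 N'0 hA hB hcf.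
have n0 : 0 < N%:R :> R by rewrite ltr0n.
have n0' : 0 < N'%:R :> R by rewrite ltr0n.
pose c := 16 / (N%:R ^+ 2 * N'%:R ^+ 2) : R.
have c0 : 0 <= c by rewrite divr_ge0// mulr_ge0// sqr_ge0.
have mc (x y : R) : summable_rv P (fun w => cos (x * A w) * cos (y * B w)).
  apply: summable_le1.
    by apply: measurable_funM; apply: measurable_cosT; exact: measurable_funM.
  by move=> w; rewrite normrM mulr_ile1 ?cos_max.
have mc' (x y : R) : summable_rv P (fun w => cos (x * A w + y * B w)).
  apply: summable_le1; last by move=> w; exact: cos_max.
  by apply: measurable_cosT; apply: measurable_funD; exact: measurable_funM.
pose F i j i' j' w := cos ((i%:R - j%:R) * A w) * cos ((i'%:R - j'%:R) * B w).
have DD w : dirichlet2 N (A w) * dirichlet2 N' (B w) =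
  \sum_(0 <= i < N) \sum_(0 <= j < N) \sum_(0 <= i' < N') \sum_(0 <= j' < N') F i j i' j' w.
  rewrite /dirichlet2 mulr_suml; apply: eq_bigr => i _.
  rewrite mulr_suml; apply: eq_bigr => j _.
  rewrite mulr_sumr; apply: eq_bigr => i' _.
  by rewrite mulr_sumr.
have sF3 i j i' : summable_rv P (fun w => \sum_(0 <= j' < N') F i j i' j' w).
  by apply: summable_sum => j' _; exact: mc.
have sF2 i j : summable_rv P (fun w => \sum_(0 <= i' < N') \sum_(0 <= j' < N') F i j i' j' w).
  by apply: summable_sum => i' _; exact: sF3.
have sF1 i : summable_rv P (fun w => \sum_(0 <= j < N) \sum_(0 <= i' < N') \sum_(0 <= j' < N') F i j i' j' w).
  by apply: summable_sum => j _; exact: sF2.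
have sF : summable_rv P (fun w => \sum_(0 <= i < N) \sum_(0 <= j < N) \sum_(0 <= i' < N') \sum_(0 <= j' < N') F i j i' j' w).
  by apply: summable_sum => i _; exact: sF1.
have EF i j i' j' : (i < N)%N -> (j < N)%N -> (i' < N')%N -> (j' < N')%N ->
    Ex P (F i j i' j') <= gs i j * gs i' j' + nu.
  move=> iN jN i'N j'N.
  have -> : Ex P (F i j i' j') =
     1 / 2 * Ex P (fun w => cos ((i%:R - j%:R) * A w + (i'%:R - j'%:R) * B w)) +
     1 / 2 * Ex P (fun w => cos ((i%:R - j%:R) * A w + (j'%:R - i'%:R) * B w)).
    rewrite -!ExZ// -ExD; [|exact: summableZ..].
    apply: eq_Ex => w; rewrite /F.
    rewrite [(j'%:R - i'%:R) * _](_ : _ = - ((i'%:R - j'%:R) * B w)); last by ring.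
    by move: (_ * A w) (_ * B w) => u v; rewrite cosD cosB; field.
  have h1 := hcf _ _ _ _ iN jN i'N j'N; have h2 := hcf _ _ _ _ iN jN j'N i'N.
  have sy : gs j' i' = gs i' j' by rewrite /gs -sqrrN opprB.
  rewrite sy in h2.
  have := le_trans (ler_norm _) h1; have := le_trans (ler_norm _) h2; lra.
have gsum (m : nat) i : \sum_(0 <= j < m) gs i j <= 8 by exact: gauss_sum_le.
have gge i j : 0 <= gs i j by exact: expR_ge0.
have sumc (m : nat) (x : R) : \sum_(0 <= j < m) x = m%:R * x.
  by rewrite big_const_nat iter_addr addr0 subn0 mulr_natl.
have lsum (m : nat) (f : nat -> R) (b : R) : (forall i, (i < m)%N -> f i <= b) ->
    \sum_(0 <= i < m) f i <= m%:R * b.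
  move=> hf; rewrite -sumc big_nat_cond [leRHS]big_nat_cond.
  by apply: ler_sum => i /andP[/andP[_ im] _]; exact: hf.
have big : Ex P (fun w => \sum_(0 <= i < N) \sum_(0 <= j < N) \sum_(0 <= i' < N') \sum_(0 <= j' < N') F i j i' j' w)
   <= 64 * (N%:R * N'%:R) + nu * (N%:R ^+ 2 * N'%:R ^+ 2).
  have E3 i j i' : (i < N)%N -> (j < N)%N -> (i' < N')%N ->
     Ex P (fun w => \sum_(0 <= j' < N') F i j i' j' w) <= gs i j * 8 + N'%:R * nu.
    move=> iN jN i'N; rewrite Ex_sum; last by move=> j' _; exact: mc.
    apply: (@le_trans _ _ (\sum_(0 <= j' < N') (gs i j * gs i' j' + nu))).
      rewrite big_nat_cond [leRHS]big_nat_cond.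
      by apply: ler_sum => j' /andP[/andP[_ j'N] _]; exact: EF.
    by rewrite big_split /= sumc -mulr_sumr lerD2r ler_wpM2l.
  have E2 i j : (i < N)%N -> (j < N)%N ->
     Ex P (fun w => \sum_(0 <= i' < N') \sum_(0 <= j' < N') F i j i' j' w) <=
     N'%:R * (gs i j * 8 + N'%:R * nu).
    move=> iN jN; rewrite Ex_sum; last by move=> i' _; exact: sF3.
    by apply: lsum => i' i'N; exact: E3.
  have E1 i : (i < N)%N ->
     Ex P (fun w => \sum_(0 <= j < N) \sum_(0 <= i' < N') \sum_(0 <= j' < N') F i j i' j' w) <=
     N'%:R * 64 + N%:R * (N'%:R * (N'%:R * nu)).
    move=> iN; rewrite Ex_sum; last by move=> j _; exact: sF2.
    apply: (@le_trans _ _ (\sum_(0 <= j < N) (N'%:R * 8 * gs i j + N'%:R * (N'%:R * nu)))).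
      rewrite big_nat_cond [leRHS]big_nat_cond.
      apply: ler_sum => j /andP[/andP[_ jN] _]; apply: le_trans (E2 i j iN jN) _.
      by rewrite le_eqVlt; apply/orP; left; apply/eqP; ring.
    rewrite big_split /= sumc -mulr_sumr lerD2r.
    apply: (@le_trans _ _ (N'%:R * 8 * 8)); first by rewrite ler_wpM2l ?mulr_ge0.
    by rewrite -mulrA; lra.
  rewrite Ex_sum; last by move=> i _; exact: sF1.
  apply: le_trans (lsum _ _ _ (fun i iN => E1 i iN)) _.
  by rewrite le_eqVlt; apply/orP; left; apply/eqP; ring.
apply: (@le_trans _ _ (Ex P (fun w => c * \sum_(0 <= i < N) \sum_(0 <= j < N) \sum_(0 <= i' < N') \sum_(0 <= j' < N') F i j i' j' w))).
  apply: Pr_le_Ex => //; first exact: summableZ.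
    by move=> w; rewrite -DD mulr_ge0// mulr_ge0// dirichlet2_ge0.
  move=> w Ew; rewrite -DD.
  have h : N%:R ^+ 2 / 4 * (N'%:R ^+ 2 / 4) <= dirichlet2 N (A w) * dirichlet2 N' (B w).
    by apply: ler_pM; rewrite ?divr_ge0 ?sqr_ge0// ?hA ?hB.
  apply: le_trans (ler_wpM2l c0 h).
  by rewrite le_eqVlt; apply/orP; left; apply/eqP; rewrite /c; field; rewrite !gt_eqF.
rewrite ExZ//; apply: le_trans (ler_wpM2l c0 big) _.
by rewrite le_eqVlt; apply/orP; left; apply/eqP; rewrite /c; field; rewrite !gt_eqF.
Qed.

Lemma small_ball1 (A B : T -> R) (N : nat) (rho D nu : R) :
  measurable_fun setT A -> measurable_fun setT B -> (0 < N)%N -> N%:R <= D ->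
  gauss_pair P A B rho D nu ->
  Pr P [set w | `|A w| <= N%:R^-1] <= 1024 / N%:R + 16 * nu.
Proof.
move=> mA mB N0 ND hg; have n0 : 0 < N%:R :> R by rewrite ltr0n.
rewrite -{2}[N%:R]mulr1.
apply: (@small_ball A B N 1) => //.
- exact: measurable_norm_le.
- by move=> w /= h; apply: dirichlet2_near; rewrite -ler_pdivlMr// div1r.
- move=> w _; rewrite /dirichlet2 !big_nat1 subrr mul0r cos0 expr1n; lra.
move=> i j [|//] [|//] iN jN _ _; rewrite subrr /gs subrr expr0n /= mul0r oppr0 expR0 mulr1.
have hD : `|i%:R - j%:R : R| <= D.
  apply: le_trans ND; rewrite ler_norml.
  have : i%:R <= N%:R :> R by rewrite ler_nat ltnW.
  have : j%:R <= N%:R :> R by rewrite ler_nat ltnW.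
  have : 0 <= i%:R :> R by []. have : 0 <= j%:R :> R by [].
  by move=> *; apply/andP; split; lra.
have D0 : `|0 : R| <= D by rewrite normr0 (le_trans _ ND).
have := hg 0 (i%:R - j%:R) 0 hD D0.
rewrite cos0 mul1r mulr0 expr0n /= !addr0.
rewrite (@eq_Ex _ _ _ P _ (fun w => cos ((i%:R - j%:R) * A w + 0 * B w))); last first.
  by move=> w; rewrite add0r.
set x := Ex P _; set y := expR _ => h.
have y0 : 0 <= y by exact: expR_ge0.
rewrite -[x](subrK y); apply: (le_trans (ler_normD _ _)); rewrite (ger0_norm y0) addrC.
by rewrite lerD2l.
Qed.

Lemma small_ball2 (A B : T -> R) (N N' : nat) (D nu : R) :
  measurable_fun setT A -> measurable_fun setT B -> (0 < N)%N -> (0 < N')%N ->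
  N%:R <= D -> N'%:R <= D -> gauss_pair P A B 0 D nu ->
  Pr P [set w | `|A w| <= N%:R^-1 /\ `|B w| <= N'%:R^-1] <=
    1024 / (N%:R * N'%:R) + 16 * nu.
Proof.
move=> mA mB N0 N'0 ND N'D hg; have n0 : 0 < N%:R :> R by rewrite ltr0n.
have n0' : 0 < N'%:R :> R by rewrite ltr0n.
apply: (@small_ball A B N N') => //.
- rewrite (_ : [set w | _] = [set w | `|A w| <= N%:R^-1] `&` [set w | `|B w| <= N'%:R^-1]).
    by apply: measurableI; exact: measurable_norm_le.
  by apply/seteqP; split.
- by move=> w /= [h _]; apply: dirichlet2_near; rewrite -ler_pdivlMr// div1r.
- by move=> w /= [_ h]; apply: dirichlet2_near; rewrite -ler_pdivlMr// div1r.
move=> i j i' j' iN jN iN' jN'.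
have hD (m a b : nat) : m%:R <= D -> (a < m)%N -> (b < m)%N -> `|a%:R - b%:R : R| <= D.
  move=> mD am bm; apply: le_trans mD; rewrite ler_norml.
  have : a%:R <= m%:R :> R by rewrite ler_nat ltnW.
  have : b%:R <= m%:R :> R by rewrite ler_nat ltnW.
  have : 0 <= a%:R :> R by []. have : 0 <= b%:R :> R by [].
  by move=> *; apply/andP; split; lra.
have := hg 0 _ _ (hD _ _ _ ND iN jN) (hD _ _ _ N'D iN' jN').
rewrite cos0 mul1r mulr0 !mul0r addr0.
rewrite (@eq_Ex _ _ _ P _ (fun w => cos ((i%:R - j%:R) * A w + (i'%:R - j'%:R) * B w))); last first.
  by move=> w; rewrite add0r.
have -> : gs i j * gs i' j' = expR (- (((i%:R - j%:R) ^+ 2 + (i'%:R - j'%:R) ^+ 2) / 2)).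
  by rewrite /gs -expRD; congr expR; field.
set x := Ex P _; set y := expR _ => h.
have y0 : 0 <= y by exact: expR_ge0.
rewrite -[x](subrK y); apply: (le_trans (ler_normD _ _)); rewrite (ger0_norm y0) addrC.
by rewrite lerD2l.
Qed.

End small_ball.

Section lincomb_gauss.
Context (R : realType) (e : R) (e0 : 0 < e) (e1 : e <= 1) (C : R) (C0 : 0 <= C).
Context (d : measure_display) (T : measurableType d) (P : probability T R).
Context (J : finType) (X : J -> {RV P >-> R}).
Hypotheses (hX : jointly_independent X) (nX : forall j, normalized e P C (X j)).

Lemma lincomb_cf (c : J -> R) (kappa a : R) : (forall j, `|c j| <= kappa) ->
  `|Ex P (fun w => cos (a + lincomb X c w)) -
    cos a * expR (- ((\sum_j c j ^+ 2) / 2))| <=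
  (3 * C + 1) * (kappa `^ e * \sum_j c j ^+ 2).
Proof.
move=> hc.
have := @Ex_cos_lincomb _ e e0 e1 C _ _ P J X hX nX (index_enum J) c a (index_enum_uniq J).
rewrite -mulr_suml => /le_trans; apply.
rewrite ler_wpM2l ?addr_ge0 ?mulr_ge0// mulr_sumr; apply: ler_sum => j _.
case: (eqVneq (c j) 0) => [->|cn0].
  by rewrite normr0 powR0 ?expr0n ?mulr0// gt_eqF// addr_gt0.
rewrite powRD; last by rewrite normr_eq0 cn0 implybT.
rewrite powR_mulrn// real_normK ?num_real// mulrC ler_wpM2r ?sqr_ge0//.
by apply: ge0_ler_powR; rewrite ?nnegrE ?(ltW e0)// (le_trans _ (hc j)).
Qed.

Lemma lincomb_gauss_pair (a b : J -> R) (kappa D rho : R) :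
  \sum_j a j ^+ 2 = 1 -> \sum_j b j ^+ 2 = 1 -> \sum_j a j * b j = rho ->
  (forall j, `|a j| <= kappa) -> (forall j, `|b j| <= kappa) ->
  `|rho| <= 1 -> 0 <= D ->
  gauss_pair P (lincomb X a) (lincomb X b) rho D
    ((3 * C + 1) * ((2 * D * kappa) `^ e * (4 * D ^+ 2))).
Proof.
move=> a1 b1 ab ha hb r1 D0 x l m lD mD.
pose c j := l * a j + m * b j.
have hc j : `|c j| <= 2 * D * kappa.
  apply: (le_trans (ler_normD _ _)); rewrite !normrM.
  have k0 : 0 <= kappa by exact: le_trans (ha j).
  have := ler_pM (normr_ge0 l) (normr_ge0 (a j)) lD (ha j).
  have := ler_pM (normr_ge0 m) (normr_ge0 (b j)) mD (hb j); lra.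
have sc : \sum_j c j ^+ 2 = l ^+ 2 + m ^+ 2 + 2 * rho * l * m.
  rewrite (eq_bigr (fun j => l ^+ 2 * a j ^+ 2 + m ^+ 2 * b j ^+ 2 + (2 * l * m) * (a j * b j))).
    by rewrite !big_split /= -!mulr_sumr a1 b1 ab; ring.
  by move=> j _; rewrite /c; ring.
have := lincomb_cf x hc.
rewrite sc (@eq_Ex _ _ _ P _ (fun w => cos (x + (l * lincomb X a w + m * lincomb X b w)))); last first.
  move=> w; congr (cos (x + _)); rewrite /lincomb !mulr_sumr -big_split /=.
  by apply: eq_bigr => j _; rewrite /c; ring.
move=> /le_trans; apply; rewrite ler_wpM2l ?addr_ge0 ?mulr_ge0//.
rewrite ler_wpM2l ?powR_ge0//.
have l2 : l ^+ 2 <= D ^+ 2.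
  by rewrite -[l ^+ 2]real_normK ?num_real// lerXn2r ?nnegrE.
have m2 : m ^+ 2 <= D ^+ 2.
  by rewrite -[m ^+ 2]real_normK ?num_real// lerXn2r ?nnegrE.
have : rho * l * m <= D ^+ 2.
  apply: (le_trans (ler_norm _)); rewrite !normrM expr2.
  apply: ler_pM; rewrite ?mulr_ge0// -[leRHS]mul1r; exact: ler_pM.
lra.
Qed.

End lincomb_gauss.

(** * Neighbouring values of a random linear form *)

Section neighbouring_values.
Context (R : realType) (e : R) (e0 : 0 < e) (e1 : e <= 1) (C : R) (C0 : 0 <= C).
Context (d : measure_display) (T : measurableType d) (P : probability T R).
Context (J : finType) (X : J -> {RV P >-> R}).
Hypotheses (hX : jointly_independent X) (nX : forall j, normalized e P C (X j)).
Context (k : nat) (k4 : (4 <= k)%N) (a b : J -> R) (kappa : R).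
Hypotheses (a1 : \sum_j a j ^+ 2 = 1) (b1 : \sum_j b j ^+ 2 = 1).
Hypothesis ab : \sum_j a j * b j = cos (wedge_angle R k).
Hypotheses (ha : forall j, `|a j| <= kappa) (hb : forall j, `|b j| <= kappa).
Hypothesis kappa0 : 0 <= kappa.

Let al := wedge_angle R k.

Let k0 : 0 < k%:R :> R. Proof. by rewrite ltr0n; lia. Qed.

Lemma sin_wedge_ge : k%:R^-1 <= sin al.
Proof.
have p4 : pi / 2 <= 2 :> R by rewrite ltW// pihalf_lt2.
have p2 : 2 <= pi :> R by exact: pi_ge2.
have k4' : 4 <= k%:R :> R by rewrite (ler_nat R 4).
have al1 : al <= 1 by rewrite /al /wedge_angle ler_pdivrMr// mul1r; lra.
have al0 : 0 <= al by rewrite divr_ge0// ?(ltW k0)// pi_ge0.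
have h := sin_ge_cubic al0.
have h3 : al ^+ 3 <= al by rewrite exprS ler_piMr// expr_le1.
have : 2 * k%:R^-1 <= al by rewrite /al /wedge_angle ler_pM2r// invr_gt0.
have ki : 0 < k%:R^-1 :> R by rewrite invr_gt0.
lra.
Qed.

Let s0 : 0 < sin al.
Proof. by apply: lt_le_trans sin_wedge_ge; rewrite invr_gt0. Qed.

(** The second vector of the orthonormal basis in which [b] is [a] turned by
    the wedge angle. *)
Definition gram_schmidt j : R := (b j - cos al * a j) / sin al.

Let z := gram_schmidt.

Lemma gram_schmidt_norm : \sum_j z j ^+ 2 = 1.
Proof.
rewrite (eq_bigr (fun j => (sin al) ^- 2 * (b j ^+ 2 + (- (2 * cos al)) * (a j * b j) + cos al ^+ 2 * a j ^+ 2))); last first.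
  by move=> j _; rewrite /z /gram_schmidt; field; rewrite gt_eqF.
rewrite -mulr_sumr !big_split /= -!mulr_sumr a1 b1 ab -/al.
rewrite (_ : _ + _ = sin al ^+ 2); last by rewrite sin2cos2; ring.
by rewrite mulVf// sqrf_eq0 gt_eqF.
Qed.

Lemma gram_schmidt_orth : \sum_j a j * z j = 0.
Proof.
rewrite (eq_bigr (fun j => (sin al)^-1 * (a j * b j + (- cos al) * a j ^+ 2))); last first.
  by move=> j _; rewrite /z /gram_schmidt; field; rewrite gt_eqF.
rewrite -mulr_sumr big_split /= -!mulr_sumr a1 ab -/al.
by rewrite mulr1 subrr mulr0.
Qed.

Lemma gram_schmidt_small j : `|z j| <= 2 * k%:R * kappa.
Proof.
rewrite /z /gram_schmidt normrM normfV (gtr0_norm s0).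
have h1 : `|b j - cos al * a j| <= 2 * kappa.
  apply: (le_trans (ler_normB _ _)); rewrite normrM.
  have := ler_pM (normr_ge0 (cos al)) (normr_ge0 (a j)) (cos_max al) (ha j).
  have := hb j; lra.
have h2 : (sin al)^-1 <= k%:R.
  by rewrite invf_ple ?posrE//; exact: sin_wedge_ge.
rewrite (_ : 2 * k%:R * kappa = 2 * kappa * k%:R); last by ring.
by apply: ler_pM => //; rewrite invr_ge0 ltW.
Qed.

Let u (t : R) j := cos t * a j + sin t * z j.

Let u_dot t t' : \sum_j u t j * u t' j = cos (t - t').
Proof.
rewrite (eq_bigr (fun j => cos t * cos t' * a j ^+ 2 + sin t * sin t' * z j ^+ 2 +
   (cos t * sin t' + sin t * cos t') * (a j * z j))); last by move=> j _; rewrite /u; ring.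
rewrite !big_split /= -!mulr_sumr a1 gram_schmidt_norm gram_schmidt_orth cosB.
by rewrite !mulr1 mulr0 addr0.
Qed.

Let u_small t j : `|u t j| <= 3 * k%:R * kappa.
Proof.
apply: (le_trans (ler_normD _ _)); rewrite (normrM (cos t)) (normrM (sin t)).
have := ler_pM (normr_ge0 (cos t)) (normr_ge0 (a j)) (cos_max t) (ha j).
have := ler_pM (normr_ge0 (sin t)) (normr_ge0 (z j)) (sin_max t) (gram_schmidt_small j).
have : kappa <= k%:R * kappa.
  by rewrite ler_peMl// ler1n; lia.
lra.
Qed.

Let u_norm t : \sum_j u t j ^+ 2 = 1.
Proof.
rewrite (eq_bigr (fun j => u t j * u t j)); last by move=> j _; rewrite expr2.
by rewrite u_dot subrr cos0.
Qed.

Let lu t w : lincomb X (u t) w = cos t * lincomb X a w + sin t * lincomb X z w.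
Proof.
rewrite /lincomb !mulr_sumr -big_split /=; apply: eq_bigr => j _.
by rewrite /u; ring.
Qed.

Context (D : R) (D0 : 0 <= D).

Definition clt_error : R :=
  (3 * C + 1) * ((2 * D * (3 * k%:R * kappa)) `^ e * (4 * D ^+ 2)).

Let sinusoidE j w : sinusoid k (lincomb X a w) (lincomb X z w) j =
  lincomb X (u (j%:R * al)) w.
Proof. by rewrite lu. Qed.

(** The form [b] is [a] turned by the wedge angle towards [gram_schmidt], so both
    values are consecutive values of one random sinusoid. *)
Lemma sign_change_prob (m N : nat) (L p : R) :
  (0 < N)%N -> N%:R <= D -> 0 < L -> (2 * m%:R + 1) / L <= D ->
  1024 / N%:R + 16 * clt_error <= p -> 1 / L ^+ 2 <= p ->
  let E := wedge_error m N%:R^-1 L clt_error p in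
  1 / k%:R - E <= Pr P [set w | lincomb X a w * lincomb X b w < 0] /\
  Pr P [set w | lincomb X a w * lincomb X b w <= 0] <= 1 / k%:R + E.
Proof.
move=> N0 ND L0 mD hp hL E.
have gp t t' rho : rho = cos (t - t') ->
    gauss_pair P (lincomb X (u t)) (lincomb X (u t')) rho D clt_error.
  move=> ->; apply: lincomb_gauss_pair => //; exact: cos_max.
have sX j : (fun w => sinusoid k (lincomb X a w) (lincomb X z w) j) =
   lincomb X (u (j%:R * al)) by apply/funext => w; exact: sinusoidE.
have Xa : lincomb X a = lincomb X (u (0%:R * al)).
  by apply/funext => w; rewrite lu mul0r cos0 sin0 mul1r mul0r addr0.
have Xb : lincomb X b = lincomb X (u (1%:R * al)).
  apply/funext => w; apply: eq_bigr => j _; congr (_ * _).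
  by rewrite mul1r /u /z /gram_schmidt; field; rewrite gt_eqF.
have := @wedge_probability R _ _ P k (leq_trans (isT : (2 <= 4)%N) k4)
   (lincomb X a) (lincomb X z) (measurable_lincomb X a) (measurable_lincomb X z)
   m N%:R^-1 L D clt_error p.
rewrite invr_gt0 ltr0n N0 => /(_ isT L0 mD).
have -> : [set w | sinusoid k (lincomb X a w) (lincomb X z w) 0 *
   sinusoid k (lincomb X a w) (lincomb X z w) 1 < 0] =
   [set w | lincomb X a w * lincomb X b w < 0].
  by apply/seteqP; split => w /=; rewrite !sinusoidE Xa Xb.
have -> : [set w | sinusoid k (lincomb X a w) (lincomb X z w) 0 *
   sinusoid k (lincomb X a w) (lincomb X z w) 1 <= 0] =
   [set w | lincomb X a w * lincomb X b w <= 0].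
  by apply/seteqP; split => w /=; rewrite !sinusoidE Xa Xb.
apply.
  move=> j jk; have -> : [set w | `|sinusoid k (lincomb X a w) (lincomb X z w) j| <= N%:R^-1] =
     [set w | `|lincomb X (u (j%:R * al)) w| <= N%:R^-1].
    by apply/seteqP; split => w /=; rewrite sinusoidE.
  have -> : [set w | L < `|sinusoid k (lincomb X a w) (lincomb X z w) j|] =
     [set w | L < `|lincomb X (u (j%:R * al)) w|].
    by apply/seteqP; split => w /=; rewrite sinusoidE.
  split.
    apply: le_trans hp; apply: (small_ball1 (rho := cos (0 : R)) (D := D) (B := lincomb X (u (j%:R * al)))) => //.
    - exact: measurable_lincomb.
    - exact: measurable_lincomb.
    - by apply: gp; rewrite subrr.
  by have := Pr_lincomb_gt hX nX (u (j%:R * al)) L0; rewrite u_norm => /le_trans; apply.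
move=> j jk; rewrite !sX; apply: gp.
by rewrite -[RHS]cosN opprB -mulrBl -natr1 addrAC subrr add0r mul1r.
Qed.

(** The forms [a] and [gram_schmidt] are compared with two independent
    Gaussians; the factor [2 * k] pays for the division by the sine of the wedge
    angle. *)
Lemma both_small_prob (N1 N2 : nat) (r : R) : (0 < N1)%N -> (0 < N2)%N ->
  N1%:R <= D -> N2%:R <= D -> r <= N1%:R^-1 -> 2 * k%:R * r <= N2%:R^-1 ->
  Pr P [set w | `|lincomb X a w| <= r /\ `|lincomb X b w| <= r] <=
    1024 / (N1%:R * N2%:R) + 16 * clt_error.
Proof.
move=> N10 N20 N1D N2D r1 r2.
have uz t j : `|cos t * a j + sin t * z j| <= 3 * k%:R * kappa by exact: u_small.
have ha3 j : `|a j| <= 3 * k%:R * kappa.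
  by have := uz 0 j; rewrite cos0 sin0 mul1r mul0r addr0.
have hz3 j : `|z j| <= 3 * k%:R * kappa.
  by have := uz (pi / 2) j; rewrite cos_pihalf sin_pihalf mul1r mul0r add0r.
have gp : gauss_pair P (lincomb X a) (lincomb X z) 0 D clt_error.
  apply: lincomb_gauss_pair => //; first exact: gram_schmidt_norm.
  - exact: gram_schmidt_orth.
  - by rewrite normr0.
have zE w : lincomb X z w = (lincomb X b w - cos al * lincomb X a w) / sin al.
  rewrite /lincomb mulrBl mulr_sumr mulr_suml [X in _ - X]mulr_suml -sumrB.
  by apply: eq_bigr => j _; rewrite /z /gram_schmidt; ring.
have ma := measurable_lincomb X a; have mb := measurable_lincomb X b.
have mz := measurable_lincomb X z.
have m2 (f g : T -> R) x y : measurable_fun setT f -> measurable_fun setT g ->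
    measurable [set w | `|f w| <= x /\ `|g w| <= y].
  move=> mf mg; rewrite (_ : [set w | _] = [set w | `|f w| <= x] `&` [set w | `|g w| <= y]).
    by apply: measurableI; exact: measurable_norm_le.
  by apply/seteqP; split.
apply: le_trans (small_ball2 ma mz N10 N20 N1D N2D gp).
apply: Pr_le; [exact: m2|exact: m2|move=> w /= [h1 h2]; split].
  exact: le_trans r1.
apply: le_trans r2; rewrite zE normrM normfV (gtr0_norm s0).
have h3 : (sin al)^-1 <= k%:R.
  by rewrite invf_ple ?posrE//; exact: sin_wedge_ge.
rewrite (_ : 2 * k%:R * r = 2 * r * k%:R); last by ring.
apply: ler_pM => //; first by rewrite invr_ge0 ltW.
apply: (le_trans (ler_normB _ _)); rewrite normrM.
have := ler_pM (normr_ge0 (cos al)) (normr_ge0 _) (cos_max al) h1; lra.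
Qed.

End neighbouring_values.

(** * Binomial weights *)

Section binomial_weights.
Context (R : realType) (n : nat) (p : R).
Hypotheses (p0 : 0 < p) (p1 : p < 1).

Definition binom_weight (i : nat) : R := 'C(n, i)%:R * (p ^+ i * (1 - p) ^+ (n - i)).

Local Notation u := binom_weight.
Local Notation q := (1 - p).
Local Notation s2 := (n%:R * p * (1 - p)).

Let q0 : 0 < q. Proof. by rewrite subr_gt0. Qed.

Lemma binom_weight_ge0 i : 0 <= u i.
Proof. by rewrite !mulr_ge0// exprn_ge0// ltW. Qed.

Lemma binom_weight_big i : (n < i)%N -> u i = 0.
Proof. by move=> ni; rewrite /u bin_small// mul0r. Qed.

Lemma binom_weight_sum : \sum_(0 <= i < n.+1) u i = 1.
Proof.
have := exprDn q p n; rewrite subrK expr1n big_mkord => E; rewrite [RHS]E.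
by apply: eq_bigr => i _; rewrite -[RHS]mulr_natl /u (mulrC (p ^+ i)).
Qed.

Lemma binom_weight_rec i :
  (i.+1%:R * q) * u i.+1 = (i.+1%:R * q - (i.+1%:R - n.+1%:R * p)) * u i.
Proof.
rewrite [X in _ = X * _](_ : _ = (n%:R - i%:R) * p); last by rewrite -!natr1; ring.
case: (leqP n i) => ni.
  rewrite binom_weight_big ?ltnS//; move: ni; rewrite leq_eqVlt => /orP[/eqP->|ni].
    by rewrite subrr !mul0r mulr0.
  by rewrite (binom_weight_big ni) !mulr0.
rewrite /u -natrB ?(ltnW ni)// (_ : (n - i)%N = (n - i.+1).+1); last by lia.
rewrite !exprS.
transitivity ((i.+1 * 'C(n, i.+1))%:R * (q * (p * p ^+ i * q ^+ (n - i.+1)))).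
  by rewrite natrM; ring.
rewrite mul_bin_left natrM (_ : (n - i)%N = (n - i.+1).+1); last by lia.
by ring.
Qed.

Lemma binom_mode_exists : exists2 m, (m <= n)%N & forall i, u i <= u m.
Proof.
case: (arg_maxP (fun i : 'I_n.+1 => u i) (erefl (xpredT ord0))) => m _ hm.
exists m; first by rewrite -ltnS.
move=> i; case: (ltnP i n.+1) => [iN|ni]; first exact: (hm (Ordinal iN)).
by rewrite binom_weight_big ?binom_weight_ge0.
Qed.

Section mode.
Context (m : nat) (mn : (m <= n)%N) (um : forall i, u i <= u m).
Hypothesis s0 : 0 < s2.

Lemma binom_mode_ge : n.+1%:R^-1 <= u m.
Proof.
rewrite -div1r ler_pdivrMr ?ltr0n// -[leLHS]binom_weight_sum.
apply: (@le_trans _ _ (\sum_(0 <= i < n.+1) u m)); first by apply: ler_sum.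
by rewrite big_const_nat iter_addr addr0 subn0 mulr_natr.
Qed.

Let um0 : 0 < u m.
Proof. by apply: lt_le_trans binom_mode_ge; rewrite invr_gt0 ltr0n. Qed.

Lemma binom_mode_loc : n.+1%:R * p - 1 <= m%:R <= n.+1%:R * p.
Proof.
apply/andP; split.
  have := binom_weight_rec m; have := um m.+1 => h1 h2.
  have mq : 0 < m.+1%:R * q by rewrite mulr_gt0 ?ltr0n.
  have : m.+1%:R * q * u m.+1 <= m.+1%:R * q * u m by rewrite ler_pM2l.
  rewrite h2 ler_pM2r// -natr1; lra.
case: m mn um um0 => [|m'] mn' um' um0'; first by rewrite mulr_ge0// ltW.
have := binom_weight_rec m'; have := um' m' => h1 h2.
have mq : 0 < m'.+1%:R * q by rewrite mulr_gt0 ?ltr0n.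
have c0 : 0 <= m'.+1%:R * q - (m'.+1%:R - n.+1%:R * p).
  rewrite [leRHS](_ : _ = (n%:R - m'%:R) * p); last by rewrite -!natr1; ring.
  by rewrite mulr_ge0 ?(ltW p0)// subr_ge0 ler_nat ltnW.
have : m'.+1%:R * q * u m'.+1 <= (m'.+1%:R * q - (m'.+1%:R - n.+1%:R * p)) * u m'.+1.
  by rewrite h2 ler_wpM2l.
rewrite ler_pM2r//; lra.
Qed.

Lemma binom_step_lower d : (1 - d.+1%:R / s2) * u (m + d) <= u (m + d).+1.
Proof.
have /andP[m1 m2] := binom_mode_loc.
set i := (m + d)%N.
have iq : 0 < i.+1%:R * q by rewrite mulr_gt0 ?ltr0n.
rewrite -(ler_pM2l iq) binom_weight_rec mulrA ler_wpM2r ?binom_weight_ge0//.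
rewrite mulrBr mulr1 lerD2l lerN2 /i -natr1 natrD -natr1.
apply: (@le_trans _ _ (d%:R + 1)); first by lra.
rewrite -natr1 mulrA ler_pdivlMr// mulrC ler_wpM2r ?addr_ge0//.
rewrite ler_pM2r//; apply: (@le_trans _ _ (n.+1%:R * p)).
  by rewrite ler_pM2r// ler_nat.
by have : 0 <= d%:R :> R by []; lra.
Qed.

Lemma binom_step_upper d : d%:R + 2 <= s2 ->
  u (m + d).+1 <= (1 - d%:R / (2 * s2)) * u (m + d).
Proof.
move=> ds; have /andP[m1 m2] := binom_mode_loc.
set i := (m + d)%N.
have iq : 0 < i.+1%:R * q by rewrite mulr_gt0 ?ltr0n.
rewrite -(ler_pM2l iq) binom_weight_rec [leRHS]mulrA ler_wpM2r ?binom_weight_ge0//.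
rewrite [leRHS]mulrBr mulr1 lerD2l lerN2 /i.
have -> : (m + d).+1%:R = m%:R + d%:R + 1 :> R by rewrite -natr1 natrD.
apply: (@le_trans _ _ d%:R); last by lra.
have s20 : 0 < 2 * s2 by rewrite mulr_gt0.
rewrite [leLHS]mulrA ler_pdivrMr// [leLHS]mulrC ler_wpM2l//.
have np : s2 <= n%:R * p.
  by rewrite ler_piMr ?mulr_ge0 ?(ltW p0)// gerBl ltW.
rewrite [leRHS](_ : _ = 2 * (n%:R * p) * q); last by ring.
rewrite ler_pM2r//.
have : m%:R <= n%:R * p + p by move: m2; rewrite -[n.+1%:R]natr1 mulrDl mul1r.
move: p1 np ds; set v := n%:R * p; lra.
Qed.

Lemma binom_plateau d : d%:R <= s2 -> (1 - d%:R ^+ 2 / s2) * u m <= u (m + d).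
Proof.
elim: d => [|d IH] ds; first by rewrite addn0 expr0n /= mul0r subr0 mul1r.
have ds' : d%:R <= s2 by apply: le_trans ds; rewrite ler_nat.
rewrite addnS; apply: le_trans (binom_step_lower d).
have c0 : 0 <= 1 - d.+1%:R / s2 by rewrite subr_ge0 ler_pdivrMr// mul1r.
apply: le_trans (ler_wpM2l c0 (IH ds')).
rewrite [leRHS]mulrA ler_wpM2r ?binom_weight_ge0//.
have si : 0 < s2^-1 by rewrite invr_gt0.
have d0 : 0 <= d%:R :> R by [].
rewrite -natr1; move: si; set x := s2^-1 => x0.
have : 0 <= d%:R * x by rewrite mulr_ge0// ltW.
have : 0 <= (d%:R ^+ 2 * x) * ((d%:R + 1) * x).
  by rewrite !mulr_ge0 ?sqr_ge0 ?addr_ge0// ltW.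
lra.
Qed.

(** The weights stay comparable with the largest one over a standard deviation,
    and their sum is 1. *)
Lemma binom_max_le i : u i * Num.sqrt s2 <= 3.
Proof.
have S0 : 0 <= Num.sqrt s2 by exact: sqrtr_ge0.
apply: (@le_trans _ _ (u m * Num.sqrt s2)); first by rewrite ler_wpM2r.
case: (leP (Num.sqrt s2) 2) => s4.
  have : u m <= 1.
    rewrite -[leRHS]binom_weight_sum (bigD1_seq m) ?iota_uniq ?mem_index_iota//= lerDl.
    by apply: sumr_ge0 => j _; exact: binom_weight_ge0.
  have := um0; nra.
have [L /andP[L1 L2]] : exists L : nat, L%:R <= Num.sqrt s2 / 2 < L.+1%:R.
  exists (Num.truncn (Num.sqrt s2 / 2)); apply: truncn_itv.
  by rewrite divr_ge0.
have sq : Num.sqrt s2 ^+ 2 = s2 by rewrite sqr_sqrtr// ltW.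
have Ls : L%:R ^+ 2 <= s2 / 4.
  have L0 : 0 <= L%:R :> R by [].
  by rewrite -sq; nra.
have h : L.+1%:R * (3 / 4 * u m) <= 1.
  apply: (@le_trans _ _ (\sum_(0 <= d < L.+1) u (m + d))).
    rewrite [leLHS](_ : _ = \sum_(0 <= d < L.+1) (3 / 4 * u m)); last first.
      by rewrite big_const_nat iter_addr addr0 subn0 [LHS]mulr_natl.
    rewrite big_nat_cond [leRHS]big_nat_cond; apply: ler_sum => d /andP[/andP[_ dL] _].
    have dL' : d%:R <= L%:R :> R by rewrite ler_nat -ltnS.
    have L0 : 0 <= d%:R :> R by [].
    have ds : d%:R <= s2.
      by apply: (le_trans dL'); apply: (le_trans L1); rewrite -[leRHS]sq; nra.
    apply: le_trans (binom_plateau ds); rewrite ler_wpM2r ?binom_weight_ge0//.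
    have : d%:R ^+ 2 / s2 <= 1 / 4.
      rewrite ler_pdivrMr//; apply: (@le_trans _ _ (L%:R ^+ 2)); last by lra.
      by rewrite lerXn2r ?nnegrE.
    lra.
  apply: (@le_trans _ _ (\sum_(0 <= i < n.+1 + (m + L.+1)) u i)).
    have -> : \sum_(0 <= d < L.+1) u (m + d) = \sum_(m <= i < m + L.+1) u i.
      rewrite -[m in RHS]add0n big_addn add0n addKn.
      by apply: eq_bigr => j _; rewrite addnC.
    have le1 : (0 <= m)%N by [].
    have le2 : (m <= n.+1 + (m + L.+1))%N by rewrite addnCA leq_addr.
    have le3 : (m <= m + L.+1)%N by exact: leq_addr.
    have le4 : (m + L.+1 <= n.+1 + (m + L.+1))%N by exact: leq_addl.
    rewrite (big_cat_nat le1 le2) (big_cat_nat le3 le4) /=.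
    apply: ler_wpDl; first by apply: sumr_ge0 => j _; exact: binom_weight_ge0.
    by apply: ler_wpDr => //; apply: sumr_ge0 => j _; exact: binom_weight_ge0.
  have le5 : (n.+1 <= n.+1 + (m + L.+1))%N by exact: leq_addr.
  rewrite (big_cat_nat (leq0n n.+1) le5) /=.
  rewrite binom_weight_sum big_nat_cond big1 ?addr0// => j /andP[/andP[nj _] _].
  exact: binom_weight_big.
have := um0; nra.
Qed.

End mode.
End binomial_weights.

Section lacunary_binomial.
Context (R : realType) (n : nat) (p : R).
Hypotheses (p0 : 0 < p) (p1 : p < 1).
Local Notation u := (binom_weight n p).
Local Notation s2 := (n%:R * p * (1 - p)).
Context (m : nat) (mn : (m <= n)%N) (um : forall i, u i <= u m).
Hypothesis s0 : 0 < s2.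

Lemma expR_le_half (x : R) : 0 <= x -> x <= 1 / 2 -> expR (- (2 * x)) <= 1 - x.
Proof.
move=> x0 x1; have x20 : 0 <= 2 * x by rewrite mulr_ge0.
apply: (le_trans (expRN_le_quad x20)); nra.
Qed.

Lemma binom_tail_lower (D d : nat) : (d <= D)%N -> D%:R <= s2 / 2 ->
  u m * expR (- (2 * (d%:R * D%:R / s2))) <= u (m + d).
Proof.
move=> + Ds; elim: d => [|d IH] dD.
  by rewrite addn0 !mul0r mulr0 oppr0 expR0 mulr1.
have dD' : d.+1%:R <= D%:R :> R by rewrite ler_nat.
rewrite addnS; apply: le_trans (binom_step_lower p0 p1 mn um s0 d).
rewrite [X in expR X](_ : _ = - (2 * (D%:R / s2)) - (2 * (d%:R * D%:R / s2))); last first.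
  by rewrite -natr1; ring.
rewrite expRD mulrCA; apply: ler_pM.
- exact: expR_ge0.
- by rewrite mulr_ge0 ?expR_ge0// binom_weight_ge0.
- have h : expR (- (2 * (d.+1%:R / s2))) <= 1 - d.+1%:R / s2.
    apply: expR_le_half; first by rewrite divr_ge0// ltW.
    by rewrite ler_pdivrMr//; lra.
  apply: le_trans h; rewrite ler_expR lerN2 ler_pM2l// ler_pM2r// invr_gt0//.
exact: IH (ltnW dD).
Qed.

Lemma binom_tail_ratio (d0 D : nat) : d0%:R + D%:R + 2 <= s2 ->
  u (m + d0 + D) <= expR (- (d0%:R * D%:R / (2 * s2))) * u (m + d0).
Proof.
elim: D => [|D IH] hD.
  by rewrite addn0 mulr0 mul0r oppr0 expR0 mul1r.
have D1 : D.+1%:R = D%:R + 1 :> R by rewrite -natr1.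
have ID : d0%:R + D%:R + 2 <= s2 by move: hD; rewrite D1; lra.
rewrite addnS -addnA.
have hs : (d0 + D)%:R + 2 <= s2 by rewrite natrD.
apply: (le_trans (binom_step_upper p0 p1 mn um s0 hs)).
rewrite [X in expR X](_ : _ = - (d0%:R / (2 * s2)) - (d0%:R * D%:R / (2 * s2))); last first.
  by rewrite D1; ring.
rewrite expRD -[leRHS]mulrA; apply: (@le_trans _ _ (expR (- (d0%:R / (2 * s2))) * u (m + (d0 + D)))).
  rewrite ler_wpM2r ?binom_weight_ge0//.
  have s20 : 0 < 2 * s2 by rewrite pmulr_rgt0.
  apply: le_trans (expR_ge1Dx _); rewrite lerB// ler_pM2r ?invr_gt0//.
  by rewrite natrD lerDl.
by rewrite ler_wpM2l ?expR_ge0// addnA; exact: IH.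
Qed.

End lacunary_binomial.

Section lacunary_weights.
Context (R : realType).

Lemma lacunary_geometric (J : finType) (a : J -> R) (M r t : R) (L : seq J) (l : nat) :
  0 <= M -> 0 <= t -> (size L <= l)%N -> M * (l%:R * t) <= 1 / 4 ->
  (forall j, j \in L -> r <= `|a j| / 4) ->
  pairwise (fun i j => `|a j| <= t * `|a i|) L -> lacunary a M r L.
Proof.
move=> M0 t0; elim: L => //= j L IH sL hM hr /andP[/allP hj hp].
apply/andP; split; last first.
  by apply: IH => //; [exact: ltnW|move=> i iL; apply: hr; rewrite inE iL orbT].
have h1 : \sum_(i <- L) `|a i| <= l%:R * t * `|a j|.
  apply: (@le_trans _ _ (\sum_(i <- L) t * `|a j|)).
    by rewrite big_seq [leRHS]big_seq; apply: ler_sum => i iL; exact: hj.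
  rewrite big_const_seq count_predT iter_addr addr0 -[leLHS]mulr_natl mulrA.
  by rewrite !ler_wpM2r// ler_nat ltnW.
have h2 := hr j (mem_head _ _).
have := ler_wpM2l M0 h1.
have := ler_wpM2r (normr_ge0 (a j)) hM.
move: (\sum_(_ <- _) _) => S; lra.
Qed.

(** Beyond the mode, at distances of several standard deviations, the weights
    drop by a huge factor over a few standard deviations while staying above
    [exp (- 9 l^4) / (n + 1)]. *)
Lemma lacunary_binomial_chain (n : nat) (p : R) (w : 'I_n.+1 -> R) (l : nat) (M : R) :
  0 < p -> p < 1 -> (forall i, w i ^+ 2 = binom_weight n p i) ->
  (0 < l)%N -> 16 * l%:R ^+ 2 <= Num.sqrt (n%:R * p * (1 - p)) ->
  0 <= M -> M * (l%:R * expR (- l%:R ^+ 2)) <= 1 / 4 ->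
  exists L : seq 'I_n.+1, [/\ uniq L, size L = l &
    lacunary w M (expR (- (9 * l%:R ^+ 4)) / (4 * n.+1%:R)) L].
Proof.
move=> p0 p1 hw l0 hS M0 hM.
set s2 := n%:R * p * (1 - p) in hS *; set S := Num.sqrt s2 in hS *.
have l1 : 1 <= l%:R :> R by rewrite ler1n.
have S16 : 16 <= S by apply: le_trans hS; have := l1; nra.
have s0 : 0 < s2 by rewrite -sqrtr_gt0 -/S; lra.
have sq : S ^+ 2 = s2 by rewrite sqr_sqrtr// ltW.
have [m mn um] := binom_mode_exists n p0 p1.
have [D /andP[D1 D2]] : exists D : nat, 2 * l%:R * S <= D%:R <= 3 * l%:R * S.
  have [/andP[t1 t2]] : (Num.truncn (2 * l%:R * S))%:R <= 2 * l%:R * S <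
     (Num.truncn (2 * l%:R * S)).+1%:R.
    by apply: truncn_itv; rewrite !mulr_ge0 ?sqrtr_ge0.
  exists (Num.truncn (2 * l%:R * S)).+1; rewrite (ltW t2) /= -natr1.
  have : 1 <= l%:R * S by have := l1; nra.
  lra.
have D0 : (0 < D)%N by rewrite -(ltr0n R); apply: lt_le_trans D1; rewrite !mulr_gt0//; lra.
have lD : (l * D)%:R <= s2 / 2 - 2.
  rewrite natrM -sq; apply: (@le_trans _ _ (l%:R * (3 * l%:R * S))).
    by rewrite ler_wpM2l.
  have : l%:R ^+ 2 * S <= S / 16 * S by rewrite ler_wpM2r; lra.
  have : 2 <= S / 8 * S by have := S16; nra.
  nra.
pose idx j := (m + j.+1 * D)%N.
have dl j : (j < l)%N -> (j.+1 * D <= l * D)%N by move=> jl; rewrite leq_mul2r jl orbT.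
have ulow j : (j < l)%N -> (expR (- (9 * l%:R ^+ 4)) / n.+1%:R) ^+ 2 <= binom_weight n p (idx j).
  move=> jl; have lD' : (l * D)%:R <= s2 / 2 by lra.
  apply: le_trans (binom_tail_lower p0 p1 mn um s0 (dl j jl) lD').
  rewrite exprMn [leLHS]mulrC; apply: ler_pM; rewrite ?sqr_ge0//.
    apply: le_trans (binom_mode_ge um).
    rewrite exprVn lef_pV2 ?posrE ?exprn_gt0 ?ltr0n// -natrX ler_nat.
    by rewrite -[X in (X <= _)%N]expn1 leq_pexp2l.
  rewrite -expRM_natl ler_expR mulrN lerN2.
  apply: (@le_trans _ _ (2 * ((l * D)%:R * (l * D)%:R / s2))).
    rewrite ler_pM2l// ler_pM2r ?invr_gt0// ler_wpM2r//.
    by rewrite ler_nat dl.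
  rewrite ler_pM2l// ler_pdivrMr// natrM -sq.
  have h : l%:R * D%:R <= 3 * l%:R ^+ 2 * S.
    apply: (@le_trans _ _ (l%:R * (3 * l%:R * S))); first by rewrite ler_wpM2l.
    by rewrite le_eqVlt; apply/orP; left; apply/eqP; ring.
  have lD0 : 0 <= l%:R * D%:R :> R by rewrite mulr_ge0.
  apply: le_trans (ler_pM lD0 lD0 h h) _.
  by rewrite le_eqVlt; apply/orP; left; apply/eqP; ring.
have idxn j : (j < l)%N -> (idx j < n.+1)%N.
  move=> jl; rewrite ltnNge; apply/negP => ni; have := ulow j jl.
  rewrite binom_weight_big// leNgt exprn_gt0// divr_gt0 ?expR_gt0//.
pose o j : 'I_n.+1 := inord (idx j).
have oE j : (j < l)%N -> o j = idx j :> nat by move=> jl; rewrite inordK ?idxn.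
have ratio i j : (i < j)%N -> (j < l)%N -> `|w (o j)| <= expR (- l%:R ^+ 2) * `|w (o i)|.
  move=> ij jl; have il := ltn_trans ij jl.
  rewrite -[leRHS]ger0_norm ?mulr_ge0 ?expR_ge0// -ler_sqr ?nnegrE ?normr_ge0//.
  rewrite normrM normr_id (ger0_norm (expR_ge0 _)) exprMn !real_normK ?num_real//.
  rewrite !hw !oE// -expRM_natl.
  have -> : idx j = (m + i.+1 * D + (j - i) * D)%N.
    by rewrite /idx -addnA -mulnDl addSn subnKC// ltnW.
  have hD : (i.+1 * D)%:R + ((j - i) * D)%:R + 2 <= s2.
    rewrite -natrD -mulnDl addSn subnKC ?(ltnW ij)//.
    have : (j.+1 * D)%:R <= (l * D)%:R :> R by rewrite ler_nat dl.
    lra.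
  apply: le_trans (binom_tail_ratio p0 p1 mn um s0 hD) _.
  rewrite ler_wpM2r ?binom_weight_ge0// ler_expR mulrN lerN2.
  have s20 : 0 < 2 * s2 by rewrite pmulr_rgt0.
  rewrite ler_pdivlMr//.
  apply: (@le_trans _ _ (D%:R * D%:R)).
    rewrite [leLHS](_ : _ = (2 * l%:R * S) * (2 * l%:R * S)); last by rewrite -/s2 -sq; ring.
    have LS0 : 0 <= 2 * l%:R * S by rewrite !mulr_ge0// sqrtr_ge0.
    exact: ler_pM.
  by apply: ler_pM => //; rewrite ler_nat leq_pmull// subn_gt0.
have ol j : (j < l)%N -> expR (- (9 * l%:R ^+ 4)) / (4 * n.+1%:R) <= `|w (o j)| / 4.
  move=> jl; rewrite invfM mulrCA mulrC ler_pM2r ?invr_gt0//.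
  have t0 : 0 <= expR (- (9 * l%:R ^+ 4)) / n.+1%:R :> R.
    by apply: mulr_ge0; [exact: expR_ge0|rewrite invr_ge0].
  rewrite -ler_sqr ?nnegrE// real_normK ?num_real// hw oE//; exact: ulow.
exists [seq o j | j <- iota 0 l]; split.
- rewrite map_inj_in_uniq ?iota_uniq// => i j.
  rewrite !mem_iota /= add0n => il jl /(congr1 val) /=; rewrite !oE// /idx => /addnI /eqP.
  by rewrite eqn_mul2r -leqn0 leqNgt D0 /= eqSS => /eqP.
- by rewrite size_map size_iota.
apply: (@lacunary_geometric _ _ _ _ (expR (- l%:R ^+ 2)) _ l) => //.
- by rewrite size_map size_iota.
- by move=> i /mapP[j]; rewrite mem_iota /= add0n => jl ->; exact: ol.
rewrite pairwise_map; apply/(pairwiseP 0%N) => i j.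
rewrite !inE !size_iota => il jl ij; rewrite !nth_iota// !add0n; exact: ratio.
Qed.

End lacunary_weights.

(** * Real roots of polynomials *)

Section real_roots.
Context (R : realType).
Implicit Types (p g : {poly R}) (rs : seq R) (J : pred R).

Lemma real_root_factorization p : p != 0 -> exists rs g,
  p = \prod_(r <- rs) ('X - r%:P) * g /\ forall x, ~~ root g x.
Proof.
have [N] := ubnP (size p); elim: N p => // N IH p pN p0.
case: (pselect (exists x, root p x)) => [[x]|h]; last first.
  exists [::], p; split; first by rewrite big_nil mul1r.
  by move=> x; apply/negP => px; apply: h; exists x.
move=> /factor_theorem[q pq].
have q0 : q != 0 by apply: contra_neq p0 => q0; rewrite pq q0 mul0r.
have sq : (size q < N)%N.
  by move: pN; rewrite pq size_Mmonic ?monicXsubC// size_XsubC addn2.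
have [rs [g [qE gx]]] := IH q sq q0.
exists (x :: rs), g; split => //.
by rewrite big_cons pq qE mulrC mulrA.
Qed.

(** The cofactor [g] has no real root, so on the real axis multiplicities come
    from the linear factors alone. *)
Lemma zero_count_real p rs g J : p != 0 ->
  p = \prod_(r <- rs) ('X - r%:P) * g -> (forall x, ~~ root g x) ->
  zero_count (map_poly (real_complex R) p) (on_real_axis [set x | J x]) = count J rs.
Proof.
move=> p0 pE gx; rewrite /zero_count map_poly_eq0 (negbTE p0).
have g0 : g != 0 by apply: contra_neq p0 => g0; rewrite pE g0 mulr0.
have P0 : \prod_(r <- rs) ('X - r%:P) != 0 :> {poly R}.
  by apply: contra_neq p0 => P0; rewrite pE P0 mul0r.
have muE (x : R) : mup (real_complex R x) (map_poly (real_complex R) p) = count_mem x rs.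
  rewrite pE rmorphM /= mupMl; last by rewrite fmorph_root.
  rewrite rmorph_prod /=.
  rewrite (eq_bigr (fun r => 'X - (real_complex R r)%:P)); last first.
    by move=> r _; rewrite rmorphB /= map_polyX map_polyC.
  rewrite -(big_map (real_complex R) xpredT (fun z => 'X - z%:P)) mu_prod_XsubC.
  rewrite count_map; apply: eq_count => r /=.
  by apply/eqP/eqP => [[]|->].
pose fs := undup [seq r <- rs | J r].
have fsE r : (r \in fs) = J r && (r \in rs) by rewrite mem_undup mem_filter.
have us : uniq [seq real_complex R r | r <- fs].
  by rewrite map_inj_uniq ?undup_uniq// => x y [].
rewrite (fsbigE _ _ us).
- rewrite big_map big_seq_cond.
  rewrite (eq_bigl (fun r => r \in fs)); last first.
    move=> r; rewrite andb_idr//= fsE => /andP[Jr _].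
    by apply/mem_set; exists r.
  rewrite -big_seq (eq_bigr (fun r => (\sum_(x <- rs) (x == r))%N)); last first.
    by move=> r _; rewrite muE -sum1_count big_mkcond; apply: eq_bigr => x _ /=; case: eqP.
  rewrite exchange_big /= -sum1_count [RHS]big_mkcond /=.
  apply: eq_big_seq => x xrs.
  have -> : (\sum_(r <- fs) (x == r))%N = count_mem x fs.
    by rewrite -sum1_count [RHS]big_mkcond; apply: eq_bigr => r _ /=; rewrite eq_sym; case: eqP.
  by rewrite count_uniq_mem ?undup_uniq// fsE xrs andbT; case: (J x).
- move=> z /= /mapP[r]; rewrite fsE => /andP[Jr _] ->.
  by exists r.
- move=> _ [r /= Jr <-] rn; rewrite muE; apply/count_memPn.
  apply: contra rn => rrs; apply/mapP; exists r => //.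
  by rewrite fsE Jr.
Qed.

Lemma zero_count_le_deg p (n : nat) J : (size p <= n.+1)%N ->
  (zero_count (map_poly (real_complex R) p) (on_real_axis [set x | J x]) <= n)%N.
Proof.
case: (eqVneq p 0) => [->|p0] sp; first by rewrite /zero_count rmorph0 eqxx.
have [rs [g [pE gx]]] := real_root_factorization p0.
rewrite (zero_count_real J p0 pE gx); apply: (leq_trans (count_size _ _)).
have g0 : g != 0 by apply: contra_neq p0 => g0; rewrite pE g0 mulr0.
rewrite -ltnS; apply: leq_trans sp.
rewrite pE size_monicM ?monic_prod_XsubC// size_prod_XsubC.
by rewrite addSn /= -[X in (X < _)%N]addn0 ltn_add2l lt0n size_poly_eq0.
Qed.

Lemma no_root_same_sign g (a b : R) : a <= b ->
  (forall x, a <= x <= b -> ~~ root g x) -> 0 < g.[a] * g.[b].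
Proof.
move=> ab gx.
have na : g.[a] != 0 by have := gx a; rewrite lexx ab; apply.
have nb : g.[b] != 0 by have := gx b; rewrite lexx ab andbT; apply.
rewrite ltNge; apply/negP => h.
have [x] : exists2 x, x \in `[a, b] & root g x.
  case: (leP 0 g.[a]) => ga.
    have gb : g.[b] <= 0.
      by rewrite -(pmulr_rle0 _ (_ : 0 < g.[a]))// lt_neqAle eq_sym na.
    have [|x xab rx] := @poly_ivt _ (- g) a b ab.
      by rewrite !hornerN oppr_le0 ga oppr_ge0 gb.
    by exists x => //; rewrite -rootN.
  apply: poly_ivt => //; rewrite (ltW ga) /=.
  by rewrite -(nmulr_rle0 _ ga).
by rewrite in_itv /= => xab; apply/negP; exact: gx.
Qed.

(** Without a root strictly inside, no factor changes sign. *)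
Lemma count_ge1_of_sign_change p rs g (a b : R) : a <= b ->
  p = \prod_(r <- rs) ('X - r%:P) * g -> (forall x, ~~ root g x) ->
  p.[a] * p.[b] < 0 -> (0 < count (fun x => (a < x < b)%R) rs)%N.
Proof.
move=> ab pE gx hp; rewrite -has_count.
have [x xab rx] : exists2 x, x \in `[a, b] & root p x.
  case: (pselect (exists2 x, x \in `[a, b] & root p x)) => // h.
  have := @no_root_same_sign p a b ab; rewrite ltNge (ltW hp) => H.
  suff : false by []; apply: H => x xab; apply/negP => rx; apply: h.
  by exists x; rewrite ?in_itv.
have pa : p.[a] != 0 by apply: contraTneq hp => ->; rewrite mul0r ltxx.
have pb : p.[b] != 0 by apply: contraTneq hp => ->; rewrite mulr0 ltxx.
move: rx; rewrite pE rootM (negbTE (gx x)) orbF root_prod_XsubC => xrs.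
apply/hasP; exists x => //; move: xab; rewrite in_itv /= => /andP[ax xb].
have rx : root p x by rewrite pE rootM root_prod_XsubC xrs.
rewrite !lt_neqAle ax xb !andbT; apply/andP; split.
  by apply: contraNneq pa => ->.
by apply: contraNneq pb => <-.
Qed.

Lemma sign_change_of_count1 p rs g (a b : R) : a <= b ->
  p = \prod_(r <- rs) ('X - r%:P) * g -> (forall x, ~~ root g x) ->
  count (fun x => a <= x <= b) rs = 1%N -> p.[a] * p.[b] <= 0.
Proof.
move=> ab pE gx c1.
have : has (fun x => a <= x <= b) rs by rewrite has_count c1.
move=> /hasP[r rrs /andP[ar rb]].
have prs := perm_to_rem rrs.
have cr : count (fun x => a <= x <= b) (rem r rs) = 0%N.
  by have := permP prs (fun x => a <= x <= b); rewrite c1 /= ar rb => -[].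
pose h := \prod_(x <- rem r rs) ('X - x%:P) * g.
have pE' : p = ('X - r%:P) * h by rewrite pE (perm_big _ prs) big_cons /h mulrA.
have hh : 0 < h.[a] * h.[b].
  apply: no_root_same_sign => // x xab; rewrite /h rootM (negbTE (gx x)) orbF.
  rewrite root_prod_XsubC; apply/negP => xr.
  have : has (fun x => a <= x <= b) (rem r rs) by apply/hasP; exists x.
  by rewrite has_count cr.
rewrite pE' !hornerM !hornerXsubC mulrACA pmulr_lle0; last by move: hh; rewrite /h !hornerM.
by apply: mulr_le0_ge0; [rewrite subr_le0|rewrite subr_ge0].
Qed.

Section weighted_norm.
Context (n : nat) (Q : R) (Q0 : 0 < Q).

Definition coef_norm p : R := \sum_(i < n.+1) `|p`_i| * Q ^+ i.

Lemma coef_norm_ge0 p : 0 <= coef_norm p.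
Proof. by apply: sumr_ge0 => i _; rewrite mulr_ge0// exprn_ge0// ltW. Qed.

Lemma horner_le_coef_norm p x : (size p <= n.+1)%N -> `|x| <= Q ->
  `|p.[x]| <= coef_norm p.
Proof.
move=> sp xQ; rewrite (horner_coef_wide _ sp); apply: (le_trans (ler_norm_sum _ _ _)).
apply: ler_sum => i _; rewrite normrM normrX ler_wpM2l//.
by rewrite lerXn2r ?nnegrE// ltW.
Qed.

(** Multiplication by [X - r] costs at most [Q - |r|] in this norm: compare the
    two terms of the product. *)
Lemma coef_norm_XsubC (r : R) g : (size g <= n)%N ->
  (Q - `|r|) * coef_norm g <= coef_norm (('X - r%:P) * g).
Proof.
move=> sg; rewrite mulrBl lerBlDr.
rewrite [in X in X <= _]/coef_norm big_ord_recr /= nth_default// normr0 mul0r addr0.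
have -> : coef_norm (('X - r%:P) * g) + `|r| * coef_norm g =
    \sum_(i < n.+1) (`|(('X - r%:P) * g)`_i| + `|r| * `|g`_i|) * Q ^+ i.
  rewrite /coef_norm mulr_sumr -big_split /=; apply: eq_bigr => i _.
  by rewrite [RHS]mulrDl !mulrA.
rewrite big_ord_recl /= mulr_sumr.
apply: ler_wpDl; first by rewrite mulr_ge0// addr_ge0// mulr_ge0.
apply: ler_sum => i _; rewrite mulrCA exprS.
rewrite /bump leq0n add1n mulrBl coefB coefXM coefCM /= ler_wpM2r//.
  by rewrite mulr_ge0 ?exprn_ge0// ltW.
rewrite -normrM -[X in `|X| <= _](subrK (r * g`_i.+1)).
exact: ler_normD.
Qed.

(** A real-variable form of Jensen's inequality: each linear factor is at most
    [2 * tau] at [x] but costs [Q - tau] in the norm. *)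
Lemma roots_imply_small p g rs (tau x : R) : (size p <= n.+1)%N -> g != 0 ->
  p = \prod_(r <- rs) ('X - r%:P) * g -> 0 <= tau -> tau < Q ->
  (forall r, r \in rs -> `|r| <= tau) -> `|x| <= tau ->
  `|p.[x]| <= (2 * tau / (Q - tau)) ^+ size rs * coef_norm p.
Proof.
move=> + g0 + tau0 tQ + xt.
elim: rs p => [|r rs IH] p sp pE hrs.
  rewrite expr0 mul1r horner_le_coef_norm// (le_trans xt)// ltW//.
set h := \prod_(s <- rs) ('X - s%:P) * g.
have pE' : p = ('X - r%:P) * h by rewrite pE big_cons mulrA.
have P0 : \prod_(s <- rs) ('X - s%:P) != 0 :> {poly R}.
  by rewrite monic_neq0// monic_prod_XsubC.
have h0 : h != 0 by rewrite mulf_neq0.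
have sh : (size h <= n)%N.
  by move: sp; rewrite pE' size_monicM ?monicXsubC// size_XsubC.
have hx := IH h (leqW sh) erefl (fun s sr => hrs s ltac:(by rewrite inE sr orbT)).
have rt := hrs r (mem_head _ _).
have hn : (Q - tau) * coef_norm h <= coef_norm p.
  rewrite pE'; apply: le_trans (coef_norm_XsubC r sh).
  by rewrite ler_wpM2r ?coef_norm_ge0// lerB.
have Qt : 0 < Q - tau by rewrite subr_gt0.
have c0 : 0 <= 2 * tau / (Q - tau) by rewrite divr_ge0 ?mulr_ge0// ltW.
rewrite pE' hornerM normrM -pE' /= exprS hornerXsubC.
apply: (@le_trans _ _ (2 * tau * ((2 * tau / (Q - tau)) ^+ size rs * coef_norm h))).
  apply: ler_pM => //; apply: (le_trans (ler_normB _ _)); lra.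
apply: (@le_trans _ _ ((2 * tau / (Q - tau)) * (2 * tau / (Q - tau)) ^+ size rs * ((Q - tau) * coef_norm h))); last first.
  by rewrite ler_wpM2l// mulr_ge0// exprn_ge0.
by rewrite le_eqVlt; apply/orP; left; apply/eqP; field; rewrite gt_eqF.
Qed.

End weighted_norm.
End real_roots.

(** * The elliptic polynomial on the circle *)

Section rotation.
Context (R : realType) (n : nat).
Implicit Types (a : 'I_n.+1 -> R) (t x : R) (p g : {poly R}) (rs : seq R).

(** The elliptic polynomial on the circle: substitute [x = sqrt n * tan t] and
    multiply by [cos t ^+ n].  Its covariance is a power of the cosine of the
    difference of angles, so all angles look alike. *)
Definition circle_weight t (i : 'I_n.+1) : R :=
  Num.sqrt 'C(n, i)%:R * (sin t ^+ i * cos t ^+ (n - i)).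

Definition circle_value a t : R := \sum_i a i * circle_weight t i.

(** The binary form restricted to the tangent line at angle [t], and to the
    [i]-th monomial. *)
Definition tangent_monomial t (i : 'I_n.+1) : {poly R} :=
  Num.sqrt 'C(n, i)%:R *: (((sin t)%:P + cos t *: 'X) ^+ i *
    ((cos t)%:P - sin t *: 'X) ^+ (n - i)).

Definition tangent_poly a t : {poly R} := \sum_i a i *: tangent_monomial t i.

Lemma size_tangent_poly a t : (size (tangent_poly a t) <= n.+1)%N.
Proof.
apply: (leq_trans (size_sum _ _ _)); apply/bigmax_leqP => i _.
apply: (leq_trans (size_scale_leq _ _)).
apply: (leq_trans (size_scale_leq _ _)).
have sl (b c : R) : (size (b%:P + c *: 'X)%R <= 2)%N.
  apply: (leq_trans (size_polyD _ _)); rewrite geq_max.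
  rewrite (leq_trans (size_polyC_leq1 _))//=.
  by rewrite (leq_trans (size_scale_leq _ _))// size_polyX.
have slX (b c : R) m : (size ((b%:P + c *: 'X) ^+ m)%R <= m.+1)%N.
  apply: (leq_trans (size_poly_exp_leq _ _)); rewrite ltnS.
  have := sl b c; case: (size _) => [|[|[|//]]] _; rewrite /= ?mul0n ?mul1n//.
apply: (leq_trans (size_polyMleq _ _)).
have h1 := slX (sin t) (cos t) i.
have h2 : (size (((cos t)%:P - sin t *: 'X) ^+ (n - i)%N)%R <= (n - i).+1)%N.
  by rewrite -scaleNr; exact: slX.
have := ltn_ord i; lia.
Qed.

Lemma tangent_monomialE t i x : (tangent_monomial t i).[x] =
  Num.sqrt 'C(n, i)%:R * ((sin t + cos t * x) ^+ i * (cos t - sin t * x) ^+ (n - i)).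
Proof. by rewrite !(hornerE, horner_exp). Qed.

Lemma circle_value_tangent a t x : cos x != 0 ->
  circle_value a (t + x) = cos x ^+ n * (tangent_poly a t).[tan x].
Proof.
move=> cx; rewrite /circle_value /tangent_poly horner_sum mulr_sumr.
apply: eq_bigr => i _; rewrite hornerZ tangent_monomialE /circle_weight.
rewrite sinD cosD.
have -> : sin t * cos x + cos t * sin x = cos x * (sin t + cos t * tan x).
  by rewrite /tan; field.
have -> : cos t * cos x - sin t * sin x = cos x * (cos t - sin t * tan x).
  by rewrite /tan; field.
rewrite [X in cos x ^+ X](_ : n = (i + (n - i))%N); last by rewrite subnKC// -ltnS.
by rewrite exprD !exprMn; ring.
Qed.

Lemma circle_value0 a t : circle_value a t = (tangent_poly a t).[0].
Proof. by have := @circle_value_tangent a t 0; rewrite addr0 cos0 oner_eq0 expr1n mul1r tan0; apply. Qed.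

Lemma circle_weight_dot t t' :
  \sum_i circle_weight t i * circle_weight t' i = cos (t - t') ^+ n.
Proof.
rewrite cosB exprDn; apply: eq_bigr => i _.
have s2 : Num.sqrt 'C(n, i)%:R * Num.sqrt 'C(n, i)%:R = 'C(n, i)%:R :> R.
  by rewrite -expr2 sqr_sqrtr.
rewrite /circle_weight -[RHS]mulr_natl -[X in _ = X * _]s2 !exprMn; ring.
Qed.

Lemma circle_weight_sqr t i :
  circle_weight t i ^+ 2 = binom_weight n (sin t ^+ 2) i.
Proof.
rewrite /circle_weight /binom_weight exprMn sqr_sqrtr// -cos2sin2.
by rewrite exprMn -!exprM (mulnC 2) (mulnC 2).
Qed.

(** Comparing coefficients in
    [((s+cX)(s+cY) + (c-sX)(c-sY))^n = (1+XY)^n]: the coefficients of the form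
    in any rotated frame are uncorrelated with binomial variances. *)
Lemma tangent_coef_variance t (k : nat) : (k <= n)%N ->
  \sum_i ((tangent_monomial t i)`_k) ^+ 2 = 'C(n, k)%:R.
Proof.
move=> kn.
pose U : {poly R} := (sin t)%:P + cos t *: 'X.
pose V : {poly R} := (cos t)%:P - sin t *: 'X.
have key : \sum_(i < n.+1) (tangent_monomial t i)^:P * (tangent_monomial t i)%:P =
   (1 + 'X * ('X)%:P) ^+ n :> {poly {poly R}}.
  have -> : 1 + 'X * ('X)%:P = V^:P * V%:P + U^:P * U%:P :> {poly {poly R}}.
    rewrite /U /V -!mul_polyC !rmorphB !rmorphD /= !rmorphM /= !map_polyC /= !map_polyX.
    have h : (cos t)%:P%:P ^+ 2 + (sin t)%:P%:P ^+ 2 = 1 :> {poly {poly R}}.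
      by rewrite -!rmorphXn -!rmorphD /= cos2Dsin2.
    move: h; move: (cos t)%:P%:P (sin t)%:P%:P => c s h.
    transitivity ((c ^+ 2 + s ^+ 2) * (1 + 'X * ('X)%:P)); first by rewrite h mul1r.
    ring.
  rewrite exprDn; apply: eq_bigr => i _.
  have s2 : Num.sqrt 'C(n, i)%:R * Num.sqrt 'C(n, i)%:R = 'C(n, i)%:R :> R.
    by rewrite -expr2 sqr_sqrtr.
  rewrite /tangent_monomial -/U -/V -!mul_polyC !rmorphM /= !map_polyC /= !rmorphXn /=.
  rewrite -[RHS]mulr_natl.
  have -> : 'C(n, i)%:R = (Num.sqrt 'C(n, i)%:R)%:P%:P * (Num.sqrt 'C(n, i)%:R)%:P%:P :> {poly {poly R}}.
    by rewrite -!rmorphM /= s2 !rmorph_nat.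
  rewrite !exprMn; ring.
have key1 : \sum_(i < n.+1) ((tangent_monomial t i)`_k *: tangent_monomial t i) =
    'C(n, k)%:R *: 'X^k.
  have := congr1 (fun q : {poly {poly R}} => q`_k) key; rewrite /= coef_sum.
  rewrite (eq_bigr (fun i => (tangent_monomial t i)`_k *: tangent_monomial t i)); last first.
    by move=> i _; rewrite coefMC coef_map /= mul_polyC.
  move=> ->; rewrite exprDn coef_sum.
  rewrite (bigD1 (Ordinal (kn : (k < n.+1)%N)))//= big1 ?addr0.
    rewrite expr1n mul1r exprMn coefMn -rmorphXn coefMC coefXn eqxx mul1r.
    by rewrite scaler_nat.
  move=> i ik; rewrite expr1n mul1r exprMn coefMn -rmorphXn coefMC coefXn.
  rewrite (_ : (k == i) = false) ?mul0r ?mul0rn//.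
  by apply/negP => /eqP ki; case/eqP: ik; apply/val_inj.
have := congr1 (fun q : {poly R} => q`_k) key1.
rewrite /= coefZ coefXn eqxx mulr1 coef_sum => <-.
by apply: eq_bigr => i _; rewrite coefZ expr2.
Qed.

Lemma tangent_poly_coef a t k :
  (tangent_poly a t)`_k = \sum_i a i * (tangent_monomial t i)`_k.
Proof. by rewrite coef_sum; apply: eq_bigr => i _; rewrite coefZ. Qed.

Context (n0 : (0 < n)%N).
Let sn : R := Num.sqrt n%:R.
Let sn0 : 0 < sn. Proof. by rewrite sqrtr_gt0 ltr0n. Qed.

Definition angle x : R := atan (x / Num.sqrt n%:R).

Lemma angleK x : x = sn * tan (angle x).
Proof. by rewrite /angle atanK mulrC -mulrA mulVf ?mulr1// gt_eqF. Qed.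

Lemma cos_angle_gt0 x : 0 < cos (angle x).
Proof. by apply: cos_gt0_pihalf; rewrite atan_gtNpi2 atan_ltpi2. Qed.

Lemma elliptic_coef_scale (i : 'I_n.+1) :
  Num.sqrt ('C(n, i)%:R * n%:R ^- i) * sn ^+ i = Num.sqrt 'C(n, i)%:R.
Proof.
have e : sn ^+ i = Num.sqrt (n%:R ^+ i).
  rewrite /sn; elim: (i : nat) => [|j IH]; first by rewrite !expr0 sqrtr1.
  by rewrite !exprS sqrtrM// IH.
rewrite e -sqrtrM; last by rewrite mulr_ge0// invr_ge0 exprn_ge0.
by rewrite mulfVK// expf_neq0// pnatr_eq0 -lt0n.
Qed.

Lemma elliptic_polyE a x : cos x != 0 ->
  cos x ^+ n * (elliptic_poly a).[sn * tan x] = circle_value a x.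
Proof.
move=> cx; rewrite /elliptic_poly horner_sum mulr_sumr.
apply: eq_bigr => i _; rewrite hornerZ hornerXn [(sn * _) ^+ _]exprMn /circle_weight.
rewrite -(elliptic_coef_scale i).
have -> : sin x = cos x * tan x by rewrite /tan; field.
rewrite [X in cos x ^+ X](_ : n = (i + (n - i))%N); last by rewrite subnKC// -ltnS.
by rewrite exprD [(cos x * tan x) ^+ i]exprMn; ring.
Qed.

(** Homogenization in degree [k] along the tangent line at angle [t]. *)
Definition homog t k p : {poly R} :=
  \sum_(i < k.+1) p`_i *: ((sn *: ((sin t)%:P + cos t *: 'X)) ^+ i *
    ((cos t)%:P - sin t *: 'X) ^+ (k - i)).

Lemma homog_XsubC t k r p : (size p <= k.+1)%N ->
  homog t k.+1 (('X - r%:P) * p) =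
  (sn *: ((sin t)%:P + cos t *: 'X) - r *: ((cos t)%:P - sin t *: 'X)) * homog t k p.
Proof.
move=> sp; rewrite /homog.
set A := sn *: _; set B := (cos t)%:P - _.
rewrite (eq_bigr (fun i : 'I_k.+2 => ('X * p)`_i *: (A ^+ i * B ^+ (k.+1 - i)) -
   r *: (p`_i *: (A ^+ i * B ^+ (k.+1 - i))))); last first.
  by move=> i _; rewrite mulrBl coefB coefCM scalerBl scalerA.
rewrite sumrB mulrBl; congr (_ - _).
  rewrite big_ord_recl /= coefXM /= scale0r add0r mulr_sumr; apply: eq_bigr => i _.
  rewrite /bump leq0n add1n coefXM /= subSS exprS -scalerAr mulrA //.
rewrite big_ord_recr /= nth_default// scale0r scaler0 addr0 mulr_sumr.
apply: eq_bigr => i _; rewrite subSn; last by rewrite -ltnS.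
by rewrite exprS -!scalerAl -!scalerAr; congr (_ *: (_ *: _)); rewrite mulrCA.
Qed.

Lemma homog_elliptic a t : homog t n (elliptic_poly a) = tangent_poly a t.
Proof.
apply: eq_bigr => i _.
have -> : (elliptic_poly a)`_i = Num.sqrt ('C(n, i)%:R * n%:R ^- i) * a i.
  rewrite /elliptic_poly coef_sum (bigD1 i)//= coefZ coefXn eqxx mulr1 big1 ?addr0//.
  by move=> j ji; rewrite coefZ coefXn (_ : (_ == _) = false) ?mulr0//;
    apply/negP => /eqP ij; case/eqP: ji; apply/val_inj.
rewrite /tangent_monomial -(elliptic_coef_scale i) exprZn -scalerAl !scalerA.
by congr (_ *: _); ring.
Qed.

(** In the frame rotated by [t], a root at angle [angle r] becomes a root at
    [tan (angle r - t)]. *)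
Lemma homog_prod t rs g : (size rs + size g <= n.+1)%N -> g != 0 ->
  (forall r, r \in rs -> cos (angle r - t) != 0) ->
  exists h, homog t n (\prod_(r <- rs) ('X - r%:P) * g) =
    \prod_(r <- rs) ('X - (tan (angle r - t))%:P) * h.
Proof.
move=> + g0.
suff H k : (size rs + size g <= k.+1)%N ->
  (forall r, r \in rs -> cos (angle r - t) != 0) ->
  exists h, homog t k (\prod_(r <- rs) ('X - r%:P) * g) =
    \prod_(r <- rs) ('X - (tan (angle r - t))%:P) * h by exact: H.
elim: rs k => [|r rs IH] k sk hc.
  by exists (homog t k g); rewrite !big_nil !mul1r.
have sg : (0 < size g)%N by rewrite lt0n size_poly_eq0.
case: k sk => [|k] sk; first by move: sk; rewrite /= addSn ltnS leqn0 addn_eq0 => /andP[_ /eqP h]; rewrite h in sg.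
have [h hE] := IH k sk (fun s sr => hc s ltac:(by rewrite inE sr orbT)).
have crt := hc r (mem_head _ _).
have cr : cos (angle r) != 0 by rewrite gt_eqF// cos_angle_gt0.
pose c := sn * cos (angle r - t) / cos (angle r).
exists (c *: h).
rewrite !big_cons -!mulrA homog_XsubC; last first.
  by rewrite size_monicM ?monic_prod_XsubC// size_prod_XsubC addSn.
rewrite hE -!scalerAr [RHS]scalerAl; congr (_ * _).
suff -> : sn *: ((sin t)%:P + cos t *: 'X) - r *: ((cos t)%:P - sin t *: 'X) =
    c *: ('X - (tan (angle r - t))%:P) by [].
  rewrite {1}[r]angleK /c -!mul_polyC.
  have e1 : cos (angle r - t) = cos (angle r) * cos t + sin (angle r) * sin t by rewrite cosB.
  have e2 : cos (angle r - t) * tan (angle r - t) = sin (angle r) * cos t - cos (angle r) * sin t.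
    by rewrite -sinB /tan; field.
  transitivity ((sn * cos (angle r - t) / cos (angle r))%:P * 'X -
     (sn / cos (angle r) * (cos (angle r - t) * tan (angle r - t)))%:P); last first.
    rewrite mulrBr -polyCM; congr (_ - _%:P); by field.
  rewrite e2 e1.
  have e3 : sn * (cos (angle r) * cos t + sin (angle r) * sin t) / cos (angle r) =
     sn * cos t + (sn * tan (angle r)) * sin t by rewrite /tan; field.
  have e4 : sn / cos (angle r) * (sin (angle r) * cos t - cos (angle r) * sin t) =
     (sn * tan (angle r)) * cos t - sn * sin t by rewrite /tan; field.
  rewrite e3 e4 !(polyCD, polyCM, polyCB); ring.
Qed.

End rotation.

(** * Clusters of roots *)

Section many_roots.
Context (R : realType) (n : nat) (n0 : (0 < n)%N).
Implicit Types (a : 'I_n.+1 -> R) (t x tau Q : R) (pr : pred R).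

Definition roots_in a pr : nat := elliptic_zero_count a (on_real_axis [set x | pr x]).

Lemma size_elliptic_poly a : (size (elliptic_poly a) <= n.+1)%N.
Proof.
apply: (leq_trans (size_sum _ _ _)); apply/bigmax_leqP => i _.
by apply: (leq_trans (size_scale_leq _ _)); rewrite size_polyXn.
Qed.

Lemma roots_in_le a pr : (roots_in a pr <= n)%N.
Proof. exact: zero_count_le_deg (size_elliptic_poly a). Qed.

(** This is [roots_imply_small] in the frame rotated by [t], where a root [r]
    sits at [tan (angle r - t)]. *)
Lemma roots_in_small a pr t tau Q x : 0 < Q -> 0 <= tau -> tau < Q ->
  (forall r, pr r -> cos (angle n r - t) != 0 /\ `|tan (angle n r - t)| <= tau) ->
  `|x| <= tau -> (0 < roots_in a pr)%N ->
  `|(tangent_poly a t).[x]| <=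
     (2 * tau / (Q - tau)) ^+ roots_in a pr * coef_norm n Q (tangent_poly a t).
Proof.
move=> Q0 tau0 tQ hpr xt c0.
have p0 : elliptic_poly a != 0.
  by apply: contraTneq c0 => h; rewrite /roots_in /elliptic_zero_count /zero_count h rmorph0 eqxx.
have [rs [g [pE gx]]] := real_root_factorization p0.
have cE : roots_in a pr = count pr rs by exact: zero_count_real p0 pE gx.
have g0 : g != 0 by apply: contra_neq p0 => g0; rewrite pE g0 mulr0.
pose g' := \prod_(r <- [seq r <- rs | predC pr r]) ('X - r%:P) * g.
have P0 s : \prod_(r <- s) ('X - r%:P) != 0 :> {poly R}.
  by rewrite monic_neq0// monic_prod_XsubC.
have g'0 : g' != 0 by rewrite mulf_neq0.
have pE' : elliptic_poly a = \prod_(r <- [seq r <- rs | pr r]) ('X - r%:P) * g'.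
  by rewrite pE /g' mulrA -big_cat; congr (_ * _); apply: perm_big; rewrite perm_sym perm_filterC.
have sz : (size [seq r <- rs | pr r] + size g' <= n.+1)%N.
  have := size_elliptic_poly a; rewrite pE' size_monicM ?monic_prod_XsubC//.
  by rewrite size_prod_XsubC addSn.
have hc r : r \in [seq r <- rs | pr r] -> cos (angle n r - t) != 0.
  by rewrite mem_filter => /andP[/hpr[]].
have [h hE] := homog_prod n0 sz g'0 hc.
rewrite -pE' homog_elliptic// in hE.
case: (eqVneq h 0) => [h0|h0].
  by rewrite hE h0 mulr0 horner0 normr0 mulr_ge0 ?coef_norm_ge0// exprn_ge0// divr_ge0 ?mulr_ge0// subr_ge0 ltW.
pose rs' := [seq tan (angle n r - t) | r <- [seq r <- rs | pr r]].
have hE' : tangent_poly a t = \prod_(r <- rs') ('X - r%:P) * h by rewrite hE big_map.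
have hrs' r : r \in rs' -> `|r| <= tau.
  by move=> /mapP[s]; rewrite mem_filter => /andP[/hpr[_ ?] _] ->.
have := roots_imply_small Q0 (size_tangent_poly a t) h0 hE' tau0 tQ hrs' xt.
by rewrite size_map size_filter cE.
Qed.

Context (e : R) (e0 : 0 < e) (C : R).
Context (d : measure_display) (T : measurableType d) (P : probability T R).
Context (X : 'I_n.+1 -> {RV P >-> R}).
Hypotheses (hX : jointly_independent X) (nX : forall j, normalized e P C (X j)).

Let A (w : T) : 'I_n.+1 -> R := fun j => X j w.

Lemma circle_value_lincomb t w : circle_value (A w) t = lincomb X (circle_weight t) w.
Proof. by apply: eq_bigr => i _; rewrite mulrC. Qed.

Lemma tangent_coef_lincomb t k w : (tangent_poly (A w) t)`_k =
  lincomb X (fun i => (tangent_monomial t i)`_k) w.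
Proof. by rewrite tangent_poly_coef; apply: eq_bigr => i _; rewrite mulrC. Qed.

Lemma measurable_coef_norm t Q : measurable_fun setT
  (fun w => coef_norm n Q (tangent_poly (A w) t)).
Proof.
apply: measurable_sum => i; apply: measurable_funM => //.
apply: measurableT_comp => //.
rewrite (_ : (fun w => _) = lincomb X (fun j => (tangent_monomial t j)`_i)).
  exact: measurable_lincomb.
by apply/funext => w; exact: tangent_coef_lincomb.
Qed.

Lemma measurable_gt (f : T -> R) M : measurable_fun setT f -> measurable [set w | M < f w].
Proof.
move=> mf; rewrite (_ : [set w | _] = f @^-1` `]M, +oo[).
  exact: measurable_preimage.
by apply/seteqP; split => w /=; rewrite in_itv /= andbT.
Qed.

(** If the norm exceeds [M], its term of degree [k] exceeds [M / 2 ^ (k + 1)] for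
    some [k]; by [tangent_coef_variance] the Chebyshev bounds for these events
    add up to the binomial sum [4 / M ^ 2 * (1 + 4 * Q ^ 2) ^ n]. *)
Lemma coef_norm_tail t Q M : 0 < Q -> 0 < M ->
  Pr P [set w | M < coef_norm n Q (tangent_poly (A w) t)] <=
  4 / M ^+ 2 * expR (4 * n%:R * Q ^+ 2).
Proof.
move=> Q0 M0.
have M2 : 0 < M ^+ 2 by rewrite exprn_gt0.
pose c (k : nat) : R := 4 / M ^+ 2 * (4 * Q ^+ 2) ^+ k.
have c0 k : 0 <= c k by rewrite mulr_ge0 ?divr_ge0 ?exprn_ge0 ?mulr_ge0 ?sqr_ge0// ltW.
pose H k w := lincomb X (fun i => (tangent_monomial t i)`_k) w.
have sH k : summable_rv P (fun w => H k w ^+ 2).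
  by have [] := lincomb_second_moment hX nX (fun i => (tangent_monomial t i)`_k).
have scH k : summable_rv P (fun w => c k * H k w ^+ 2) by exact: summableZ.
have E : Ex P (fun w => \sum_(k < n.+1) c k * H k w ^+ 2) <= 4 / M ^+ 2 * expR (4 * n%:R * Q ^+ 2).
  rewrite Ex_sum//.
  rewrite (eq_bigr (fun k : 'I_n.+1 => 4 / M ^+ 2 * ((4 * Q ^+ 2) ^+ k *+ 'C(n, k)))); last first.
    move=> k _; rewrite ExZ//.
    have [_ ->] := lincomb_second_moment hX nX (fun i => (tangent_monomial t i)`_k).
    rewrite tangent_coef_variance; last by rewrite -ltnS.
    by rewrite /c mulr_natr mulrnAr.
  rewrite -mulr_sumr ler_wpM2l//; first by rewrite divr_ge0// ltW.
  have := exprDn 1 (4 * Q ^+ 2) n.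
  rewrite (eq_bigr (fun k : 'I_n.+1 => (4 * Q ^+ 2) ^+ k *+ 'C(n, k))); last first.
    by move=> k _; rewrite expr1n mul1r.
  move=> <-; rewrite (_ : 4 * n%:R * _ = n%:R * (4 * Q ^+ 2)); last by ring.
  rewrite expRM_natl; apply: lerXn2r; rewrite ?nnegrE ?expR_ge0 ?addr_ge0 ?mulr_ge0 ?sqr_ge0 ?(ltW Q0)//.
  exact: expR_ge1Dx.
apply: le_trans E; apply: Pr_le_Ex.
- by apply: measurable_gt; exact: measurable_coef_norm.
- exact: summable_sum.
- by move=> w; apply: sumr_ge0 => k _; rewrite mulr_ge0// sqr_ge0.
move=> w /= hM; rewrite leNgt; apply/negP => hlt.
have small (k : 'I_n.+1) : `|H k w| * Q ^+ k <= M * (1 / 2) ^+ k.+1.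
  have h : c k * H k w ^+ 2 <= 1.
    apply: le_trans (ltW hlt); rewrite (bigD1 k)//= lerDl.
    by apply: sumr_ge0 => j _; rewrite mulr_ge0// sqr_ge0.
  rewrite -ler_sqr ?nnegrE ?mulr_ge0 ?exprn_ge0 ?(ltW Q0) ?(ltW M0)//.
  have -> : (`|H k w| * Q ^+ k) ^+ 2 = c k * H k w ^+ 2 * (M ^+ 2 * ((1 / 2) ^+ k.+1) ^+ 2).
    rewrite exprMn real_normK ?num_real// /c.
    have -> : ((1 / 2 : R) ^+ k.+1) ^+ 2 = 1 / 4 * (1 / 4) ^+ k.
      by rewrite -exprM mulnC exprM exprS; congr (_ * _); [field|congr (_ ^+ _); field].
    rewrite exprMn -!exprM (mulnC 2) (_ : Q ^+ (k * 2) = (Q ^+ 2) ^+ k); last by rewrite -exprM mulnC.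
    have : (4 : R) ^+ k * (1 / 4) ^+ k = 1.
      by rewrite -exprMn (_ : 4 * (1 / 4) = 1) ?expr1n//; field.
    move: (4 ^+ k) ((1 / 4) ^+ k) => x y xy.
    transitivity (H k w ^+ 2 * (Q ^+ 2) ^+ k * (x * y)); first by rewrite xy mulr1.
    by field; rewrite gt_eqF.
  by rewrite [leRHS]exprMn -[leRHS]mul1r ler_wpM2r// mulr_ge0 ?sqr_ge0.
suff : coef_norm n Q (tangent_poly (A w) t) <= M by rewrite leNgt hM.
apply: (@le_trans _ _ (\sum_(k < n.+1) M * (1 / 2) ^+ k.+1)).
  by apply: ler_sum => k _; rewrite tangent_coef_lincomb; exact: small.
rewrite -mulr_sumr ler_piMr ?(ltW M0)//.
suff -> : \sum_(k < n.+1) (1 / 2 : R) ^+ k.+1 = 1 - (1 / 2) ^+ n.+1.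
  by rewrite gerBl exprn_ge0.
elim: n.+1 => [|N IH]; first by rewrite big_ord0 expr0 subrr.
by rewrite big_ord_recr /= IH !exprS; field.
Qed.

(** The hypotheses on [l] say that it exceeds a large power of the logarithm of
    [n] and that the standard deviation of the weights is much larger than
    [l ^ 2]. *)
Lemma angle_small_ball t (l : nat) (q : R) :
  (forall j y, Pr P [set w | `|X j w - y| <= 1 / 2] <= 1 - q) -> 0 < q -> q <= 1 ->
  (0 < l)%N -> 16 * l%:R ^+ 2 <= Num.sqrt (n%:R * sin t ^+ 2 * cos t ^+ 2) ->
  n.+1%:R ^+ 2 * (l%:R * expR (- l%:R ^+ 2)) <= 1 / 4 :> R ->
  (1 - q / 2) ^+ l <= n%:R ^- 3 -> 1 / n.+1%:R ^+ 4 <= q / 2 ->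
  Pr P [set w | `|circle_value (A w) t| <= expR (- (9 * l%:R ^+ 4)) / (4 * n.+1%:R)]
    <= 2 * n%:R ^- 3.
Proof.
move=> hq q0 q1 l0 hS h1 h2 h3.
have nn0 : 0 < n%:R :> R by rewrite ltr0n.
have l1 : 1 <= l%:R :> R by rewrite ler1n.
have s2c2 : 0 < n%:R * sin t ^+ 2 * cos t ^+ 2.
  by rewrite -sqrtr_gt0; apply: lt_le_trans hS; rewrite mulr_gt0// exprn_gt0//; lra.
have sn0 : sin t != 0 by apply: contraTneq s2c2 => ->; rewrite expr0n /= mulr0 mul0r ltxx.
have cn0 : cos t != 0 by apply: contraTneq s2c2 => ->; rewrite expr0n /= mulr0 ltxx.
have p0 : 0 < sin t ^+ 2 by rewrite lt_neqAle sqr_ge0 eq_sym sqrf_eq0 sn0.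
have p1 : sin t ^+ 2 < 1.
  by rewrite sin2cos2 gtrBl lt_neqAle sqr_ge0 eq_sym sqrf_eq0 cn0.
have M0 : 0 < n.+1%:R ^+ 2 :> R by rewrite exprn_gt0.
rewrite cos2sin2 in hS.
have [L [uL sL lL]] := lacunary_binomial_chain p0 p1 (circle_weight_sqr t) l0 hS (ltW M0) h1.
pose K := [seq i <- index_enum 'I_n.+1 | i \notin L].
have pKL : perm_eq (K ++ L) (index_enum 'I_n.+1).
  rewrite perm_sym -(perm_filterC (fun i => i \notin L)) perm_cat2l.
  apply: uniq_perm => //; first by rewrite filter_uniq ?index_enum_uniq.
  by move=> i; rewrite mem_filter mem_index_enum andbT /= negbK.
have r0 : 0 < expR (- (9 * l%:R ^+ 4)) / (4 * n.+1%:R) :> R.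
  by rewrite divr_gt0 ?expR_gt0// mulr_gt0.
have h3' : 1 / (n.+1%:R ^+ 2) ^+ 2 <= q / 2 by rewrite -exprM.
have := lincomb_small_ball hX nX pKL hq q1 M0 h3' r0 lL.
rewrite sL card_ord.
have -> : [set w | `|lincomb X (circle_weight t) w| <= expR (- (9 * l%:R ^+ 4)) / (4 * n.+1%:R)] =
   [set w | `|circle_value (A w) t| <= expR (- (9 * l%:R ^+ 4)) / (4 * n.+1%:R)].
  by apply/seteqP; split => w /=; rewrite circle_value_lincomb.
move=> /le_trans; apply; rewrite [leRHS]mulr_natl mulr2n lerD//.
rewrite (_ : _ / _ = (n.+1%:R ^+ 3)^-1); last first.
  have N0 : n.+1%:R != 0 :> R by rewrite pnatr_eq0.
  by move: (n.+1%:R) N0 => N N0; field.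
rewrite lef_pV2 ?posrE ?exprn_gt0//.
by rewrite lerXn2r ?nnegrE// ler_nat.
Qed.

(** Many roots near angle [t] need either a large coefficient norm or a tiny
    value at [t]. *)
Definition wild_event t Q M (K : nat) : set T :=
  [set w | M < coef_norm n Q (tangent_poly (A w) t)] `|`
  [set w | `|circle_value (A w) t| <= (1 / 2) ^+ K * M].

Lemma measurable_wild t Q M K : measurable (wild_event t Q M K).
Proof.
apply: measurableU; first by apply: measurable_gt; exact: measurable_coef_norm.
rewrite (_ : [set w | _] = [set w | `|lincomb X (circle_weight t) w| <= (1 / 2) ^+ K * M]).
  by apply: measurable_norm_le; exact: measurable_lincomb.
by apply/seteqP; split => w /=; rewrite circle_value_lincomb.
Qed.

(** For [Q = 5 * tau] each root contributes a factor
    [2 * tau / (Q - tau) = 1 / 2]. *)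
Lemma roots_in_le_wild t tau M (K : nat) pr w : 0 < tau ->
  (forall r, pr r -> cos (angle n r - t) != 0 /\ `|tan (angle n r - t)| <= tau) ->
  ~ wild_event t (5 * tau) M K w -> (roots_in (A w) pr <= K)%N.
Proof.
move=> tau0 hpr hw; rewrite leqNgt; apply/negP => hK; apply: hw.
case: (ltP M (coef_norm n (5 * tau) (tangent_poly (A w) t))) => hM; first by left.
right => /=; rewrite circle_value0.
have c0 : (0 < roots_in (A w) pr)%N by exact: leq_ltn_trans hK.
have Q0 : 0 < 5 * tau by rewrite mulr_gt0.
have tQ : tau < 5 * tau by lra.
have x0 : `|0 : R| <= tau by rewrite normr0 ltW.
apply: (le_trans (roots_in_small Q0 (ltW tau0) tQ hpr x0 c0)).
rewrite (_ : 2 * tau / (5 * tau - tau) = 1 / 2); last by field; rewrite !gt_eqF//; lra.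
apply: ler_pM => //; first exact: coef_norm_ge0.
by apply: ler_wiXn2l => //; [lra|exact: ltnW].
Qed.

End many_roots.

(** * Cells of angles *)

Section counting_on_cells.
Context (R : realType) (n : nat) (n0 : (0 < n)%N).
Implicit Types (a : 'I_n.+1 -> R) (t ta tb : R) (pr : pred R).

Lemma roots_inE a : (elliptic_poly a = 0 /\ forall pr, roots_in a pr = 0%N) \/
  exists rs g, [/\ elliptic_poly a = \prod_(r <- rs) ('X - r%:P) * g,
    forall x, ~~ root g x & forall pr, roots_in a pr = count pr rs].
Proof.
case: (eqVneq (elliptic_poly a) 0) => [h|p0]; [left|right].
  split => // pr; by rewrite /roots_in /elliptic_zero_count /zero_count h rmorph0 eqxx.
have [rs [g [pE gx]]] := real_root_factorization p0.
by exists rs, g; split => // pr; exact: zero_count_real p0 pE gx.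
Qed.

Lemma roots_in_cover (I : eqType) a pr (s : seq I) (q : I -> pred R) :
  (forall r, pr r -> exists2 i, i \in s & q i r) ->
  (roots_in a pr <= \sum_(i <- s) roots_in a (q i))%N.
Proof.
move=> h; case: (roots_inE a) => [[_ ->]//|[rs [g [_ _ cE]]]].
rewrite cE -sum1_count big_mkcond /=.
rewrite (eq_bigr (fun i => \sum_(r <- rs) (q i r : nat))%N); last first.
  by move=> i _; rewrite cE -sum1_count big_mkcond /=; apply: eq_bigr => r _; case: (q i r).
rewrite exchange_big /=; apply: leq_sum => r _; case: ifP => // /h[i is_ qir].
by rewrite (big_rem i)//= qir.
Qed.

Lemma roots_in_sub a pr pr' : (forall r, pr r -> pr' r) -> (roots_in a pr <= roots_in a pr')%N.
Proof.
move=> h; case: (roots_inE a) => [[_ ->]//|[rs [g [_ _ cE]]]].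
by rewrite !cE; exact: sub_count.
Qed.

Let sn : R := Num.sqrt n%:R.
Let sn0 : 0 < sn. Proof. by rewrite sqrtr_gt0 ltr0n. Qed.

Definition inside t := (- (pi / 2) < t) && (t < pi / 2).

Lemma cos_inside t : inside t -> 0 < cos t.
Proof. by move=> /andP[h1 h2]; apply: cos_gt0_pihalf; rewrite h1. Qed.

Lemma angle_ge t r : inside t -> (t <= angle n r) = (sn * tan t <= r).
Proof.
move=> /andP[t1 t2]; rewrite -[in LHS](@tanK _ t) ?in_itv /= ?t1//.
rewrite /angle (_ : (_ <= atan _) = (tan t <= r / sn)).
  by rewrite ler_pdivlMr// mulrC.
have := @lt_atan R; case: (leP (tan t) (r / sn)) => h L; first by rewrite le_atan.
by rewrite leNgt L.
Qed.

Lemma angle_le t r : inside t -> (angle n r <= t) = (r <= sn * tan t).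
Proof.
move=> /andP[t1 t2]; rewrite -[in LHS](@tanK _ t) ?in_itv /= ?t1//.
rewrite /angle (_ : (atan _ <= atan _) = (r / sn <= tan t)).
  by rewrite ler_pdivrMr// mulrC.
have := @lt_atan R; case: (leP (r / sn) (tan t)) => h L; first by rewrite le_atan.
by rewrite leNgt L.
Qed.

Lemma circle_value_sign a ta tb : inside ta -> inside tb ->
  exists2 c : R, 0 < c & circle_value a ta * circle_value a tb =
    c * ((elliptic_poly a).[sn * tan ta] * (elliptic_poly a).[sn * tan tb]).
Proof.
move=> ia ib; have ca := cos_inside ia; have cb := cos_inside ib.
exists (cos ta ^+ n * cos tb ^+ n); first by rewrite mulr_gt0// exprn_gt0.
by rewrite -!elliptic_polyE ?gt_eqF// mulrACA.
Qed.

Definition cell ta tb : pred R := fun r => ta <= angle n r <= tb.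
Definition open_cell ta tb : pred R := fun r => ta < angle n r < tb.

Lemma cell_one_root a ta tb : inside ta -> inside tb -> ta <= tb ->
  roots_in a (cell ta tb) = 1%N -> circle_value a ta * circle_value a tb <= 0.
Proof.
move=> ia ib ab; case: (roots_inE a) => [[_ ->]//|[rs [g [pE gx cE]]]].
rewrite cE => c1; have [c c0 ->] := circle_value_sign a ia ib.
rewrite pmulr_rle0//; apply: (sign_change_of_count1 _ pE gx).
  have : tan ta <= tan tb.
    move: ab; rewrite le_eqVlt => /orP[/eqP->//|ab]; apply: ltW.
    by rewrite ltr_tan.
  by rewrite ler_pM2l.
by rewrite -c1; apply: eq_count => r /=; rewrite /cell angle_ge// angle_le.
Qed.

Lemma open_cell_root a ta tb rs g : inside ta -> inside tb -> ta <= tb ->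
  elliptic_poly a = \prod_(r <- rs) ('X - r%:P) * g -> (forall x, ~~ root g x) ->
  circle_value a ta * circle_value a tb < 0 -> (0 < count (open_cell ta tb) rs)%N.
Proof.
move=> ia ib ab pE gx; have [c c0 ->] := circle_value_sign a ia ib.
rewrite pmulr_rlt0// => h.
have tt : sn * tan ta <= sn * tan tb.
  move: ab; rewrite le_eqVlt => /orP[/eqP->//|ab]; rewrite ler_pM2l//; apply: ltW.
  by rewrite ltr_tan.
apply: leq_trans (count_ge1_of_sign_change tt pE gx h) _.
apply: sub_count => r /= /andP[h1 h2]; rewrite /open_cell.
by rewrite !ltNge angle_le// angle_ge// -!ltNge h1 h2.
Qed.

(** Each sign change costs a root in its own open cell, and these cells are
    disjoint. *)
Lemma sign_changes_le_roots a pr (th : nat -> R) (s : seq nat) : uniq s ->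
  {homo th : i j / (i <= j)%N >-> i <= j} ->
  (forall j, j \in s -> inside (th j) && inside (th j.+1)) ->
  (forall j r, j \in s -> open_cell (th j) (th j.+1) r -> pr r) ->
  (\sum_(j <- s) (circle_value a (th j) * circle_value a (th j.+1) < 0)%R <= roots_in a pr)%N.
Proof.
move=> us mth ins hpr; case: (roots_inE a) => [[p0 _]|[rs [g [pE gx cE]]]].
  rewrite big_seq big1// => j /ins /andP[i1 i2].
  have [c _ ->] := circle_value_sign a i1 i2.
  by rewrite p0 !horner0 !mulr0 ltxx.
rewrite cE; apply: (@leq_trans (\sum_(j <- s) count (open_cell (th j) (th j.+1)) rs)%N).
  rewrite big_seq [leqRHS]big_seq; apply: leq_sum => j js.
  have /andP[i1 i2] := ins j js.
  case: (boolP (_ < 0)) => // h; exact: (open_cell_root i1 i2 (mth _ _ (leqnSn j)) pE gx h).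
rewrite (eq_bigr (fun j => \sum_(r <- rs) (open_cell (th j) (th j.+1) r : nat))%N); last first.
  by move=> j _; rewrite -sum1_count big_mkcond /=; apply: eq_bigr => r _; case: (open_cell _ _ r).
rewrite exchange_big /= -sum1_count [leqRHS]big_mkcond /=; apply: leq_sum => r _.
case: (boolP (has (fun j => open_cell (th j) (th j.+1) r) s)) => [/hasP[j js jr]|/hasPn h]; last first.
  by rewrite big_seq big1// => j /h /negbTE ->.
rewrite (hpr j r js jr) (bigD1_seq j)//= jr big_seq_cond big1// => i /andP[is_ ij].
apply/eqP; rewrite eqb0; apply/negP => /andP[h1 h2]; move: jr => /andP[h3 h4].
have [ij'|ij'|e] := ltngtP i j; last by rewrite e eqxx in ij.
- have := mth _ _ ij'; rewrite leNgt => /negP; apply; exact: lt_trans h3 h2.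
- have := mth _ _ ij'; rewrite leNgt => /negP; apply; exact: lt_trans h1 h4.
Qed.

End counting_on_cells.

(** * The width of the cells *)

Section cell_width.
Context (R : realType).
Implicit Types x y u : R.

Lemma expRN_ge_cubic u : 0 <= u -> 1 - u + u ^+ 2 / 2 - u ^+ 3 / 6 <= expR (- u).
Proof.
move=> u0; rewrite -subr_ge0.
apply: (@ge0_of_derive R (fun x => expR (- x) - (1 - x + x ^+ 2 / 2 - x ^+ 3 / 6))
   (fun x => 1 - x + x ^+ 2 / 2 - expR (- x))) => //.
- move=> y; apply: is_derive_eq; rewrite /GRing.scale /=; by field.
- by rewrite !expr0n /= !mul0r oppr0 expR0 !addr0 subrr.
- by move=> y y0; rewrite subr_ge0; exact: expRN_le_quad.
Qed.

Lemma cos_le_gauss x : 0 <= x <= 1 -> cos x <= expR (- (x ^+ 2 / 2)).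
Proof.
move=> /andP[x0 x1]; apply: (le_trans (cos_le_quartic x)).
have u0 : 0 <= x ^+ 2 / 2 by rewrite divr_ge0// sqr_ge0.
apply: le_trans (expRN_ge_cubic u0).
have x2 : x ^+ 2 <= 1 by rewrite expr_le1.
have : x ^+ 2 * x ^+ 4 <= 1 * x ^+ 4 by rewrite ler_wpM2r// exprn_even_ge0.
have : 0 <= x ^+ 4 by rewrite exprn_even_ge0.
rewrite (_ : (x ^+ 2 / 2) ^+ 2 = x ^+ 4 / 4); last by field.
rewrite (_ : (x ^+ 2 / 2) ^+ 3 = x ^+ 2 * x ^+ 4 / 8); last by field.
lra.
Qed.

Lemma cos_ge_gauss x : 0 <= x <= 1 -> expR (- (x ^+ 2 / 2 + x ^+ 4)) <= cos x.
Proof.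
move=> /andP[x0 x1]; apply: le_trans (cos_ge_quad x).
pose u := x ^+ 2 / 2.
have x2 : x ^+ 2 <= 1 by rewrite expr_le1.
have u0 : 0 <= u by rewrite divr_ge0// sqr_ge0.
have u1 : u <= 1 / 2 by rewrite /u; lra.
apply: (@le_trans _ _ (expR (- (u + 2 * u ^+ 2)))).
  rewrite ler_expR lerN2 /u.
  rewrite (_ : (x ^+ 2 / 2) ^+ 2 = x ^+ 4 / 4); last by field.
  have : 0 <= x ^+ 4 by rewrite exprn_even_ge0.
  lra.
have v0 : 0 <= u + 2 * u ^+ 2 by rewrite addr_ge0// mulr_ge0// sqr_ge0.
apply: (le_trans (expRN_le_quad v0)); rewrite -/u.
have -> : (u + 2 * u ^+ 2) ^+ 2 / 2 = u ^+ 2 * ((1 + 2 * u) ^+ 2 / 2) by field.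
have h : (1 + 2 * u) ^+ 2 / 2 <= 2 by nra.
have := ler_wpM2l (sqr_ge0 u) h; lra.
Qed.

Lemma tan_small x : `|x| <= 1 -> 0 < cos x /\ `|tan x| <= 2 * `|x|.
Proof.
move=> x1; have x2 : x ^+ 2 <= 1.
  by rewrite -[x ^+ 2]real_normK ?num_real// expr_le1.
have c2 : 1 / 2 <= cos x by apply: le_trans (cos_ge_quad x); lra.
have c0 : 0 < cos x by lra.
split => //; rewrite /tan normrM normfV (gtr0_norm c0) ler_pdivrMr//.
have s1 : `|sin x| <= `|x|.
  case: (leP 0 x) => x0.
    rewrite ger0_norm ?sin_ge0_pi ?x0//=; first by rewrite (ger0_norm x0) sin_le_id.
    by have := pi_ge2 R; have := ler_norm x; lra.
  have x0' : 0 <= - x by rewrite oppr_ge0 ltW.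
  rewrite -normrN -sinN -[`|x|]normrN.
  rewrite ger0_norm ?sin_ge0_pi ?x0'//=; first by rewrite (ger0_norm x0') sin_le_id.
  by have := pi_ge2 R; have := ler_norm (- x); rewrite normrN; lra.
apply: (le_trans s1); have := normr_ge0 x; nra.
Qed.

Context (n k : nat) (n0 : (0 < n)%N) (k24 : (24 <= k)%N).
Let al : R := wedge_angle R k.
Let nn0 : 0 < n%:R :> R. Proof. by rewrite ltr0n. Qed.
Let kk0 : 0 < k%:R :> R. Proof. by rewrite ltr0n; lia. Qed.

Lemma wedge_angle_bounds : 2 / k%:R <= al <= 4 / k%:R.
Proof.
have p4 : pi / 2 <= 2 :> R by rewrite ltW// pihalf_lt2.
have p2 : 2 <= pi :> R by exact: pi_ge2.
by rewrite /al /wedge_angle !ler_pM2r ?invr_gt0//; lra.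
Qed.

Lemma wedge_angle_small : 0 < al <= 1 / 6.
Proof.
have /andP[h1 h2] := wedge_angle_bounds.
have k24' : 24 <= k%:R :> R by rewrite (ler_nat R 24).
apply/andP; split; first by apply: lt_le_trans h1; rewrite divr_gt0.
by apply: (le_trans h2); rewrite ler_pdivrMr//; lra.
Qed.

(** The cells are chosen so that the values at both ends of a cell have
    correlation exactly [cos (pi / k)]. *)
Definition cell_width : R := acos ((cos al) `^ (n%:R^-1)).
Local Notation be := cell_width.

Let al0 : 0 < al. Proof. by have /andP[] := wedge_angle_small. Qed.
Let al6 : al <= 1 / 6. Proof. by have /andP[] := wedge_angle_small. Qed.
Let ca0 : 0 < cos al.
Proof. by have := cos_ge_quad al; have := al0; have := al6; nra. Qed.

Let ca1 : cos al < 1.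
Proof.
have h : 0 <= al <= 1 by have := al0; have := al6; lra.
apply: (le_lt_trans (cos_le_gauss h)).
by rewrite expR_lt1 oppr_lt0 divr_gt0// exprn_gt0.
Qed.

Let y := (cos al) `^ (n%:R^-1).
Let y0 : 0 < y. Proof. exact: powR_gt0. Qed.
Let yn : y ^+ n = cos al.
Proof. by rewrite -powR_mulrn ?(ltW y0)// -powRrM mulVf ?powRr1 ?(ltW ca0)// gt_eqF. Qed.
Let y1 : y < 1.
Proof.
rewrite ltNge; apply/negP => h; have := ca1; rewrite -yn ltNge => /negP; apply.
by apply: exprn_ege1.
Qed.

Let yin : -1 <= y < 1. Proof. by rewrite y1 andbT (le_trans _ (ltW y0)). Qed.

Lemma cos_cell_width : cos be = y.
Proof. by move: yin => /andP[h1 h2]; rewrite acosK// in_itv /= h1 ltW. Qed.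

Lemma cos_cell_widthX : cos be ^+ n = cos al.
Proof. by rewrite cos_cell_width yn. Qed.

Lemma cell_width_gt0 : 0 < be. Proof. exact: acos_gt0. Qed.

Lemma cell_width_le : be <= al.
Proof.
have be_pi : be <= pi by apply: acos_lepi; move: yin => /andP[-> /ltW].
rewrite leNgt; apply/negP => h.
have : cos be < cos al.
  have bi : be \in `[0, pi] by rewrite in_itv /= (ltW cell_width_gt0).
  have ai : al \in `[0, pi] by rewrite in_itv /= (ltW al0) (le_trans (ltW h)).
  by rewrite ltr_cos.
rewrite cos_cell_width -yn ltNge => /negP; apply.
rewrite -[leRHS]expr1; apply: ler_wiXn2l => //; exact: ltW.
Qed.

Let be01 : 0 <= be <= 1.
Proof. by rewrite (ltW cell_width_gt0) (le_trans cell_width_le)//; have := al6; lra. Qed.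
Let al01 : 0 <= al <= 1. Proof. by rewrite (ltW al0); have := al6; lra. Qed.

Lemma cell_width_sqr_le : n%:R * be ^+ 2 <= al ^+ 2 + 2 * al ^+ 4.
Proof.
have h1 := cos_ge_gauss al01.
have : expR (- (al ^+ 2 / 2 + al ^+ 4)) <= expR (n%:R * (- (be ^+ 2 / 2))).
  apply: (le_trans h1); rewrite expRM_natl -cos_cell_widthX.
  apply: lerXn2r; rewrite ?nnegrE ?expR_ge0//; last exact: cos_le_gauss.
  by rewrite cos_cell_width ltW.
rewrite ler_expR; lra.
Qed.

Lemma cell_width_sqr_ge : al ^+ 2 - 18 * al ^+ 4 <= n%:R * be ^+ 2.
Proof.
have h1 := cos_le_gauss al01.
have : expR (n%:R * (- (be ^+ 2 / 2 + be ^+ 4))) <= expR (- (al ^+ 2 / 2)).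
  apply: le_trans h1; rewrite expRM_natl -cos_cell_widthX.
  by apply: lerXn2r; rewrite ?nnegrE ?expR_ge0 ?cos_cell_width ?(ltW y0)// -cos_cell_width; exact: cos_ge_gauss.
rewrite ler_expR => h2.
have h3 := cell_width_sqr_le.
have a4 : al ^+ 4 = (al ^+ 2) ^+ 2 by rewrite -exprM.
have b4 : be ^+ 4 = (be ^+ 2) ^+ 2 by rewrite -exprM.
have a2 : 0 <= al ^+ 2 by exact: sqr_ge0.
have a21 : al ^+ 2 <= 1 by have /andP[? ?] := al01; rewrite expr_le1.
have h4 : n%:R * be ^+ 2 <= 3 * al ^+ 2.
  apply: (le_trans h3); rewrite a4; nra.
have n1 : 1 <= n%:R :> R by rewrite ler1n.
have b2 : 0 <= be ^+ 2 by exact: sqr_ge0.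
have h5 : be ^+ 2 <= n%:R * be ^+ 2 by rewrite ler_peMl.
have h6 : n%:R * be ^+ 4 <= 9 * al ^+ 4.
  rewrite b4 a4 expr2 mulrA.
  apply: (@le_trans _ _ ((3 * al ^+ 2) * (3 * al ^+ 2))).
    by apply: ler_pM => //; [rewrite mulr_ge0|exact: le_trans h5 h4].
  rewrite expr2; lra.
move: h2 h6; rewrite mulrN mulrDr; lra.
Qed.

Definition scaled_width : R := Num.sqrt n%:R * be.
Local Notation b := scaled_width.

Let b0 : 0 < b. Proof. by rewrite mulr_gt0 ?sqrtr_gt0 ?cell_width_gt0. Qed.
Let b2E : b ^+ 2 = n%:R * be ^+ 2. Proof. by rewrite exprMn sqr_sqrtr. Qed.

Lemma scaled_width_bounds : 1 / k%:R <= b <= 8 / k%:R.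
Proof.
have /andP[h1 h2] := wedge_angle_bounds.
have a4 : al ^+ 4 = (al ^+ 2) * (al ^+ 2) by rewrite -exprD.
have a36 : al ^+ 2 <= 1 / 36 by have := al0; have := al6; nra.
have a2 : 0 <= al ^+ 2 by exact: sqr_ge0.
apply/andP; split.
  suff : al / 2 <= b.
    by apply: le_trans; move: h1; rewrite !mul1r; lra.
  have hal : 0 <= al / 2 by have := al0; lra.
  rewrite -ler_sqr ?nnegrE ?(ltW b0)//.
  have -> : b ^+ 2 = n%:R * be ^+ 2 := b2E.
  apply: le_trans cell_width_sqr_ge; rewrite a4 [(al / 2) ^+ 2]exprMn.
  move: a36 a2; move: (al ^+ 2) => z; nra.
suff h : b <= 2 * al.
  apply: (le_trans h); rewrite (_ : 8 / k%:R = 2 * (4 / k%:R)); last by ring.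
  by rewrite ler_pM2l.
have hal : 0 <= 2 * al by have := al0; lra.
rewrite -ler_sqr ?nnegrE ?(ltW b0)//.
have -> : b ^+ 2 = n%:R * be ^+ 2 := b2E.
apply: (le_trans cell_width_sqr_le); rewrite a4 [(2 * al) ^+ 2]exprMn.
move: a36 a2; move: (al ^+ 2) => z; nra.
Qed.

(** Taking logarithms in [cos be ^ n = cos (pi / k)] gives
    [n * be ^ 2 = (pi / k) ^ 2 + O((pi / k) ^ 4)]. *)
Lemma scaled_width_approx : `|b / pi - 1 / k%:R| <= 576 / k%:R ^+ 3.
Proof.
have p2 : 2 <= pi :> R by exact: pi_ge2.
have p0 : 0 < pi :> R by exact: pi_gt0.
have kE : 1 / k%:R = al / pi by rewrite /al /wedge_angle mulrAC divff ?gt_eqF.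
have a4 : al ^+ 4 = al * al * (al * al) by rewrite !exprS expr0; ring.
have hu := cell_width_sqr_le; have hl := cell_width_sqr_ge.
rewrite -b2E in hu hl.
have key : `|b - al| <= 18 * al ^+ 3.
  have a3 : 0 <= al ^+ 3 by rewrite exprn_ge0// ltW.
  have sumE : (b - al) * (b + al) = b ^+ 2 - al ^+ 2 by ring.
  have ab : 0 < b + al by rewrite addr_gt0.
  rewrite -(ler_pM2r ab) -[X in _ * X <= _](gtr0_norm ab) -normrM sumE.
  have : 18 * al ^+ 3 * al <= 18 * al ^+ 3 * (b + al).
    have a18 : 0 <= 18 * al ^+ 3 by rewrite pmulr_rge0.
    by apply: ler_wpM2l => //; rewrite lerDr ltW.
  have -> : 18 * al ^+ 3 * al = 18 * al ^+ 4 by ring.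
  have : 0 <= al ^+ 4 by rewrite exprn_ge0// ltW.
  by move=> q0 q1; rewrite ler_norml; apply/andP; split; lra.
rewrite kE -mulrBl normrM normfV (gtr0_norm p0) ler_pdivrMr//.
apply: (le_trans key); have /andP[_ h2] := wedge_angle_bounds.
have h3 : al ^+ 3 <= (4 / k%:R) ^+ 3.
  by apply: lerXn2r; rewrite ?nnegrE ?divr_ge0// ltW.
apply: (@le_trans _ _ (576 / k%:R ^+ 3 * 2)).
  apply: (@le_trans _ _ (18 * (4 / k%:R) ^+ 3)); first by rewrite ler_pM2l.
  by rewrite le_eqVlt; apply/orP; left; apply/eqP; field; rewrite gt_eqF.
by rewrite ler_wpM2l// divr_ge0// exprn_ge0.
Qed.

Lemma tan_cell_width : 0 < tan be /\ Num.sqrt n%:R * tan be <= 16 / k%:R.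
Proof.
have bn : `|be| <= 1 by have /andP[h1 h2] := be01; rewrite ger0_norm.
have [cb tb] := tan_small bn.
have /andP[_ hb] := scaled_width_bounds.
rewrite (gtr0_norm cell_width_gt0) in tb; split.
  rewrite /tan divr_gt0// sin_gt0_pi// cell_width_gt0 /=.
  by have /andP[_ h] := be01; have := pi_ge2 R; lra.
have := ler_norm (tan be) => h.
apply: (@le_trans _ _ (Num.sqrt n%:R * (2 * be))).
  by rewrite ler_wpM2l ?sqrtr_ge0// (le_trans h).
by rewrite mulrCA -/b; move: hb; lra.
Qed.

End cell_width.

Lemma sin_cos_lower (R : realType) (t g : R) : 0 <= g -> 2 * g <= 1 ->
  g <= `|t| <= pi / 2 - g -> g / 2 <= `|sin t * cos t|.
Proof.
move=> g0 g1; wlog t0 : t / 0 <= t.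
  move=> h; case: (leP 0 t) => [|/ltW]; first exact: h.
  rewrite -oppr_ge0 -[`|t|]normrN => t0 ht; have := h _ t0 ht.
  by rewrite sinN cosN mulNr normrN.
rewrite (ger0_norm t0) => /andP[gt tg].
apply: le_trans (ler_norm _).
have s2 : g <= sin (g + g).
  have y0 : 0 <= g + g by rewrite addr_ge0.
  have := sin_ge_cubic y0.
  have : (g + g) ^+ 3 <= g + g by rewrite exprS ler_piMr// expr_le1//; lra.
  lra.
have c1 : 0 <= cos (t + g) by apply: cos_ge0_pihalf; have := pi_ge0 R; lra.
have c2 : 0 <= sin (t - g) by apply: sin_ge0_pi; have := pi_ge0 R; lra.
have : 0 <= cos (t + g) * sin (t - g) by exact: mulr_ge0.
have -> : cos (t + g) * sin (t - g) = sin t * cos t - sin (g + g) / 2.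
  rewrite cosD sinB sinD; have := cos2Dsin2 t; have := cos2Dsin2 g.
  move: (cos t) (sin t) (cos g) (sin g) => ct st cg sg h1 h2.
  transitivity (st * ct * (cg ^+ 2 + sg ^+ 2) - (cg * sg) * (ct ^+ 2 + st ^+ 2)); first by ring.
  by rewrite h1 h2; field.
lra.
Qed.

(** * Expected number of roots in a cell *)

Lemma absorb_factor (R : realType) (x y c : R) : 0 < x -> 0 < y -> 0 <= c -> c <= x ->
  c / (x * y) <= y^-1.
Proof.
move=> x0 y0 c0 cx; rewrite invfM mulrA ler_piMl ?invr_ge0 ?(ltW y0)//.
by rewrite ler_pdivrMr// mul1r.
Qed.

Lemma le_mul9 (R : realType) (x y : R) : 0 <= y -> x <= y -> x <= 9 * y.
Proof. lra. Qed.

Lemma expR1_le4 (R : realType) : expR 1 <= 4 :> R.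
Proof.
have h2 : 1 / 2 <= expR (- (1 / 2)) :> R by have := expR_ge1Dx (- (1 / 2) : R); lra.
have e1 : expR (1 / 2) <= 2 :> R.
  by rewrite -[expR (1 / 2)]invrK -expRN invf_ple ?posrE ?expR_gt0//; lra.
have -> : 1 = 1 / 2 + 1 / 2 :> R by field.
by rewrite expRD; have := expR_ge0 (1 / 2 : R); nra.
Qed.

Lemma sqr_le_100 (R : realType) (x : R) : 0 <= x -> x <= 1 / 400 -> 100 * x ^+ 2 <= 1.
Proof. nra. Qed.

Lemma add_one_part (R : realType) (b i : R) : b <= i -> 1024 * i + b <= 1025 * i.
Proof. lra. Qed.

Lemma add_small_parts (R : realType) (i x y : R) : 0 < i -> x <= 1024 * i -> y <= 1025 * i ->
  x + y <= 2100 * i.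
Proof. lra. Qed.

Lemma cluster_size_le (R : realType) (l y u : R) : 10000 <= l -> l <= y ->
  u <= 2 * (1 + 9 * y + l) -> u + 1 <= 22 * y.
Proof. lra. Qed.

Lemma cell_budget (R : realType) (i s x y z : R) : 0 < i -> x <= s + 13000 * i ->
  y <= 5 * i -> z <= 6 * i -> x + y + z <= s + 14000 * i.
Proof. lra. Qed.

Section expected_counts.
Context (R : realType) (n : nat) (n0 : (0 < n)%N).
Context (e : R) (e0 : 0 < e) (e1 : e <= 1) (C : R) (C0 : 0 <= C) (q : R).
Context (d : measure_display) (T : measurableType d) (P : probability T R).
Context (X : 'I_n.+1 -> {RV P >-> R}).
Hypotheses (hX : jointly_independent X) (nX : forall j, normalized e P C (X j)).
Hypothesis hq : forall j y, Pr P [set w | `|X j w - y| <= 1 / 2] <= 1 - q.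
Hypotheses (q0 : 0 < q) (q1 : q <= 1).

Let A (w : T) : 'I_n.+1 -> R := fun j => X j w.
Let nn0 : 0 < n%:R :> R. Proof. by rewrite ltr0n. Qed.

Context (l gh : nat).
Local Notation lr := (l%:R : R).

(** All requirements on the scale [l]: it must lie between a large power of
    [ln n] and a small power of [n]. *)
Record scale_ok : Prop := ScaleOk {
  scale_big : 10000 <= lr;
  scale_nu : clt_error e C (l ^ 16) (3 / lr ^+ gh) (9 * lr ^+ 53) <= (lr ^+ 190)^-1;
  scale_tau : (4 * lr ^+ 53 + 1) * expR (- lr) <= (lr ^+ 17)^-1;
  scale_exp : 4 * n%:R ^+ 2 * n.+1%:R <= expR lr;
  scale_lac : n.+1%:R ^+ 2 * (lr * expR (- lr ^+ 2)) <= 1 / 4;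
  scale_spread : (1 - q / 2) ^+ l <= n%:R ^- 3;
  scale_q : 1 / n.+1%:R ^+ 4 <= q / 2;
  scale_n : lr ^+ 17 <= n%:R;
  scale_gh : 32 * lr ^+ 2 <= lr ^+ (2 * gh) }.

Hypothesis ok : scale_ok.

Let l0 : 0 < lr. Proof. by apply: lt_le_trans (scale_big ok); lra. Qed.
Let l1 : 1 <= lr. Proof. by apply: le_trans (scale_big ok); lra. Qed.
Let l8192 : 2 * 4096 <= lr. Proof. by have := scale_big ok; lra. Qed.
Let l4096 : 4096 <= lr. Proof. by have := scale_big ok; lra. Qed.
Let l9240 : 22 * 420 <= lr. Proof. by have := scale_big ok; lra. Qed.
Let l16 : 16 <= lr. Proof. by have := scale_big ok; lra. Qed.
Let ln0 : (0 < l)%N. Proof. by rewrite -(ltr0n R). Qed.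

(** The squared weights at angle [t] are binomial with variance
    [n * sin t ^ 2 * cos t ^ 2]; when it is large, every weight is small. *)
Definition good_angle t := lr ^+ (2 * gh) / 2 <= Num.sqrt (n%:R * sin t ^+ 2 * cos t ^+ 2).

Lemma circle_weight_small t (i : 'I_n.+1) : good_angle t -> `|circle_weight t i| <= 3 / lr ^+ gh.
Proof.
move=> gt.
have lg : 0 < lr ^+ gh by rewrite exprn_gt0.
have S0 : 0 < Num.sqrt (n%:R * sin t ^+ 2 * cos t ^+ 2).
  by apply: lt_le_trans gt; rewrite divr_gt0// exprn_gt0.
have s2c2 : 0 < n%:R * sin t ^+ 2 * cos t ^+ 2 by rewrite -sqrtr_gt0.
have sn0 : sin t != 0 by apply: contraTneq s2c2 => ->; rewrite expr0n /= mulr0 mul0r ltxx.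
have cn0 : cos t != 0 by apply: contraTneq s2c2 => ->; rewrite expr0n /= mulr0 ltxx.
have p0 : 0 < sin t ^+ 2 by rewrite lt_neqAle sqr_ge0 eq_sym sqrf_eq0 sn0.
have p1 : sin t ^+ 2 < 1.
  by rewrite sin2cos2 gtrBl lt_neqAle sqr_ge0 eq_sym sqrf_eq0 cn0.
have [m mn um] := binom_mode_exists n p0 p1.
have hm : binom_weight n (sin t ^+ 2) i * Num.sqrt (n%:R * sin t ^+ 2 * (1 - sin t ^+ 2)) <= 3.
  by apply: (binom_max_le p0 p1 mn um); rewrite -cos2sin2.
rewrite -cos2sin2 -circle_weight_sqr in hm.
rewrite -ler_sqr ?nnegrE ?divr_ge0 ?(ltW lg)// real_normK ?num_real//.
rewrite [leRHS]exprMn exprVn ler_pdivlMr ?exprn_gt0//.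
have w0 := sqr_ge0 (circle_weight t i).
apply: (@le_trans _ _ (circle_weight t i ^+ 2 * (2 * Num.sqrt (n%:R * sin t ^+ 2 * cos t ^+ 2)))).
  apply: ler_wpM2l => //; rewrite -exprM mulnC.
  by move: gt; rewrite /good_angle; lra.
lra.
Qed.

Lemma half_pow_le (K : nat) (x : R) : 2 * x <= K%:R -> (1 / 2) ^+ K <= expR (- x).
Proof.
move=> xK; apply: (@le_trans _ _ (expR (- (1 / 2)) ^+ K)).
  apply: lerXn2r; rewrite ?nnegrE ?expR_ge0//.
  by have := expR_ge1Dx (- (1 / 2) : R); lra.
rewrite -expRM_natl ler_expR; lra.
Qed.

Lemma wild_prob t tau (TT : R) (K : nat) : good_angle t -> 0 < tau ->
  100 * n%:R * tau ^+ 2 <= TT -> 2 * (TT + 9 * lr ^+ 4 + lr) <= K%:R ->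
  Pr P (wild_event X t (5 * tau) (n%:R ^+ 2 * expR TT) K) <= 6 * n%:R ^- 3.
Proof.
move=> gt tau0 hT hK.
set M := n%:R ^+ 2 * expR TT.
have M0 : 0 < M by rewrite mulr_gt0 ?expR_gt0 ?exprn_gt0.
have Q0 : 0 < 5 * tau by rewrite mulr_gt0.
have mA1 : measurable [set w | M < coef_norm n (5 * tau) (tangent_poly (A w) t)].
  by apply: measurable_gt; exact: measurable_coef_norm.
have mF r : measurable [set w | `|circle_value (A w) t| <= r].
  rewrite (_ : [set w | _] = [set w | `|lincomb X (circle_weight t) w| <= r]).
    by apply: measurable_norm_le; exact: measurable_lincomb.
  by apply/seteqP; split => w /=; rewrite circle_value_lincomb.
apply: (le_trans (Pr_setU P mA1 (mF _))).
have h1 : Pr P [set w | M < coef_norm n (5 * tau) (tangent_poly (A w) t)] <= 4 * n%:R ^- 3.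
  apply: (le_trans (coef_norm_tail hX nX t Q0 M0)).
  have T0 : 0 <= TT by apply: le_trans hT; apply: mulr_ge0; [rewrite mulr_ge0|exact: sqr_ge0].
  have -> : 4 * n%:R * (5 * tau) ^+ 2 = 100 * n%:R * tau ^+ 2 by ring.
  apply: (@le_trans _ _ (4 / M ^+ 2 * expR (2 * TT))).
    rewrite ler_wpM2l//; first by rewrite divr_ge0// sqr_ge0.
    by rewrite ler_expR; apply: (le_trans hT); lra.
  have e2 : expR (2 * TT) = expR TT ^+ 2 by rewrite -expRM_natl.
  have eT := expR_gt0 TT.
  rewrite e2 /M (_ : _ * _ = 4 * (n%:R ^+ 4)^-1); last first.
    by move: (expR TT) eT (n%:R : R) nn0 => E E0 N N0; field; rewrite !gt_eqF.
  rewrite ler_pM2l// lef_pV2 ?posrE ?exprn_gt0// ler_weXn2l// ler1n//.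
have h2 : Pr P [set w | `|circle_value (A w) t| <= (1 / 2) ^+ K * M] <= 2 * n%:R ^- 3.
  have hS : 16 * lr ^+ 2 <= Num.sqrt (n%:R * sin t ^+ 2 * cos t ^+ 2).
    by apply: le_trans gt; have := scale_gh ok; lra.
  apply: le_trans (angle_small_ball n0 hX nX hq q0 q1 ln0 hS (scale_lac ok)
    (scale_spread ok) (scale_q ok)).
  apply: Pr_le => // w /= h; apply: (le_trans h).
  have hp := half_pow_le hK.
  apply: (le_trans (ler_wpM2r (ltW M0) hp)).
  have -> : - (TT + 9 * lr ^+ 4 + lr) = - TT + (- (9 * lr ^+ 4)) + (- lr) by ring.
  rewrite !expRD /M !expRN.
  have E1 := expR_gt0 TT; have E2 := expR_gt0 (9 * lr ^+ 4); have E3 := expR_gt0 lr.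
  have N1 : 0 < n.+1%:R :> R by rewrite ltr0n.
  have hE := scale_exp ok.
  move: (expR TT) (expR (9 * lr ^+ 4)) (expR lr) E1 E2 E3 hE => a b c a0 b0 c0 hE.
  rewrite [leLHS](_ : _ = n%:R ^+ 2 / c * b^-1); last by field; rewrite !gt_eqF.
  rewrite [leRHS]mulrC ler_pM2r ?invr_gt0// ler_pdivrMr// mulrC ler_pdivlMr ?mulr_gt0//.
  by apply: le_trans hE; rewrite le_eqVlt; apply/orP; left; apply/eqP; ring.
lra.
Qed.

(** Outside the wild event there are at most [K] roots; on it the degree [n] is
    a sufficient bound, since its probability is of order [n ^ -3]. *)
Lemma cluster_expectation t tau (TT : R) (pr : pred R) : good_angle t -> 0 < tau ->
  100 * n%:R * tau ^+ 2 <= TT ->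
  (forall r, pr r -> cos (angle n r - t) != 0 /\ `|tan (angle n r - t)| <= tau) ->
  exists Y : T -> R, [/\ summable_rv P Y, forall w, (roots_in (A w) pr)%:R <= Y w &
    Ex P Y <= 2 * (TT + 9 * lr ^+ 4 + lr) + 7].
Proof.
move=> gt tau0 hT hpr.
have T0 : 0 <= TT by apply: le_trans hT; apply: mulr_ge0; [rewrite mulr_ge0|exact: sqr_ge0].
have x0 : 0 <= 2 * (TT + 9 * lr ^+ 4 + lr).
  by rewrite mulr_ge0// !addr_ge0// mulr_ge0// exprn_ge0.
set x := 2 * (TT + 9 * lr ^+ 4 + lr) in x0 *.
have /andP[K1 K2] : (Num.truncn x)%:R <= x < (Num.truncn x).+1%:R by exact: truncn_itv.
set K := (Num.truncn x).+1 in K2.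
have wp := wild_prob gt tau0 hT (ltW K2).
set W := wild_event X t (5 * tau) (n%:R ^+ 2 * expR TT) K in wp.
have mW : measurable W by exact: measurable_wild.
have iW := summable_indic P mW.
exists (fun w => K%:R + n%:R * \1_W w); split.
- by apply: summableD; [exact: summable_cst|exact: summableZ].
- move=> w; rewrite indicE; case: (boolP (w \in W)) => [_|/negP h] /=.
    rewrite mulr1 -natrD ler_nat; apply: (leq_trans (roots_in_le _ _)); exact: leq_addl.
  rewrite mulr0 addr0 ler_nat; apply: (roots_in_le_wild n0 tau0 hpr (_ : ~ W w)) => hw.
  by apply: h; exact: mem_set.
rewrite (ExD (summable_cst P _) (summableZ _ iW)) Ex_cst ExZ// Ex_indic//.
have : n%:R * Pr P W <= n%:R * (6 * n%:R ^- 3) by rewrite ler_wpM2l.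
have -> : n%:R * (6 * n%:R ^- 3) = 6 / n%:R ^+ 2 :> R.
  by move: (n%:R : R) nn0 => N N0; field; rewrite gt_eqF.
have : 6 / n%:R ^+ 2 <= 6 :> R.
  rewrite ler_pdivrMr ?exprn_gt0// ler_peMr// exprn_ege1// ler1n//.
rewrite /K -natr1; lra.
Qed.

Let k := (l ^ 16)%N.
Let kE : k%:R = lr ^+ 16. Proof. by rewrite natrX. Qed.

Let k24 : (24 <= k)%N.
Proof.
rewrite -(ler_nat R) kE; apply: (@le_trans _ _ lr).
  by apply: le_trans (scale_big ok); lra.
by rewrite -[leLHS]expr1 ler_weXn2l.
Qed.

Local Notation be := (cell_width R n k).

(** The powers of [l] balance the errors of [wedge_error]: small balls at scale
    [l ^ -17], values up to [l ^ 9], smoothing degree [4 * l ^ 53]. The number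
    13000 exceeds [12 * 1025] with room for the two other error terms. *)
Lemma cell_sign_prob t : good_angle t -> good_angle (t + be) ->
  1 / k%:R - 13000 / lr ^+ 17 <=
    Pr P [set w | circle_value (A w) t * circle_value (A w) (t + be) < 0] /\
  Pr P [set w | circle_value (A w) t * circle_value (A w) (t + be) <= 0] <=
    1 / k%:R + 13000 / lr ^+ 17.
Proof.
move=> g1 g2.
have k4 : (4 <= k)%N by apply: leq_trans k24.
have w1 s : \sum_(j < n.+1) circle_weight s j ^+ 2 = 1 :> R.
  rewrite (eq_bigr (fun j => circle_weight s j * circle_weight s j)); last by move=> j _; rewrite expr2.
  by rewrite circle_weight_dot subrr cos0 expr1n.
have wab : \sum_(j < n.+1) circle_weight t j * circle_weight (t + be) j = cos (wedge_angle R k).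
  rewrite circle_weight_dot opprD addrA subrr add0r cosN.
  exact: (cos_cell_widthX R n0 k24).
have ka0 : 0 <= 3 / lr ^+ gh by rewrite divr_ge0// exprn_ge0.
have D0 : 0 <= 9 * lr ^+ 53 by rewrite mulr_ge0// exprn_ge0.
set nu := clt_error e C k (3 / lr ^+ gh) (9 * lr ^+ 53).
have nub : nu <= (lr ^+ 190)^-1 by exact: scale_nu ok.
have NE : (l ^ 17)%:R = lr ^+ 17 by rewrite natrX.
have pl a b : (a <= b)%N -> lr ^+ a <= lr ^+ b by move=> ab; rewrite ler_weXn2l.
have pli a b : (a <= b)%N -> (lr ^+ b)^-1 <= (lr ^+ a)^-1.
  by move=> ab; rewrite lef_pV2 ?posrE ?exprn_gt0// pl.
have hm : (4 * l ^ 53)%:R = 4 * lr ^+ 53 by rewrite natrM natrX.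
have c1 : (0 < l ^ 17)%N by rewrite expn_gt0 ln0.
have c2 : (l ^ 17)%:R <= 9 * lr ^+ 53.
  by rewrite NE; apply: (le_trans (pl 17 53 isT)); rewrite ler_peMl ?exprn_ge0//; lra.
have c3 : 0 < lr ^+ 9 by rewrite exprn_gt0.
have c4 : (2 * (4 * l ^ 53)%:R + 1) / lr ^+ 9 <= 9 * lr ^+ 53.
  rewrite hm ler_pdivrMr//; have h53 : 1 <= lr ^+ 53 by rewrite exprn_ege1.
  have h9 : 1 <= lr ^+ 9 by rewrite exprn_ege1.
  by apply: (@le_trans _ _ (9 * lr ^+ 53)); [lra|rewrite ler_peMr// mulr_ge0//; lra].
have c5 : 1024 / (l ^ 17)%:R + 16 * nu <= 1025 / lr ^+ 17.
  rewrite NE; apply: add_one_part.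
  apply: (@le_trans _ _ (16 * (lr ^+ 190)^-1)); first by rewrite ler_pM2l.
  rewrite ler_pdivrMr ?exprn_gt0// mulrC (_ : lr ^+ 190 = lr ^+ 173 * lr ^+ 17); last by rewrite -exprD.
  rewrite mulfK ?gt_eqF ?exprn_gt0//; apply: (@le_trans _ _ lr).
    by apply: le_trans (scale_big ok); lra.
  by rewrite -[leLHS]expr1 pl.
have c6 : 1 / (lr ^+ 9) ^+ 2 <= 1025 / lr ^+ 17.
  rewrite -exprM; apply: ler_pM => //; first by lra.
  exact: pli.
have := sign_change_prob e0 e1 C0 hX nX k4 (w1 t) (w1 (t + be)) wab
  (fun j => circle_weight_small j g1) (fun j => circle_weight_small j g2) ka0 D0
  c1 c2 c3 c4 c5 c6.
rewrite -/nu.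
have -> : [set w | lincomb X (circle_weight t) w * lincomb X (circle_weight (t + be)) w < 0] =
   [set w | circle_value (A w) t * circle_value (A w) (t + be) < 0].
  by apply/seteqP; split => w /=; rewrite !circle_value_lincomb.
have -> : [set w | lincomb X (circle_weight t) w * lincomb X (circle_weight (t + be)) w <= 0] =
   [set w | circle_value (A w) t * circle_value (A w) (t + be) <= 0].
  by apply/seteqP; split => w /=; rewrite !circle_value_lincomb.
suff hE : wedge_error (4 * l ^ 53) ((l ^ 17)%:R)^-1 (lr ^+ 9) nu (1025 / lr ^+ 17) <= 13000 / lr ^+ 17.
  move=> [h1 h2]; split; first by apply: le_trans h1; rewrite lerD2l lerN2.
  by apply: (le_trans h2); rewrite lerD2l.
rewrite /wedge_error hm NE.
have -> : 4 * lr ^+ 53 * ((lr ^+ 17)^-1 / (2 * lr ^+ 9)) ^+ 2 = lr.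
  rewrite (_ : lr ^+ 53 = lr * (lr ^+ 17 * lr ^+ 9) ^+ 2); last by rewrite -!exprD -exprM -exprS.
  by move: (lr ^+ 17) (lr ^+ 9) (exprn_gt0 17 l0) (exprn_gt0 9 l0) => x y x0 y0; field; rewrite !gt_eqF.
have ht := scale_tau ok.
have c7 : nu * (4 * lr ^+ 53 + 1) ^+ 2 <= (lr ^+ 17)^-1.
  apply: (@le_trans _ _ ((lr ^+ 190)^-1 * lr ^+ 108)).
    apply: ler_pM => //.
    - by rewrite /nu /clt_error !mulr_ge0 ?powR_ge0 ?sqr_ge0 ?addr_ge0 ?mulr_ge0.
    rewrite (_ : lr ^+ 108 = (lr ^+ 54) ^+ 2); last by rewrite -exprM.
    apply: lerXn2r; rewrite ?nnegrE ?addr_ge0 ?mulr_ge0 ?exprn_ge0//.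
    have h53 : 1 <= lr ^+ 53 by rewrite exprn_ege1.
    apply: (@le_trans _ _ (5 * lr ^+ 53)); first by lra.
    by rewrite exprS ler_wpM2r ?exprn_ge0//; have := scale_big ok; lra.
  rewrite (_ : lr ^+ 190 = lr ^+ 82 * lr ^+ 108); last by rewrite -exprD.
  by rewrite invfM -mulrA mulVf ?gt_eqF ?exprn_gt0// mulr1 pli.
have i17 : 0 < (lr ^+ 17)^-1 by rewrite invr_gt0 exprn_gt0.
lra.
Qed.

Lemma good_tan : 0 < tan be /\ Num.sqrt n%:R * tan be <= 1 / 400.
Proof.
have [h1 h2] := tan_cell_width R n0 k24; split => //; apply: (le_trans h2).
have ll16 : lr <= lr ^+ 16 by rewrite -[leLHS]expr1 ler_weXn2l.
have lb := scale_big ok.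
rewrite kE ler_pdivrMr; [lra|exact: exprn_gt0].
Qed.

(** Two roots in a cell make both endpoint values tiny, which is much rarer
    than one sign change. *)
Lemma cell_expectation t : inside t -> inside (t + be) ->
  good_angle t -> good_angle (t + be) ->
  exists Y : T -> R, [/\ summable_rv P Y,
    forall w, (roots_in (A w) (cell n t (t + be)))%:R <= Y w &
    Ex P Y <= 1 / k%:R + 14000 / lr ^+ 17].
Proof.
move=> i1 i2 g1 g2.
have be0 : 0 < be by exact: (cell_width_gt0 R n0 k24).
have be6 : be < 1.
  have /andP[_ h] := wedge_angle_small R n0 k24.
  by have := cell_width_le R n0 k24; lra.
have be1 := ltW be6.
have [tan0 tanb] := good_tan.
pose sn : R := Num.sqrt n%:R.
have sn0 : 0 < sn by rewrite sqrtr_gt0.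
have sn2 : sn ^+ 2 = n%:R by rewrite sqr_sqrtr// ltW.
have tb2 : 100 * n%:R * tan be ^+ 2 <= 1.
  by rewrite -sn2 -mulrA -exprMn; apply: sqr_le_100 => //; apply: mulr_ge0; exact: ltW.
have ben : `|be| <= 1 by rewrite gtr0_norm.
have [cb _] := tan_small ben.
have cellE r : cell n t (t + be) r -> cos (angle n r - t) != 0 /\ `|tan (angle n r - t)| <= tan be.
  move=> /andP[a1 a2].
  have y0 : 0 <= angle n r - t by rewrite subr_ge0.
  have yb : angle n r - t <= be by rewrite lerBlDl.
  have p2 := pi_ge2 R.
  have yn : `|angle n r - t| <= 1 by rewrite ger0_norm// (le_trans yb).
  have [cy _] := tan_small yn.
  split; first by rewrite gt_eqF.
  rewrite ger0_norm; last by rewrite /tan divr_ge0 ?(ltW cy)// sin_ge0_pi// y0 /=; lra.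
  case: (ltgtP (angle n r - t) be) yb => // [h|->//] _; apply: ltW.
  by rewrite ltr_tan// in_itv /=; apply/andP; split; lra.
have x0 : 0 <= 2 * (1 + 9 * lr ^+ 4 + lr).
  by rewrite mulr_ge0// !addr_ge0// mulr_ge0// exprn_ge0.
set x := 2 * (1 + 9 * lr ^+ 4 + lr) in x0 *.
have /andP[K1 K2] : (Num.truncn x)%:R <= x < (Num.truncn x).+1%:R by exact: truncn_itv.
set K := (Num.truncn x).+1 in K2.
have wp := wild_prob g1 tan0 tb2 (ltW K2).
set W := wild_event X t (5 * tan be) (n%:R ^+ 2 * expR 1) K in wp.
have mW : measurable W by exact: measurable_wild.
pose Q : R := sn^-1.
have Q0 : 0 < Q by rewrite invr_gt0.
have tQ : tan be <= Q / 400.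
  by rewrite /Q -[sn^-1]mul1r mulrAC ler_pdivlMr// mulrC.
(* [l ^ 12] makes [M] improbable at the scale [l ^ -24] and still leaves the
   two end values below [4096 / l ^ 20] when there are two roots. *)
pose M : R := lr ^+ 12.
have M0 : 0 < M by rewrite exprn_gt0.
pose r : R := (64 / k%:R) ^+ 2 * M.
pose B1 := [set w | M < coef_norm n Q (tangent_poly (A w) t)].
pose B2 := [set w | `|lincomb X (circle_weight t) w| <= r /\
                    `|lincomb X (circle_weight (t + be)) w| <= r].
have mB1 : measurable B1 by apply: measurable_gt; exact: measurable_coef_norm.
have mB2 : measurable B2.
  rewrite (_ : B2 = [set w | `|lincomb X (circle_weight t) w| <= r] `&`
     [set w | `|lincomb X (circle_weight (t + be)) w| <= r]).
    by apply: measurableI; apply: measurable_norm_le; exact: measurable_lincomb.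
  by apply/seteqP; split.
have mB := measurableU _ _ mB1 mB2.
pose S := [set w | circle_value (A w) t * circle_value (A w) (t + be) <= 0].
have SE : S = [set w | lincomb X (circle_weight t) w * lincomb X (circle_weight (t + be)) w <= 0].
  by rewrite /S; apply/seteqP; split => w /=; rewrite !circle_value_lincomb.
have mS : measurable S.
  by rewrite SE; apply: measurable_le0; apply: measurable_funM; exact: measurable_lincomb.
have iS := summable_indic P mS; have iB := summable_indic P mB; have iW := summable_indic P mW.
have two w : (2 <= roots_in (A w) (cell n t (t + be)))%N -> (B1 `|` B2) w.
  move=> c2; case: (ltP M (coef_norm n Q (tangent_poly (A w) t))) => hM; [by left|right].
  have tQ' : tan be < Q by apply: le_lt_trans tQ _; lra.
  have c0 : (0 < roots_in (A w) (cell n t (t + be)))%N by exact: leq_trans c2.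
  have rat : 2 * tan be / (Q - tan be) <= 64 / k%:R.
    have [_ h16] := tan_cell_width R n0 k24.
    have Qt : 0 < Q - tan be by rewrite subr_gt0.
    rewrite ler_pdivrMr//.
    have h : tan be <= 16 / k%:R * Q.
      by rewrite /Q ler_pdivlMr// mulrC.
    have k0 : 0 < 64 / k%:R :> R by rewrite divr_gt0// kE exprn_gt0.
    have h' : Q / 2 <= Q - tan be by lra.
    have := ler_wpM2l (ltW k0) h'.
    have -> : 64 / k%:R * (Q / 2) = 2 * (16 / k%:R * Q) by field; rewrite kE gt_eqF// exprn_gt0.
    lra.
  have rat0 : 0 <= 2 * tan be / (Q - tan be).
    by apply: divr_ge0; [apply: mulr_ge0 => //; exact: ltW|rewrite subr_ge0 ltW].
  have k64 : 64 / k%:R <= 1 :> R.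
    have ll16 : lr <= lr ^+ 16 by rewrite -[leLHS]expr1 ler_weXn2l.
    rewrite kE ler_pdivrMr ?exprn_gt0// mul1r; apply: le_trans ll16.
    by apply: le_trans (scale_big ok); lra.
  have val y : `|y| <= tan be -> `|(tangent_poly (A w) t).[y]| <= r.
    move=> hy; apply: (le_trans (roots_in_small n0 Q0 (ltW tan0) tQ' cellE hy c0)).
    apply: ler_pM => //; rewrite ?exprn_ge0 ?coef_norm_ge0//.
    apply: (@le_trans _ _ ((64 / k%:R) ^+ roots_in (A w) (cell n t (t + be)))).
      by apply: lerXn2r; rewrite ?nnegrE// divr_ge0.
    by apply: ler_wiXn2l => //; rewrite divr_ge0.
  split; rewrite -circle_value_lincomb.
    by rewrite circle_value0; apply: val; rewrite normr0 ltW.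
  rewrite circle_value_tangent ?gt_eqF// normrM normrX.
  apply: (@le_trans _ _ (1 * r)); last by rewrite mul1r.
  apply: ler_pM => //; rewrite ?exprn_ge0//; last by apply: val; rewrite gtr0_norm.
  by apply: exprn_ile1 => //; exact: cos_max.
exists (fun w => \1_S w + K%:R * \1_(B1 `|` B2) w + n%:R * \1_W w); split.
- by apply: summableD; [apply: summableD => //|]; exact: summableZ.
- move=> w; set N := roots_in _ _.
  have p1 : 0 <= \1_S w :> R by [].
  have p2 : 0 <= K%:R * \1_(B1 `|` B2) w :> R by rewrite mulr_ge0.
  have p3 : 0 <= n%:R * \1_W w :> R by rewrite mulr_ge0.
  case: (leqP N 1) => N1.
    case: (posnP N) => [->|N0]; first by rewrite mulr0n !addr_ge0.
    have N1' : N = 1%N by apply/eqP; rewrite eqn_leq N1.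
    have : w \in S.
      apply/mem_set; apply: (cell_one_root n0 i1 i2 _ N1').
      by rewrite lerDl ltW.
    by move=> h; rewrite N1' indicE h -addrA lerDl addr_ge0.
  case: (boolP (w \in W)) => [hw|/negP hw].
    apply: (@le_trans _ _ n%:R); first by rewrite ler_nat roots_in_le.
    by rewrite [\1_W w]indicE hw mulr1 lerDr addr_ge0.
  have NK : (N <= K)%N.
    by apply: (roots_in_le_wild n0 tan0 cellE (_ : ~ W w)) => h; apply: hw; exact: mem_set.
  have hB : w \in B1 `|` B2 by apply/mem_set; exact: two.
  rewrite [\1_(B1 `|` B2) w]indicE hB mulr1.
  apply: (@le_trans _ _ K%:R); first by rewrite ler_nat.
  by rewrite addrAC lerDr addr_ge0.
have [_ hS] := cell_sign_prob g1 g2.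
rewrite (ExD (summableD iS (summableZ K%:R iB)) (summableZ n%:R iW)) (ExD iS (summableZ K%:R iB)).
rewrite (ExZ _ iB) (ExZ _ iW) (Ex_indic _ mS) (Ex_indic _ mB) (Ex_indic _ mW).
have hW : n%:R * Pr P W <= 6 / lr ^+ 17.
  apply: (@le_trans _ _ (n%:R * (6 * n%:R ^- 3))); first by rewrite ler_wpM2l.
  have -> : n%:R * (6 * n%:R ^- 3) = 6 / n%:R ^+ 2 :> R.
    by move: (n%:R : R) nn0 => N N0; field; rewrite gt_eqF.
  rewrite ler_pM2l// lef_pV2 ?posrE ?exprn_gt0//.
  apply: (le_trans (scale_n ok)); rewrite expr2 ler_peMl// ler1n//.
have hB : Pr P (B1 `|` B2) <= 2100 / lr ^+ 22.
  apply: (le_trans (Pr_setU P mB1 mB2)).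
  have hB1 : Pr P B1 <= 1024 / lr ^+ 22.
    apply: (le_trans (coef_norm_tail hX nX t Q0 M0)).
    have -> : 4 * n%:R * Q ^+ 2 = 4%:R * 1 by rewrite /Q exprVn sn2; field; rewrite gt_eqF.
    rewrite expRM_natl.
    have e4 := expR1_le4 R.
    have e256 : expR 1 ^+ 4 <= 256 :> R.
      by rewrite (_ : 256 = 4 ^+ 4 :> R); [apply: lerXn2r; rewrite ?nnegrE ?expR_ge0|ring].
    apply: (@le_trans _ _ (4 / M ^+ 2 * 256)).
      by rewrite ler_wpM2l// divr_ge0// sqr_ge0.
    rewrite mulrAC (_ : 4 * 256 = 1024 :> R); last by ring.
    have M2 : M ^+ 2 = lr ^+ 24 by rewrite /M -exprM.
    rewrite M2; apply: ler_wpM2l; first exact: ler0n.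
    by rewrite lef_pV2 ?posrE ?exprn_gt0//; apply: ler_weXn2l.
  have hB2 : Pr P B2 <= 1025 / lr ^+ 22.
    have k4 : (4 <= k)%N by apply: leq_trans k24.
    have w1 s : \sum_(j < n.+1) circle_weight s j ^+ 2 = 1 :> R.
      rewrite (eq_bigr (fun j => circle_weight s j * circle_weight s j)); last by move=> j _; rewrite expr2.
      by rewrite circle_weight_dot subrr cos0 expr1n.
    have wab : \sum_(j < n.+1) circle_weight t j * circle_weight (t + be) j = cos (wedge_angle R k).
      rewrite circle_weight_dot opprD addrA subrr add0r cosN.
      exact: (cos_cell_widthX R n0 k24).
    have ka0 : 0 <= 3 / lr ^+ gh by rewrite divr_ge0// exprn_ge0.
    have D0 : 0 <= 9 * lr ^+ 53 by rewrite mulr_ge0// exprn_ge0.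
    have pl a b : (a <= b)%N -> lr ^+ a <= lr ^+ b by move=> ab; rewrite ler_weXn2l.
    have hD (a : nat) : (a <= 53)%N -> (l ^ a)%:R <= 9 * lr ^+ 53.
      move=> a53; rewrite natrX; apply: le_mul9; [exact: exprn_ge0|exact: pl].
    have rE : r = 4096 / lr ^+ 20.
      rewrite /r /M kE (_ : lr ^+ 20 = lr ^+ 16 * lr ^+ 4); last by rewrite -exprD.
      rewrite (_ : lr ^+ 16 = lr ^+ 12 * lr ^+ 4); last by rewrite -exprD.
      rewrite (_ : lr ^+ 12 = (lr ^+ 4) ^+ 3); last by rewrite -exprM.
      by move: (lr ^+ 4) (exprn_gt0 4 l0) => y y0; field; rewrite gt_eqF.
    have r1 : r <= ((l ^ 19)%:R)^-1.
      rewrite rE natrX (_ : lr ^+ 20 = lr * lr ^+ 19); last by rewrite -exprS.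
      apply: absorb_factor; [exact: l0|exact: exprn_gt0|exact: ler0n|].
      exact: l4096.
    have r2 : 2 * k%:R * r <= ((l ^ 3)%:R)^-1.
      rewrite rE kE natrX (_ : lr ^+ 20 = lr ^+ 16 * (lr * lr ^+ 3)); last by rewrite -exprS -exprD.
      have lz : lr ^+ 16 != 0 by rewrite gt_eqF// exprn_gt0.
      rewrite [leLHS](_ : _ = 2 * 4096 / (lr * lr ^+ 3)); last first.
        by move: (lr ^+ 16) lz (lr ^+ 3) (exprn_gt0 3 l0) => y y0 z z0; field; rewrite y0 !gt_eqF.
      apply: absorb_factor; [exact: l0|exact: exprn_gt0|rewrite -natrM; exact: ler0n|].
      exact: l8192.
    have c19 : (0 < l ^ 19)%N by rewrite expn_gt0 ln0.
    have c3 : (0 < l ^ 3)%N by rewrite expn_gt0 ln0.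
    apply: (le_trans (both_small_prob e0 e1 C0 hX nX k4 (w1 t) (w1 (t + be)) wab
      (fun j => circle_weight_small j g1) (fun j => circle_weight_small j g2) ka0 D0
      c19 c3 (hD 19%N isT) (hD 3%N isT) r1 r2)).
    rewrite !natrX -exprD.
    apply: add_one_part.
    apply: (@le_trans _ _ (16 * (lr ^+ 190)^-1)); first by rewrite ler_pM2l//; exact: scale_nu ok.
    rewrite ler_pdivrMr ?exprn_gt0// mulrC (_ : lr ^+ 190 = lr ^+ 168 * lr ^+ 22); last by rewrite -exprD.
    rewrite mulfK ?gt_eqF ?exprn_gt0//; apply: (@le_trans _ _ lr).
      exact: l16.
    by rewrite -[leLHS]expr1 pl.
  have i22 : 0 < (lr ^+ 22)^-1 by rewrite invr_gt0 exprn_gt0.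
  exact: add_small_parts i22 hB1 hB2.
have hKB : K%:R * Pr P (B1 `|` B2) <= 5 / lr ^+ 17.
  have K22 : K%:R <= 22 * lr ^+ 4.
    have l4 : lr <= lr ^+ 4 by rewrite -[leLHS]expr1 ler_weXn2l.
    by rewrite /K -natr1; exact: cluster_size_le (scale_big ok) l4 K1.
  apply: (@le_trans _ _ (22 * lr ^+ 4 * (2100 / lr ^+ 22))).
    by apply: ler_pM => //; exact: Pr_ge0.
  rewrite (_ : lr ^+ 22 = lr ^+ 4 * (lr * lr ^+ 17)); last by rewrite -exprS -exprD.
  rewrite [leLHS](_ : _ = 5 * (22 * 420 / (lr * lr ^+ 17))); last first.
    by move: (lr ^+ 4) (exprn_gt0 4 l0) (lr ^+ 17) (exprn_gt0 17 l0) => y y0 z z0; field; rewrite !gt_eqF.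
  apply: ler_wpM2l; first exact: ler0n.
  apply: absorb_factor; [exact: l0|exact: exprn_gt0|rewrite -natrM; exact: ler0n|].
  exact: l9240.
have i17 : 0 < (lr ^+ 17)^-1 by rewrite invr_gt0 exprn_gt0.
exact: cell_budget i17 hS hKB hW.
Qed.

End expected_counts.

(** * The limiting density in the angle coordinate *)

Section limit_density.
Context (R : realType) (n : nat) (n0 : (0 < n)%N).
Let sn : R := Num.sqrt n%:R.
Let sn0 : 0 < sn. Proof. by rewrite sqrtr_gt0 ltr0n. Qed.
Let sn2 : sn ^+ 2 = n%:R. Proof. by rewrite sqr_sqrtr. Qed.
Let pi0 : 0 < pi :> R. Proof. exact: pi_gt0. Qed.

Definition root_density (x : R) : R := pi^-1 * (1 / (1 + x ^+ 2 / n%:R)).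
Local Notation mu := (@lebesgue_measure R).
Let F (x : R) : R := sn / pi * angle n x.

Let den1 (x : R) : 0 < 1 + x ^+ 2 / n%:R.
Proof. by rewrite ltr_pwDl// divr_ge0// sqr_ge0. Qed.

Lemma root_density_ge0 x : 0 <= root_density x.
Proof. by rewrite mulr_ge0 ?invr_ge0 ?(ltW pi0)// divr_ge0// ltW. Qed.

Lemma continuous_root_density : continuous root_density.
Proof.
move=> x; apply: cvgM; first exact: cvg_cst.
apply: cvgM; first exact: cvg_cst.
apply: cvgV; first by rewrite gt_eqF.
apply: cvgD; first exact: cvg_cst.
by apply: cvgM; [exact: exprn_continuous|exact: cvg_cst].
Qed.

Lemma measurable_root_density A : measurable_fun A (EFin \o root_density).
Proof.
apply/measurable_EFinP; apply: measurable_funTS.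
by apply: continuous_measurable_fun; exact: continuous_root_density.
Qed.

Lemma is_derive_scaled_angle (x : R) : is_derive x 1 F (root_density x).
Proof.
have h : is_derive x 1 (atan \o (fun y : R => sn^-1 *: y)) ((1 + (sn^-1 *: x) ^+ 2)^-1 * sn^-1).
  apply: is_derive1_comp; rewrite /=.
  by apply: is_derive_eq; rewrite [LHS]mulr1.
have -> : F = (sn / pi) *: (atan \o (fun y : R => sn^-1 *: y)).
  by apply/funext => y; rewrite /F /angle /= [y / _]mulrC.
apply: is_derive_eq.
rewrite /root_density -sn2 /GRing.scale /=.
have := den1 x; rewrite -sn2 => d0.
have e : 1 + (sn^-1 * x) ^+ 2 = 1 + x ^+ 2 / sn ^+ 2 by rewrite exprMn exprVn mulrC.
rewrite e; move: (1 + _) d0 => D D0.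
by move: (pi : R) pi0 => p p0; field; rewrite !gt_eqF.
Qed.

Let cF : continuous F.
Proof.
move=> x; apply: differentiable_continuous; apply/derivable1_diffP.
by have := is_derive_scaled_angle x; case.
Qed.

Let F' x : derive1 F x = root_density x.
Proof. by rewrite derive1E; have := is_derive_scaled_angle x; case. Qed.

Lemma integral_root_density x y : x <= y ->
  (\int[mu]_(z in `[x, y]) (root_density z)%:E = (F y - F x)%:E)%E.
Proof.
rewrite le_eqVlt => /orP[/eqP->|xy].
  by rewrite set_itv1 integral_set1 subrr.
rewrite (continuous_FTC2 xy (F := F)) //.
- by apply: continuous_in_subspaceT => z _; exact: continuous_root_density.
- split.
  + by move=> z _; have := is_derive_scaled_angle z; case.
  + by apply: cvg_at_right_filter; exact: cF.
  + by apply: cvg_at_left_filter; exact: cF.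
Qed.

Lemma integralT_root_density : (\int[mu]_z (root_density z)%:E = sn%:E)%E.
Proof.
rewrite ge0_symfun_integralT//=.
- rewrite (_ : [set x | _] = `[0, +oo[%classic); last first.
    by apply/seteqP; split => x/=; rewrite in_itv/= andbT.
  rewrite (@ge0_continuous_FTC2y R root_density F 0 (sn / 2)).
  + rewrite /F /angle mul0r atan0 mulr0 sube0 -EFinM.
    by congr (_%:E); field.
  + by move=> x _; exact: root_density_ge0.
  + apply/continuous_within_itvcyP; split; first by move=> x _; exact: continuous_root_density.
    by apply: cvg_at_right_filter; exact: continuous_root_density.
  + have -> : sn / 2 = sn / pi * (pi / 2) by move: (pi : R) pi0 => p p0; field; rewrite gt_eqF.
    apply: cvgM; first exact: cvg_cst.
    apply: (cvg_comp (fun x => x / sn) atan); last exact: cvgy_atan.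
    by apply: gt0_cvgMly => //; rewrite invr_gt0.
  + by move=> x _; have := is_derive_scaled_angle x; case.
  + by apply: cvg_at_right_filter; exact: cF.
  + by move=> z _; exact: F'.
- exact: root_density_ge0.
- exact: continuous_root_density.
- by move=> x /=; rewrite /root_density sqrrN.
Qed.

Let tan_le a b : inside a -> inside b -> a <= b -> sn * tan a <= sn * tan b.
Proof.
move=> ia ib; rewrite le_eqVlt => /orP[/eqP->//|ab].
by rewrite ler_pM2l// ltW// ltr_tan// in_itv.
Qed.

Let F_tan a : inside a -> F (sn * tan a) = sn / pi * a.
Proof.
move=> ia; rewrite /F /angle -/sn.
by rewrite [sn * tan a / sn]mulrAC divff ?gt_eqF// mul1r tanK// in_itv.
Qed.

(** In the angle coordinate the limiting density is constant, so its integral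
    over a set between an open and a closed angular interval is known up to
    what lies outside the angular window [[u, v]]. *)
Lemma root_density_window (A : set R) u v a b : measurable A ->
  inside u -> inside v -> u <= a -> a <= b -> b <= v ->
  (forall r, open_cell n a b r -> A r) ->
  (forall r, A r -> u <= angle n r <= v -> cell n a b r) ->
  exists m : R, [/\ (\int[mu]_(x in A) (root_density x)%:E = m%:E)%E,
    sn * (b - a) / pi <= m & m <= sn * (b - a) / pi + sn * (1 - (v - u) / pi)].
Proof.
move=> mA iu iv ua ab bv h1 h2.
have ia : inside a.
  by move: iu iv => /andP[u1 _] /andP[_ v2]; rewrite /inside; apply/andP; split; lra.
have ib : inside b.
  by move: iu iv => /andP[u1 _] /andP[_ v2]; rewrite /inside; apply/andP; split; lra.
have uv : u <= v by lra.
have f0 (B : set R) x : B x -> (0 <= (root_density x)%:E)%E.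
  by move=> _; rewrite lee_fin root_density_ge0.
pose Cab : set R := `[sn * tan a, sn * tan b]%classic.
pose Cuv : set R := `[sn * tan u, sn * tan v]%classic.
have Iab : (\int[mu]_(x in Cab) (root_density x)%:E = (sn * (b - a) / pi)%:E)%E.
  rewrite integral_root_density ?tan_le// !F_tan//; congr (_%:E).
  by move: (pi : R) pi0 => p p0; field; rewrite gt_eqF.
have Iuv : (\int[mu]_(x in Cuv) (root_density x)%:E = (sn * (v - u) / pi)%:E)%E.
  rewrite integral_root_density ?tan_le// !F_tan//; congr (_%:E).
  by move: (pi : R) pi0 => p p0; field; rewrite gt_eqF.
have mC : measurable Cuv by exact: measurable_itv.
have mab : measurable Cab by exact: measurable_itv.
have Iout : (\int[mu]_(x in ~` Cuv) (root_density x)%:E = (sn * (1 - (v - u) / pi))%:E)%E.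
  have := integralT_root_density.
  rewrite -(setUv Cuv) ge0_integral_setU //; last 4 first.
  - exact: measurableC.
  - exact: measurable_root_density.
  - exact: f0.
  - by apply/disj_setPCl.
  rewrite Iuv; set J := integral _ _ _ => hJ.
  have -> : (sn * (1 - (v - u) / pi))%:E = (sn%:E - (sn * (v - u) / pi)%:E)%E.
    by rewrite -EFinB; congr (_%:E); rewrite mulrBr mulr1 mulrA.
  by rewrite -hJ addeAC subee// add0e.
have up : (\int[mu]_(x in A) (root_density x)%:E <=
    (sn * (b - a) / pi + sn * (1 - (v - u) / pi))%:E)%E.
  rewrite EFinD -Iab -Iout -ge0_integral_setU //; first last.
  - apply/eqP; rewrite -subset0 => x [].
    rewrite /Cab /Cuv /= !in_itv /= => /andP[x1 x2]; apply.
    apply/andP; split; first by apply: le_trans x1; exact: tan_le.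
    by apply: (le_trans x2); exact: tan_le.
  - exact: f0.
  - exact: measurable_root_density.
  - exact: measurableC.
  apply: ge0_subset_integral => //.
  - by apply: measurableU => //; exact: measurableC.
  - exact: measurable_root_density.
  - exact: f0.
  - move=> x Ax; case: (pselect (Cuv x)) => [|h]; last by right.
    rewrite /Cuv /= in_itv /= -angle_ge// -angle_le// => huv; left.
    by rewrite /Cab /= in_itv /= -angle_ge// -angle_le//; exact: h2.
have lo : ((sn * (b - a) / pi)%:E <= \int[mu]_(x in A) (root_density x)%:E)%E.
  rewrite -Iab /Cab (integral_itv_bndoo true false); last exact: measurable_root_density.
  apply: ge0_subset_integral => //.
  - exact: measurable_root_density.
  - exact: f0.
  - move=> x /=; rewrite in_itv /= => /andP[x1 x2]; apply: h1.
    by rewrite /open_cell !ltNge angle_le// angle_ge// -!ltNge x1 x2.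
move: up lo; case: integral => [m||]; rewrite ?leey_eq ?leeNy_eq// !lee_fin => up lo.
by exists m.
Qed.

End limit_density.

(** * Arcs *)

Lemma grid_count (R : realType) (a b be : R) : 0 < be -> a <= b ->
  exists J : nat, [/\ a + J%:R * be <= b, b < a + J.+1%:R * be &
    forall x, a <= x <= b -> exists2 j : nat, (j <= J)%N &
      a + j%:R * be <= x < a + j.+1%:R * be].
Proof.
move=> be0 ab.
have key x : a <= x -> a + (Num.truncn ((x - a) / be))%:R * be <= x < a + (Num.truncn ((x - a) / be)).+1%:R * be.
  move=> ax; have h : 0 <= (x - a) / be by rewrite divr_ge0 ?(ltW be0)// subr_ge0.
  have /andP[h1 h2] := truncn_itv h.
  by apply/andP; split; [rewrite -lerBrDl -ler_pdivlMr|rewrite -ltrBlDl -ltr_pdivrMr].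
exists (Num.truncn ((b - a) / be)); have /andP[b1 b2] := key _ ab; split => // x /andP[ax xb].
exists (Num.truncn ((x - a) / be)); last exact: key.
apply: le_truncn; rewrite ler_pM2r ?invr_gt0//; lra.
Qed.

Lemma cell_total_aux (R : realType) (J s y l c : R) : 0 < y -> 0 < l -> 0 <= c ->
  J <= 4 * s * y -> J * (c / (l * y)) <= 4 * ((c) * (s / l)).
Proof.
move=> y0 l0 c0 hJ; have h : 0 <= c / (l * y) by rewrite divr_ge0// ltW// mulr_gt0.
apply: (le_trans (ler_wpM2r h hJ)); rewrite le_eqVlt; apply/orP; left; apply/eqP.
by field; rewrite !gt_eqF.
Qed.

Lemma arc_budget (R : realType) (S x a b c : R) : 0 <= S -> x <= 14000 ->
  a + b <= 4 * ((576 + x) * S) -> c <= a -> c + b <= 60 * 1000 * S.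
Proof. by move=> S0 x1 h1 h2; have := ler_wpM2r S0 x1; lra. Qed.

Lemma arc_upper_budget (R : realType) (y b e x X E w : R) : y <= b + e -> b <= X ->
  e + x <= E -> w <= 2 -> y + x + w <= X + (E + 2).
Proof. lra. Qed.

Lemma arc_lower_budget (R : realType) (y b e x X E w u v : R) : b <= y + e ->
  X <= b + w -> w <= u + v -> u <= 1 -> v <= 1 -> e + x <= E -> X - (E + 2) <= y - x.
Proof. lra. Qed.

Section arcs.
Context (R : realType) (n : nat) (n0 : (0 < n)%N).
Context (e : R) (e0 : 0 < e) (e1 : e <= 1) (C : R) (C0 : 0 <= C) (q : R).
Context (d : measure_display) (T : measurableType d) (P : probability T R).
Context (X : 'I_n.+1 -> {RV P >-> R}).
Hypotheses (hX : jointly_independent X) (nX : forall j, normalized e P C (X j)).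
Hypothesis hq : forall j y, Pr P [set w | `|X j w - y| <= 1 / 2] <= 1 - q.
Hypotheses (q0 : 0 < q) (q1 : q <= 1).
Context (l gh : nat).
Hypothesis ok : scale_ok n e C q l gh.
Let A (w : T) : 'I_n.+1 -> R := fun j => X j w.
Local Notation lr := (l%:R : R).
Local Notation sn := (Num.sqrt n%:R : R).
Local Notation k := (l ^ 16)%N.
Local Notation be := (cell_width R n k).

Let l1 : 1 <= lr. Proof. by have := scale_big ok; lra. Qed.
Let l0 : 0 < lr. Proof. by have := scale_big ok; lra. Qed.
Let l576 : 576 <= lr. Proof. by have := scale_big ok; lra. Qed.
Let c13000 : 13000 <= 14000 :> R. Proof. lra. Qed.
Let k24 : (24 <= k)%N.
Proof.
rewrite -(ler_nat R) natrX; apply: (@le_trans _ _ lr); first by have := scale_big ok; lra.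
by rewrite -[leLHS]expr1 ler_weXn2l.
Qed.
Let kE : k%:R = lr ^+ 16. Proof. by rewrite natrX. Qed.
Let sn0 : 0 < sn. Proof. by rewrite sqrtr_gt0 ltr0n. Qed.
Let be0 : 0 < be. Proof. exact: cell_width_gt0. Qed.

Definition good_arc (a b : R) := forall t, a <= t <= b -> inside t /\ good_angle n l gh t.

Lemma arc_count (a b : R) (J : nat) : good_arc a b -> a + J%:R * be <= b ->
  J%:R <= 4 * sn * lr ^+ 16.
Proof.
move=> gab hJ; have Jb : 0 <= J%:R * be by rewrite mulr_ge0 ?(ltW be0).
have [/andP[i1 _] _] : inside a /\ good_angle n l gh a by apply: gab; apply/andP; split; lra.
have [/andP[_ i2] _] : inside b /\ good_angle n l gh b by apply: gab; apply/andP; split; lra.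
have p4 : pi / 2 <= 2 :> R by rewrite ltW// pihalf_lt2.
have {hJ} hJ : J%:R * be <= 4 by lra.
have /andP[h _] := scaled_width_bounds R n0 k24.
have kk0 : 0 < k%:R :> R by rewrite kE exprn_gt0.
rewrite -kE; move: h; rewrite /scaled_width ler_pdivrMr// => h.
have : J%:R * 1 <= J%:R * (sn * be * k%:R) by rewrite ler_wpM2l.
have -> : J%:R * (sn * be * k%:R) = (J%:R * be) * (sn * k%:R) by ring.
have : (J%:R * be) * (sn * k%:R) <= 4 * (sn * k%:R) by rewrite ler_wpM2r// mulr_ge0 ?(ltW sn0) ?(ltW kk0).
lra.
Qed.

Lemma scaled_width_bounds16 : `|sn * be / pi - 1 / lr ^+ 16| <= 576 / lr ^+ 48.
Proof.
have := scaled_width_approx R n0 k24; rewrite /scaled_width kE -exprM; exact.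
Qed.

(** The error per cell is [l ^- 17] and there are about [sqrt n * l ^ 16]
    cells, whence the arc error [sqrt n / l]. *)
Definition arc_error : R := 60 * 1000 * (sn / lr) + 2.

Let cell_total (J : nat) (x : R) : 0 <= x -> x <= 14000 -> J%:R <= 4 * sn * lr ^+ 16 ->
  J%:R * (576 / lr ^+ 48) + J%:R * (x / lr ^+ 17) <= 60 * 1000 * (sn / lr).
Proof.
move=> x0 x1 hJ.
have h1 : 576 / lr ^+ 48 <= 576 / lr ^+ 17.
  by rewrite ler_pM2l ?ltr0n// lef_pV2 ?posrE ?exprn_gt0//; apply: ler_weXn2l.
have s0 : 0 <= sn / lr by rewrite divr_ge0// ltW.
have h5 := ler_wpM2l (ler0n R J) h1.
have y0 := exprn_gt0 16 l0.
have x576 : 0 <= 576 + x by rewrite addr_ge0 ?ler0n.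
have h3 := cell_total_aux y0 l0 x576 hJ.
rewrite -exprS mulrDl mulrDr in h3.
exact: arc_budget s0 x1 h3 h5.
Qed.

Let small_step : 1 / lr ^+ 16 + 14000 / lr ^+ 17 <= 2.
Proof.
have a1 : 1 / lr ^+ 16 <= 1 by rewrite ler_pdivrMr ?exprn_gt0// mul1r exprn_ege1.
have a2 : 14000 / lr ^+ 17 <= 1.
  rewrite ler_pdivrMr ?exprn_gt0// mul1r; apply: (@le_trans _ _ (lr * lr)).
    by have := scale_big ok => h; nra.
  by rewrite -expr2 ler_weXn2l.
lra.
Qed.

(** The last cell may stick out of the arc, so the arc must remain good one cell
    width further. *)
Lemma arc_upper (a b : R) (pr : pred R) : a <= b -> good_arc a (b + be) ->
  (forall r, pr r -> cell n a b r) ->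
  exists Y : T -> R, [/\ summable_rv P Y, forall w, (roots_in (A w) pr)%:R <= Y w &
    Ex P Y <= sn * (b - a) / pi + arc_error].
Proof.
move=> ab gab hpr; have [J [J1 J2 hJ]] := grid_count be0 ab.
pose th (j : nat) := a + j%:R * be.
have thS j : th j.+1 = th j + be by rewrite /th -natr1 mulrDl mul1r addrA.
have thb j : (j <= J.+1)%N -> a <= th j <= b + be.
  move=> jJ; have jb : j%:R * be <= J.+1%:R * be by rewrite ler_pM2r// ler_nat.
  have jb0 : 0 <= j%:R * be by rewrite mulr_ge0// ltW.
  rewrite /th; apply/andP; split; first by lra.
  by move: jb; rewrite -[J.+1%:R]natr1 mulrDl mul1r; lra.
have /choice[Y hY] : forall j, exists Y : T -> R, (j <= J)%N -> [/\ summable_rv P Y,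
    forall w, (roots_in (A w) (cell n (th j) (th j.+1)))%:R <= Y w &
    Ex P Y <= 1 / k%:R + 14000 / lr ^+ 17].
  move=> j; case: (leqP j J) => jJ; last by exists (fun=> 0).
  have [i1 g1] := gab _ (thb j (leqW jJ)); have [i2 g2] := gab _ (thb j.+1 jJ).
  rewrite thS in i2 g2 *.
  have [Y hY] := cell_expectation n0 e0 e1 C0 hX nX hq q0 q1 ok i1 i2 g1 g2.
  by exists Y.
have sY j : (j < J.+1)%N -> summable_rv P (Y j) by rewrite ltnS => /hY[].
exists (fun w => \sum_(j < J.+1) Y j w); split.
- by apply: summable_sum => j _; exact: sY.
- move=> w; apply: (@le_trans _ _ (\sum_(j < J.+1) (roots_in (A w) (cell n (th j) (th j.+1)))%:R)).
    rewrite -natr_sum ler_nat -(big_mkord xpredT (fun j => roots_in (A w) (cell n (th j) (th j.+1)))).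
    apply: (@roots_in_cover R n nat (A w) pr _ (fun j => cell n (th j) (th j.+1))).
    move=> r /hpr /hJ[j jJ hr]; exists j; first by rewrite mem_index_iota.
    by rewrite /cell /=; move: hr => /andP[-> /ltW].
  by apply: ler_sum => j _; have [_ + _] := hY j (ltn_ord j); exact.
rewrite Ex_sum; last by move=> j _; exact: sY.
apply: (@le_trans _ _ (\sum_(j < J.+1) (1 / k%:R + 14000 / lr ^+ 17))).
  by apply: ler_sum => j _; have [] := hY j (ltn_ord j).
rewrite sumr_const card_ord -[_ *+ J.+1]mulr_natl -[J.+1%:R]natr1 mulrDl [1 * (_ + _)]mul1r kE.
have Jb : J%:R <= 4 * sn * lr ^+ 16.
  by apply: (arc_count gab); apply: (le_trans J1); rewrite lerDl ltW.
have ht := cell_total (ler0n R 14000) (lexx _) Jb.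
have p0 : 0 < pi :> R by exact: pi_gt0.
have hb : J%:R * (sn * be / pi) <= sn * (b - a) / pi.
  rewrite -(_ : sn / pi * (J%:R * be) = J%:R * (sn * be / pi)); last by ring.
  rewrite -(_ : sn / pi * (b - a) = sn * (b - a) / pi); last by ring.
  by apply: ler_wpM2l; [rewrite divr_ge0 ?(ltW sn0) ?(ltW p0)|lra].
have hw' : 1 / lr ^+ 16 <= sn * be / pi + 576 / lr ^+ 48.
  by have := scaled_width_bounds16; rewrite distrC ler_distl => /andP[_].
have hJw := ler_wpM2l (ler0n R J) hw'; rewrite [leRHS]mulrDr in hJw.
rewrite [J%:R * (_ + _ / lr ^+ 17)]mulrDr.
exact: arc_upper_budget hJw hb ht small_step.
Qed.

Lemma arc_lower (a b : R) (pr : pred R) : a <= b -> good_arc a b ->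
  (forall r, open_cell n a b r -> pr r) ->
  exists Y : T -> R, [/\ summable_rv P Y, forall w, 0 <= Y w <= (roots_in (A w) pr)%:R &
    sn * (b - a) / pi - arc_error <= Ex P Y].
Proof.
move=> ab gab hpr; have [J [J1 J2 hJ]] := grid_count be0 ab.
pose th (j : nat) := a + j%:R * be.
have thS j : th j.+1 = th j + be by rewrite /th -natr1 mulrDl mul1r addrA.
have th_mono : {homo th : i j / (i <= j)%N >-> i <= j}.
  by move=> i j ij; rewrite /th lerD2l ler_pM2r// ler_nat.
have thb j : (j <= J)%N -> a <= th j <= b.
  move=> jJ; apply/andP; split; last by apply: le_trans J1; exact: th_mono.
  by rewrite /th lerDl mulr_ge0// ltW.
pose S (j : nat) := [set w | circle_value (A w) (th j) * circle_value (A w) (th j.+1) < 0].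
have SE j : S j = [set w | lincomb X (circle_weight (th j)) w * lincomb X (circle_weight (th j.+1)) w < 0].
  by rewrite /S; apply/seteqP; split => w /=; rewrite !circle_value_lincomb.
have mS j : measurable (S j).
  by rewrite SE; apply: measurable_lt0; apply: measurable_funM; exact: measurable_lincomb.
have iS j := summable_indic P (mS j).
exists (fun w => \sum_(j < J) \1_(S j) w); split.
- by apply: summable_sum => j _; exact: iS.
- move=> w; rewrite sumr_ge0//=.
  have -> : \sum_(j < J) \1_(S j) w = (\sum_(j <- iota 0 J)
      (circle_value (A w) (th j) * circle_value (A w) (th j.+1) < 0)%R)%:R :> R.
    rewrite natr_sum (_ : iota 0 J = index_iota 0 J) ?big_mkord; last by rewrite /index_iota subn0.
    by apply: eq_bigr => j _; rewrite indicE; congr ((nat_of_bool _)%:R); apply/idP/idP => [/set_mem//|h]; exact/mem_set.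
  rewrite ler_nat; apply: (sign_changes_le_roots n0 (A w) (iota_uniq 0 J) th_mono).
  - move=> j; rewrite mem_iota add0n => /andP[_ jJ].
    by have [-> _] := gab _ (thb j (ltnW jJ)); have [-> _] := gab _ (thb j.+1 jJ).
  - move=> j r; rewrite mem_iota add0n => /andP[_ jJ] /andP[r1 r2]; apply: hpr.
    have /andP[t1 _] := thb j (ltnW jJ); have /andP[_ t2] := thb j.+1 jJ.
    by apply/andP; split; [exact: le_lt_trans r1|exact: lt_le_trans t2].
rewrite Ex_sum; last by move=> j _; exact: iS.
apply: (@le_trans _ _ (\sum_(j < J) (1 / k%:R - 13000 / lr ^+ 17))); last first.
  apply: ler_sum => j _; rewrite (Ex_indic _ (mS j)) /S.
  have [_ g1] := gab _ (thb j (ltnW (ltn_ord j))); have [_ g2] := gab _ (thb j.+1 (ltn_ord j)).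
  rewrite thS in g2 *.
  by have [] := cell_sign_prob n0 e0 e1 C0 hX nX ok g1 g2.
rewrite sumr_const card_ord -[_ *+ J]mulr_natl kE.
have Jb : J%:R <= 4 * sn * lr ^+ 16 by exact: (arc_count gab J1).
have ht := cell_total (ler0n R 13000) c13000 Jb.
have p0 : 0 < pi :> R by exact: pi_gt0.
have := scaled_width_bounds16; rewrite ler_distl => /andP[_ hw].
have l48 : 576 / lr ^+ 48 <= 1.
  rewrite ler_pdivrMr ?exprn_gt0// mul1r; apply: (@le_trans _ _ lr).
    exact: l576.
  by rewrite -[leLHS]expr1 ler_weXn2l.
have l16 : 1 / lr ^+ 16 <= 1 by rewrite ler_pdivrMr ?exprn_gt0// mul1r exprn_ege1.
have hb : sn * (b - a) / pi <= J%:R * (sn * be / pi) + sn * be / pi.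
  rewrite -(_ : sn / pi * (J.+1%:R * be) = J%:R * (sn * be / pi) + sn * be / pi); last by rewrite -natr1; ring.
  rewrite -(_ : sn / pi * (b - a) = sn * (b - a) / pi); last by ring.
  by apply: ler_wpM2l; [rewrite divr_ge0 ?(ltW sn0) ?(ltW p0)|lra].
have hJw := ler_wpM2l (ler0n R J) hw; rewrite [leRHS]mulrDr in hJw.
rewrite [J%:R * (_ - _ / lr ^+ 17)]mulrBr.
exact: arc_lower_budget hJw hb hw l16 l48 ht.
Qed.

End arcs.

(** * Excluded bands *)

Section counting_unions.
Context (R : realType) (n : nat).
Implicit Types (a : 'I_n.+1 -> R) (pr : pred R).

Lemma roots_in_coverU a pr (p1 p2 : pred R) : (forall r, pr r -> p1 r || p2 r) ->
  (roots_in a pr <= roots_in a p1 + roots_in a p2)%N.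
Proof.
move=> h; case: (roots_inE a) => [[_ ->]//|[rs [g [_ _ cE]]]].
rewrite !cE -count_predUI; apply: leq_trans (leq_addr _ _); exact: sub_count.
Qed.

Lemma roots_in_disjoint a pr (p1 p2 : pred R) : (forall r, p1 r -> pr r) -> (forall r, p2 r -> pr r) ->
  (forall r, p1 r -> ~~ p2 r) -> (roots_in a p1 + roots_in a p2 <= roots_in a pr)%N.
Proof.
move=> h1 h2 h12; case: (roots_inE a) => [[_ z]|[rs [g [_ _ cE]]]]; first by rewrite !z.
rewrite !cE -count_predUI (_ : count (predI p1 p2) rs = 0%N).
  by rewrite addn0; apply: sub_count => r /orP[/h1|/h2].
by apply/eqP; rewrite -leqn0 leqNgt -has_count; apply/hasPn => r _ /=; apply/negP => /andP[/h12/negP].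
Qed.

End counting_unions.

Definition clamp (R : realType) (u v x : R) := Num.max u (Num.min v x).

Lemma clamp_in (R : realType) (u v x : R) : u <= v -> u <= clamp u v x <= v.
Proof. by move=> uv; rewrite /clamp le_max lexx ge_max uv ge_min lexx. Qed.

Lemma clamp_id (R : realType) (u v x : R) : u <= x <= v -> clamp u v x = x.
Proof. by move=> /andP[ux xv]; rewrite /clamp min_r// max_r. Qed.

Lemma clamp_le (R : realType) (u v x y : R) : x <= y -> clamp u v x <= clamp u v y.
Proof.
move=> xy; rewrite /clamp ge_max !le_max lexx /=; apply/orP; right.
by rewrite le_min !ge_min lexx xy orbT.
Qed.

Lemma clamp_lt (R : realType) (u v x y : R) : u <= y <= v -> clamp u v x < y -> x < y.
Proof. by move=> /andP[uy yv]; rewrite /clamp gt_max gt_min => /andP[_ /orP[|//]]; lra. Qed.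

Lemma clamp_gt (R : realType) (u v x y : R) : u <= y <= v -> y < clamp u v x -> y < x.
Proof. by move=> /andP[uy yv]; rewrite /clamp lt_max lt_min => /orP[|/andP[_ //]]; lra. Qed.

(** The two clamps add up to the identity minus the clamp to [[- h, h]], which
    varies by at most [2 * h]. *)
Lemma two_clamps (R : realType) (h v x y : R) : 0 <= h -> h <= v -> - v <= x -> x <= y -> y <= v ->
  y - x - 2 * h <= (clamp (- v) (- h) y - clamp (- v) (- h) x) + (clamp h v y - clamp h v x)
    <= y - x.
Proof.
move=> h0 hv vx xy yv.
have key z : - v <= z -> z <= v -> [\/ z <= - h /\ clamp (- v) (- h) z + clamp h v z = z + h,
    - h <= z <= h /\ clamp (- v) (- h) z + clamp h v z = 0 |
    h <= z /\ clamp (- v) (- h) z + clamp h v z = z - h].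
  move=> z1 z2; case: (lerP z (- h)) => zh.
    constructor 1; split => //; rewrite clamp_id ?z1//; congr (_ + _).
    by rewrite /clamp min_r// max_l//; lra.
  case: (lerP z h) => zh'.
    constructor 2; split; first by rewrite (ltW zh).
    rewrite /clamp (min_l (ltW zh)) (max_r (_ : - v <= - h)); last by lra.
    by rewrite min_r// max_l// addNr.
  constructor 3; split; first exact: ltW.
  rewrite [clamp h v z]clamp_id ?(ltW zh')//.
  rewrite /clamp (min_l (ltW zh)) (max_r (_ : - v <= - h)); last by lra.
  by rewrite addrC.
have xv : x <= v by lra.
have vy : - v <= y by lra.
case: (key x vx xv) => -[k1 k2]; case: (key y vy yv) => -[k3 k4]; apply/andP; split; lra.
Qed.

Lemma window_budget (R : realType) (l G y s : R) : 10000 <= l -> l * G <= s -> y <= G ->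
  l <= y -> 2 * (6400 * G + 9 * y + l) + 7 <= 2 * s.
Proof.
move=> l1 h1 h2 h3; have G0 : 0 <= G by lra.
by have := ler_wpM2r G0 l1; lra.
Qed.

Section expected_roots.
Context (R : realType) (n : nat) (n0 : (0 < n)%N).
Context (e : R) (e0 : 0 < e) (e1 : e <= 1) (C : R) (C0 : 0 <= C) (q : R).
Context (d : measure_display) (T : measurableType d) (P : probability T R).
Context (X : 'I_n.+1 -> {RV P >-> R}).
Hypotheses (hX : jointly_independent X) (nX : forall j, normalized e P C (X j)).
Hypothesis hq : forall j y, Pr P [set w | `|X j w - y| <= 1 / 2] <= 1 - q.
Hypotheses (q0 : 0 < q) (q1 : q <= 1).
Context (l gh : nat).
Hypothesis ok : scale_ok n e C q l gh.
Let A (w : T) : 'I_n.+1 -> R := fun j => X j w.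
Local Notation lr := (l%:R : R).
Local Notation sn := (Num.sqrt n%:R : R).
Hypothesis hB : lr ^+ (4 * gh + 2) <= sn.
Local Notation k := (l ^ 16)%N.
Local Notation be := (cell_width R n k).

(** Angular half-width of the bands around [0] and [+- pi / 2] where the
    Gaussian comparison is not available. *)
Definition margin : R := lr ^+ (2 * gh) / sn.

Let l1 : 1 <= lr. Proof. by have := scale_big ok; lra. Qed.
Let l0 : 0 < lr. Proof. by have := scale_big ok; lra. Qed.
Let lb : 10000 <= lr. Proof. exact: scale_big ok. Qed.
Let k24 : (24 <= k)%N.
Proof.
rewrite -(ler_nat R) natrX; apply: (@le_trans _ _ lr); first by have := scale_big ok; lra.
by rewrite -[leLHS]expr1 ler_weXn2l.
Qed.
Let sn0 : 0 < sn. Proof. by rewrite sqrtr_gt0 ltr0n. Qed.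
Let g1 : 1 <= lr ^+ (2 * gh). Proof. exact: exprn_ege1. Qed.
Let g0 : 0 < lr ^+ (2 * gh). Proof. exact: exprn_gt0. Qed.

Lemma margin_gt0 : 0 < margin. Proof. exact: divr_gt0. Qed.
Let snm : sn * margin = lr ^+ (2 * gh).
Proof. by rewrite /margin mulrCA divff ?mulr1// gt_eqF. Qed.

Let margin_scale : lr ^+ (2 * gh) * lr ^+ (2 * gh) * (lr * lr) <= sn.
Proof. by apply: le_trans hB; rewrite -[lr * lr]expr2 -exprD -exprD -mulnDl. Qed.

Let hsl : lr * lr ^+ (2 * gh) <= sn / lr.
Proof.
rewrite ler_pdivlMr//; apply: le_trans margin_scale.
have : 0 <= lr * lr * lr ^+ (2 * gh) by rewrite !mulr_ge0// ltW.
by move: (lr ^+ (2 * gh)) g1 => G G1 h; nra.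
Qed.

Let hsl2 : lr * (lr ^+ (2 * gh) * lr ^+ (2 * gh)) <= sn / lr.
Proof.
by rewrite ler_pdivlMr//; apply: le_trans margin_scale; rewrite le_eqVlt; apply/orP; left; apply/eqP; ring.
Qed.

Lemma margin_small : 100 * margin <= 1.
Proof.
rewrite /margin mulrA ler_pdivrMr// mul1r.
have h : sn / lr <= sn by rewrite ler_pdivrMr// ler_peMr// ltW.
apply: le_trans h; apply: le_trans hsl; apply: ler_wpM2r; first exact: ltW.
by move: lb; lra.
Qed.

Let be_margin : be <= margin.
Proof.
rewrite /margin ler_pdivlMr// mulrC.
have /andP[_ h] := scaled_width_bounds R n0 k24; apply: (le_trans h).
apply: le_trans g1; rewrite ler_pdivrMr ?ltr0n//; last exact: leq_trans k24.
by rewrite mul1r (ler_nat R 8); apply: leq_trans k24.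
Qed.

Let be0 : 0 < be. Proof. exact: cell_width_gt0. Qed.

Lemma good_band t : margin <= `|t| <= pi / 2 - margin -> inside t /\ good_angle n l gh t.
Proof.
move=> ht; have m0 := margin_gt0; have ms := margin_small; split.
  move: ht => /andP[_]; rewrite /inside ler_norml => /andP[h1 h2].
  by apply/andP; split; lra.
have h := @sin_cos_lower R t margin (ltW m0) (_ : 2 * margin <= 1) ht.
have {}h : margin / 2 <= `|sin t * cos t| by apply: h; lra.
rewrite /good_angle (_ : n%:R * _ * _ = n%:R * (sin t * cos t) ^+ 2); last by ring.
rewrite sqrtrM// sqrtr_sqr -snm -mulrA; apply: ler_wpM2l => //; exact: ltW.
Qed.

Definition dominated (pr : pred R) (B : R) := exists Y : T -> R,
  [/\ summable_rv P Y, forall w, (roots_in (A w) pr)%:R <= Y w & Ex P Y <= B].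

Lemma dominatedU (pr p1 p2 : pred R) B1 B2 : dominated p1 B1 -> dominated p2 B2 ->
  (forall r, pr r -> p1 r || p2 r) -> dominated pr (B1 + B2).
Proof.
move=> [Y1 [s1 d1 b1]] [Y2 [s2 d2 b2]] h; exists (fun w => Y1 w + Y2 w); split.
- exact: summableD.
- move=> w; apply: (@le_trans _ _ (roots_in (A w) p1 + roots_in (A w) p2)%:R).
    by rewrite ler_nat; exact: roots_in_coverU.
  by rewrite natrD lerD.
- by rewrite ExD// lerD.
Qed.

(** One disc around a good angle covers each of the excluded bands; Jensen's
    bound there gives a number of roots that is negligible against [sqrt n]. *)
Lemma window_upper t (pr : pred R) : margin <= `|t| <= pi / 2 - margin ->
  (forall r, pr r -> `|angle n r - t| <= 4 * margin) -> dominated pr (2 * (sn / lr)).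
Proof.
move=> ht hpr; have m0 := margin_gt0; have ms := margin_small.
have [_ gt] := good_band ht.
have tau0 : 0 < 8 * margin by rewrite pmulr_rgt0.
have hT : 100 * n%:R * (8 * margin) ^+ 2 <= 6400 * (lr ^+ (2 * gh) * lr ^+ (2 * gh)).
  rewrite -snm -{1}(@sqr_sqrtr _ n%:R)// le_eqVlt; apply/orP; left; apply/eqP; ring.
have hw r : pr r -> cos (angle n r - t) != 0 /\ `|tan (angle n r - t)| <= 8 * margin.
  move=> /hpr hr; have h1 : `|angle n r - t| <= 1 by lra.
  have [c1 c2] := tan_small h1; split; first by rewrite gt_eqF.
  by apply: (le_trans c2); lra.
have [Y [s1 d1 b1]] := cluster_expectation n0 hX nX hq q0 q1 ok gt tau0 hT hw.
exists Y; split => //; apply: (le_trans b1).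
have G4 : lr ^+ 4 <= lr ^+ (2 * gh) * lr ^+ (2 * gh).
  rewrite (_ : lr ^+ 4 = lr ^+ 2 * lr ^+ 2); last by rewrite -exprD.
  have : lr ^+ 2 <= lr ^+ (2 * gh).
    by have := scale_gh ok; have := exprn_ge0 2 (ltW l0); lra.
  by move=> h; apply: ler_pM; rewrite ?exprn_ge0 ?(ltW l0).
have G1 : lr <= lr ^+ 4 by rewrite -[leLHS]expr1 ler_weXn2l.
exact: window_budget lb hsl2 G4 G1.
Qed.

Definition root_error : R := 200 * 1000 * (sn / lr).

Let v : R := pi / 2 - 2 * margin.
Let h2 : R := 2 * margin.

Let pi_bounds : 2 <= pi :> R /\ pi <= 4 :> R.
Proof. by split; [exact: pi_ge2|have := @pihalf_lt2 R; lra]. Qed.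

Let hv : h2 <= v.
Proof. by have [p1 p2] := pi_bounds; have ms := margin_small; rewrite /h2 /v; lra. Qed.

Let arc_pos (a b : R) : h2 <= a -> b <= v -> good_arc n l gh a (b + be).
Proof.
move=> ha hb t /andP[t1 t2]; have m0 := margin_gt0; have ms := margin_small.
apply: good_band; rewrite ger0_norm; last by move: ha; rewrite /h2; lra.
by move: ha hb be_margin; rewrite /h2 /v => *; apply/andP; split; lra.
Qed.

Let arc_neg (a b : R) : - v <= a -> b <= - h2 -> good_arc n l gh a (b + be).
Proof.
move=> ha hb t /andP[t1 t2]; have m0 := margin_gt0; have ms := margin_small.
have bm := be_margin.
apply: good_band; rewrite ler0_norm; last by move: hb; rewrite /h2; lra.
by move: ha hb; rewrite /h2 /v => *; apply/andP; split; lra.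
Qed.

Let sl1 : 1 <= sn / lr.
Proof. by apply: le_trans hsl; exact: mulr_ege1. Qed.

(** The good part of the interval is made of two arcs, and three windows cover
    the excluded bands. *)
Lemma roots_upper (a b : R) (pr : pred R) : - v <= a -> a <= b -> b <= v ->
  (forall r, pr r -> - v <= angle n r <= v -> cell n a b r) ->
  dominated pr (sn * (b - a) / pi + root_error).
Proof.
move=> va ab bv hpr; have m0 := margin_gt0; have ms := margin_small; have [p2 p4] := pi_bounds.
have vN : - v <= - h2 by rewrite lerN2.
pose a1 := clamp (- v) (- h2) a; pose b1 := clamp (- v) (- h2) b.
pose a2 := clamp h2 v a; pose b2 := clamp h2 v b.
have /andP[a1l a1r] : - v <= a1 <= - h2 by exact: clamp_in.
have /andP[b1l b1r] : - v <= b1 <= - h2 by exact: clamp_in.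
have /andP[a2l a2r] : h2 <= a2 <= v by exact: clamp_in.
have /andP[b2l b2r] : h2 <= b2 <= v by exact: clamp_in.
have ab1 : a1 <= b1 by exact: clamp_le.
have ab2 : a2 <= b2 by exact: clamp_le.
have D1 : dominated (cell n a1 b1) (sn * (b1 - a1) / pi + arc_error R n l).
  exact: (arc_upper n0 e0 e1 C0 hX nX hq q0 q1 ok ab1 (arc_neg a1l b1r)).
have D2 : dominated (cell n a2 b2) (sn * (b2 - a2) / pi + arc_error R n l).
  exact: (arc_upper n0 e0 e1 C0 hX nX hq q0 q1 ok ab2 (arc_pos a2l b2r)).
pose w1 : pred R := fun r => `|angle n r - h2| <= 4 * margin.
pose w2 : pred R := fun r => `|angle n r - v| <= 4 * margin.
pose w3 : pred R := fun r => `|angle n r - - v| <= 4 * margin.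
have W1 : dominated w1 (2 * (sn / lr)).
  apply: (@window_upper h2) => //; rewrite ger0_norm; last by rewrite /h2; lra.
  by move: hv; rewrite /h2 /v => *; apply/andP; split; lra.
have W2 : dominated w2 (2 * (sn / lr)).
  apply: (@window_upper v) => //; rewrite ger0_norm; last by rewrite /v; lra.
  by rewrite /v; apply/andP; split; lra.
have W3 : dominated w3 (2 * (sn / lr)).
  apply: (@window_upper (- v)) => //; rewrite normrN ger0_norm; last by rewrite /v; lra.
  by rewrite /v; apply/andP; split; lra.
have DU p p' B B' : dominated p B -> dominated p' B' -> dominated (predU p p') (B + B').
  by move=> h h'; apply: (dominatedU h h').
have all := DU _ _ _ _ D1 (DU _ _ _ _ D2 (DU _ _ _ _ W1 (DU _ _ _ _ W2 W3))).
have {all} [Y [s1 d1 e1']] := all.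
exists Y; split => //.
  move=> w; apply: le_trans (d1 w); rewrite ler_nat; apply: roots_in_sub => r hr /=.
  have /andP[x1 x2] : - (pi / 2) < angle n r < pi / 2.
    by rewrite /angle atan_gtNpi2 atan_ltpi2.
  rewrite /w1 /w2 /w3 !ler_norml /=.
  case: (lerP (angle n r) (- v)) => y1.
    by do 4 (apply/orP; right); move: y1; rewrite /v => y1; apply/andP; split; lra.
  case: (lerP v (angle n r)) => y2.
    by do 3 (apply/orP; right); apply/orP; left; move: y2; rewrite /v => y2; apply/andP; split; lra.
  have hc : cell n a b r by apply: hpr hr _; rewrite !ltW.
  move: hc => /andP[c1 c2].
  case: (lerP (angle n r) (- h2)) => y3.
    apply/orP; left; have ec : clamp (- v) (- h2) (angle n r) = angle n r by rewrite clamp_id// (ltW y1).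
    by rewrite /cell -ec; apply/andP; split; exact: clamp_le.
  case: (lerP h2 (angle n r)) => y4.
    apply/orP; right; apply/orP; left.
    have ec : clamp h2 v (angle n r) = angle n r by rewrite clamp_id// y4 (ltW y2).
    by rewrite /cell -ec; apply/andP; split; exact: clamp_le.
  by do 2 (apply/orP; right); apply/orP; left; move: y3 y4; rewrite /h2 => *; apply/andP; split; lra.
apply: (le_trans e1').
have h20 : 0 <= h2 by rewrite /h2; lra.
have /andP[_ tc] := two_clamps h20 hv va ab bv.
have sp0 : 0 <= sn / pi by rewrite divr_ge0 ?(ltW sn0)//; lra.
have := ler_wpM2l sp0 tc; rewrite -/a1 -/b1 -/a2 -/b2.
have -> : sn * (b - a) / pi = sn / pi * (b - a) by ring.
have -> : sn * (b1 - a1) / pi = sn / pi * (b1 - a1) by ring.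
have -> : sn * (b2 - a2) / pi = sn / pi * (b2 - a2) by ring.
rewrite [X in X <= _ -> _]mulrDr /root_error /arc_error.
move: sl1; move: (sn / lr) (sn / pi * (b - a)) (sn / pi * (b1 - a1)) (sn / pi * (b2 - a2)) => ? ? ? ?.
lra.
Qed.

Lemma roots_lower (a b : R) (pr : pred R) : - v <= a -> a <= b -> b <= v ->
  (forall r, open_cell n a b r -> pr r) ->
  exists Y : T -> R, [/\ summable_rv P Y, forall w, 0 <= Y w <= (roots_in (A w) pr)%:R &
    sn * (b - a) / pi - root_error <= Ex P Y].
Proof.
move=> va ab bv hpr; have m0 := margin_gt0; have ms := margin_small; have [p2 p4] := pi_bounds.
have vN : - v <= - h2 by rewrite lerN2.
pose a1 := clamp (- v) (- h2) a; pose b1 := clamp (- v) (- h2) b.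
pose a2 := clamp h2 v a; pose b2 := clamp h2 v b.
have /andP[a1l a1r] : - v <= a1 <= - h2 by exact: clamp_in.
have /andP[b1l b1r] : - v <= b1 <= - h2 by exact: clamp_in.
have /andP[a2l a2r] : h2 <= a2 <= v by exact: clamp_in.
have /andP[b2l b2r] : h2 <= b2 <= v by exact: clamp_in.
have ab1 : a1 <= b1 by exact: clamp_le.
have ab2 : a2 <= b2 by exact: clamp_le.
have sub a' b' t : t \in `[a', b'] -> a' <= t <= b' + be.
  by rewrite in_itv /= => /andP[-> t2] /=; apply: (le_trans t2); rewrite lerDl ltW.
have A1 : good_arc n l gh a1 b1.
  by move=> t ht; apply: (arc_neg a1l b1r); apply: sub; rewrite in_itv.
have A2 : good_arc n l gh a2 b2.
  by move=> t ht; apply: (arc_pos a2l b2r); apply: sub; rewrite in_itv.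
have [Y1 [s1 d1 b1']] := @arc_lower R n n0 e e0 e1 C C0 q d T P X hX nX l gh ok a1 b1 (open_cell n a1 b1) ab1 A1 (fun r h => h).
have [Y2 [s2 d2 b2']] := @arc_lower R n n0 e e0 e1 C C0 q d T P X hX nX l gh ok a2 b2 (open_cell n a2 b2) ab2 A2 (fun r h => h).
exists (fun w => Y1 w + Y2 w); split.
- exact: summableD.
- move=> w; have /andP[x1 y1] := d1 w; have /andP[x2 y2] := d2 w; rewrite addr_ge0//=.
  apply: (@le_trans _ _ (roots_in (A w) (open_cell n a1 b1) + roots_in (A w) (open_cell n a2 b2))%:R).
    by rewrite natrD lerD.
  rewrite ler_nat; apply: roots_in_disjoint.
  + move=> r /andP[r1 r2]; apply: hpr.
    have hr : - v <= angle n r <= - h2 by apply/andP; split; lra.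
    by rewrite /open_cell (clamp_lt hr r1) (clamp_gt hr r2).
  + move=> r /andP[r1 r2]; apply: hpr.
    have hr : h2 <= angle n r <= v by apply/andP; split; lra.
    by rewrite /open_cell (clamp_lt hr r1) (clamp_gt hr r2).
  + move=> r /andP[r1 r2]; apply/negP => /andP[r3 r4].
    have h20 : 0 < h2 by rewrite /h2; lra.
    by lra.
rewrite ExD//.
have h20 : 0 <= h2 by rewrite /h2; lra.
have /andP[tc _] := two_clamps h20 hv va ab bv.
have sp0 : 0 <= sn / pi by rewrite divr_ge0 ?(ltW sn0)//; lra.
have := ler_wpM2l sp0 tc; rewrite -/a1 -/b1 -/a2 -/b2.
have sh : sn / pi * (2 * h2) <= 2 * (sn / lr).
  have -> : sn / pi * (2 * h2) = 4 / pi * (sn * margin) by rewrite /h2; ring.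
  rewrite snm; apply: (@le_trans _ _ (2 * lr ^+ (2 * gh))).
    apply: ler_wpM2r; first exact: ltW.
    by rewrite ler_pdivrMr; lra.
  rewrite ler_pM2l//; apply: le_trans hsl; rewrite ler_peMl// ltW//.
move: b1' b2'.
have -> : sn * (b - a) / pi = sn / pi * (b - a) by ring.
have -> : sn * (b1 - a1) / pi = sn / pi * (b1 - a1) by ring.
have -> : sn * (b2 - a2) / pi = sn / pi * (b2 - a2) by ring.
rewrite [X in _ -> _ -> X <= _ -> _]mulrBr [X in _ -> _ -> _ <= X -> _]mulrDr /root_error /arc_error.
move: sl1 sh; move: (sn / pi * (2 * h2)) (sn / lr) (sn / pi * (b - a)) (sn / pi * (b1 - a1)) (sn / pi * (b2 - a2)) => ? ? ? ? ?.
lra.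
Qed.

End expected_roots.

(** * Intervals *)

(** The integral of a nonnegative function is a supremum over the simple
    functions below it, hence monotone for all nonnegative functions; the root
    count enters through two measurable bounds. *)
Lemma integral_sandwich (R : realType) d (T : measurableType d) (P : probability T R)
    (f Y1 Y2 : T -> R) : summable_rv P Y1 -> summable_rv P Y2 ->
  (forall w, 0 <= Y1 w <= f w) -> (forall w, f w <= Y2 w) ->
  exists m : R, [/\ (\int[P]_w (f w)%:E = m%:E)%E, Ex P Y1 <= m & m <= Ex P Y2].
Proof.
move=> s1 s2 h1 h2.
have mono (f1 f2 : T -> R) : (forall w, 0 <= f1 w) -> (forall w, f1 w <= f2 w) ->
    (\int[P]_w (f1 w)%:E <= \int[P]_w (f2 w)%:E)%E.
  move=> f10 f12.
  have e1 w : (0 <= (f1 w)%:E)%E by rewrite lee_fin.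
  have e2 w : (0 <= (f2 w)%:E)%E by rewrite lee_fin (le_trans (f10 w)).
  rewrite (ge0_integralTE _ e1) (ge0_integralTE _ e2).
  apply: ereal_sup_le => x [h hh <-]; exists h => // w; apply: le_trans (hh w) _.
  by rewrite lee_fin.
have fin Y : summable_rv P Y -> (\int[P]_w (Y w)%:E = (Ex P Y)%:E)%E.
  by move=> sY; rewrite /Ex /Rintegral fineK//; exact: integrable_fin_num.
have Y10 w : 0 <= Y1 w by have /andP[] := h1 w.
have Y1f w : Y1 w <= f w by have /andP[] := h1 w.
have lo := mono _ _ Y10 Y1f; rewrite (fin _ s1) in lo.
have up := mono _ _ (fun w => le_trans (Y10 w) (Y1f w)) h2; rewrite (fin _ s2) in up.
move: lo up; case: integral => [m||]; rewrite ?leey_eq ?leeNy_eq// !lee_fin => lo up.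
by exists m.
Qed.

Section interval_angles.
Context (R : realType) (n : nat) (n0 : (0 < n)%N).

Lemma angle_lt_inv (x y : R) : angle n x < angle n y -> x < y.
Proof.
apply: contraTT; rewrite -!leNgt => yx; rewrite /angle; apply: (le_atan _) => //.
by rewrite ler_pM2r// invr_gt0 sqrtr_gt0 ltr0n.
Qed.

(** In the angle coordinate an interval is, up to endpoints and outside the
    window [[- v, v]], the cell between the extreme clamped angles. *)
Lemma interval_angles (A : set R) (v : R) : is_interval A -> 0 <= v ->
  exists a b : R, [/\ - v <= a, a <= b, b <= v, forall r, open_cell n a b r -> A r &
    forall r, A r -> - v <= angle n r <= v -> cell n a b r].
Proof.
move=> iA v0; have vv : - v <= v by lra.
case: (pselect (A !=set0)) => [[x0 Ax0]|A0]; last first.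
  exists 0, 0; split; rewrite ?oppr_le0//.
  - by move=> r /andP[h1 h2]; have := lt_trans h1 h2; rewrite ltxx.
  - by move=> r Ar; exfalso; apply: A0; exists r.
pose S := [set clamp (- v) v (angle n r) | r in A].
have Sin y : S y -> - v <= y <= v by move=> [r _ <-]; exact: clamp_in.
have Su : has_ubound S by exists v => y /Sin /andP[].
have Sl : has_lbound S by exists (- v) => y /Sin /andP[].
have S0 : S !=set0 by exists (clamp (- v) v (angle n x0)); exists x0.
have S1 : S (clamp (- v) v (angle n x0)) by exists x0.
exists (inf S), (sup S); split.
- by apply: lb_le_inf => // y /Sin /andP[].
- by apply: le_trans (ub_le_sup Su S1); exact: ge_inf.
- by apply: ge_sup => // y /Sin /andP[].
- move=> r /andP[r1 r2].
  have [_ [s As <-] s1] := inf_lt S0 r1; have [_ [t At <-] t1] := sup_gt S0 r2.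
  have hs : - v <= clamp (- v) v (angle n s) <= v by exact: clamp_in.
  have ht : - v <= clamp (- v) v (angle n t) <= v by exact: clamp_in.
  have hr : - v <= angle n r <= v by apply/andP; split; lra.
  apply: (iA s t) => //; apply/andP; split; apply/ltW/angle_lt_inv.
    exact: clamp_lt hr s1.
  exact: clamp_gt hr t1.
- move=> r Ar hr; have Sr : S (angle n r) by exists r => //; exact: clamp_id.
  by apply/andP; split; [exact: ge_inf|exact: ub_le_sup].
Qed.

End interval_angles.

Lemma four_div_le (R : realType) (p : R) : 2 <= p -> 4 / p <= 2.
Proof. by move=> p2; rewrite ler_pdivrMr; lra. Qed.

Lemma estimate_budget (R : realType) (S x y1 y2 m s o : R) : 0 <= S ->
  x - 200 * 1000 * S <= y1 -> y1 <= m -> m <= y2 -> y2 <= x + 200 * 1000 * S ->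
  x <= s -> s <= x + o -> o <= 2 * S -> `|m - s| <= 2 * (200 * 1000 * S).
Proof. by move=> *; rewrite ler_norml; apply/andP; split; lra. Qed.

Section interval_estimate.
Context (R : realType) (n : nat) (n0 : (0 < n)%N).
Context (e : R) (e0 : 0 < e) (e1 : e <= 1) (C : R) (C0 : 0 <= C) (q : R).
Context (d : measure_display) (T : measurableType d) (P : probability T R).
Context (X : 'I_n.+1 -> {RV P >-> R}).
Hypotheses (hX : jointly_independent X) (nX : forall j, normalized e P C (X j)).
Hypothesis hq : forall j y, Pr P [set w | `|X j w - y| <= 1 / 2] <= 1 - q.
Hypotheses (q0 : 0 < q) (q1 : q <= 1).
Context (l gh : nat).
Hypothesis ok : scale_ok n e C q l gh.
Local Notation lr := (l%:R : R).
Local Notation sn := (Num.sqrt n%:R : R).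
Hypothesis hB : lr ^+ (4 * gh + 2) <= sn.

Lemma interval_estimate (I : interval R) : exists m s : R,
  [/\ (\int[P]_w (elliptic_zero_count (fun j => X j w) (on_real_axis [set` I]))%:R%:E = m%:E)%E,
      (\int[@lebesgue_measure R]_(x in [set` I]) (root_density n x)%:E = s%:E)%E &
      `|m - s| <= 2 * root_error R n l].
Proof.
have m0 := margin_gt0 n0 ok; have ms := margin_small n0 ok hB.
have [p2 p4] : 2 <= pi :> R /\ pi <= 4 :> R.
  by split; [exact: pi_ge2|have := @pihalf_lt2 R; lra].
set mg := margin R n l gh in m0 ms.
pose v : R := pi / 2 - 2 * mg.
have v0 : 0 <= v by rewrite /v; lra.
have [a [b [va ab bv h1 h2]]] := interval_angles n0 (@interval_is_interval _ I) v0.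
have iv : inside v by rewrite /inside /v; apply/andP; split; lra.
have iNv : inside (- v) by rewrite /inside /v; apply/andP; split; lra.
have [s [hs s1 s2]] := root_density_window n0 (measurable_itv I) iNv iv va ab bv h1 h2.
have [Y1 [i1 d1 b1]] := roots_lower n0 e0 e1 C0 hX nX ok hB va ab bv h1.
have [Y2 [i2 d2 b2]] := roots_upper n0 e0 e1 C0 hX nX hq q0 q1 ok hB va ab bv h2.
have [m [hm m1 m2]] := integral_sandwich i1 i2 d1 d2.
exists m, s; split => //.
have lb := scale_big ok; have l0 : 0 < lr by apply: lt_le_trans lb; rewrite ltr0n.
have sn0 : 0 < sn by rewrite sqrtr_gt0 ltr0n.
have G1 : 1 <= lr ^+ (2 * gh) by apply: exprn_ege1; lra.
have snm : sn * mg = lr ^+ (2 * gh) by rewrite /mg /margin mulrCA divff ?mulr1// gt_eqF.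
have hsl : lr ^+ (2 * gh) <= sn / lr.
  rewrite ler_pdivlMr//; apply: le_trans hB; rewrite -exprSr.
  by apply: ler_weXn2l; [lra|rewrite -addn1 leq_add// leq_mul2r orbT].
have out : sn * (1 - (v - - v) / pi) <= 2 * (sn / lr).
  have -> : sn * (1 - (v - - v) / pi) = 4 / pi * (sn * mg).
    by rewrite /v; move: (pi : R) p2 => p pp; field; rewrite gt_eqF//; lra.
  rewrite snm; apply: (@le_trans _ _ (2 * lr ^+ (2 * gh))).
    by apply: ler_wpM2r; [exact: le_trans G1|exact: four_div_le].
  by rewrite ler_pM2l.
have s0 : 0 <= sn / lr by rewrite divr_ge0// ltW.
exact: estimate_budget s0 b1 m1 m2 b2 s1 s2 out.
Qed.

End interval_estimate.

(** * Moments of the copies *)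

Section copies.
Context (R : realType) (d0 d : measure_display).
Context (T0 : measurableType d0) (P0 : probability T0 R) (xi : {RV P0 >-> R}).
Context (T : measurableType d) (P : probability T R) (Y : {RV P >-> R}).
Hypothesis same_law : forall B : set R, measurable B ->
  distribution P Y B = distribution P0 xi B.

Lemma same_law_integral (f : R -> \bar R) :
  (\int[distribution P Y]_y f y = \int[distribution P0 xi]_y f y)%E.
Proof. by apply: eq_measure_integral => B mB _; exact: same_law. Qed.

Lemma same_law_Ex (g : R -> R) : measurable_fun setT g -> summable_rv P0 (g \o xi) ->
  summable_rv P (g \o Y) /\ Ex P (g \o Y) = Ex P0 (g \o xi).
Proof.
move=> mg s0.
have mg' : measurable_fun setT (EFin \o g) by exact/measurable_EFinP.
have mn : measurable_fun setT (fun x => `|(EFin \o g) x|)%E by exact: measurableT_comp.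
have s : summable_rv P (g \o Y).
  apply/integrableP; split; first by apply/measurable_EFinP; apply: measurableT_comp.
  have /integrableP[_] := s0.
  have -> : (\int[P0]_x `|(EFin \o (g \o xi)) x| = \int[distribution P0 xi]_y `|(EFin \o g) y|)%E.
    by rewrite ge0_integral_distribution.
  rewrite -same_law_integral ge0_integral_distribution//.
split => //; rewrite /Ex /Rintegral; congr fine.
have := same_law_integral (EFin \o g).
by rewrite !integral_distribution.
Qed.

Lemma normalized_copy e C : normalized e P0 C xi -> normalized e P C Y.
Proof.
move=> [m1 i1 i2 ie v1 v2 vC].
have mid : measurable_fun setT (@id R) by exact: measurable_id.
have msq : measurable_fun setT (fun x : R => x ^+ 2) by exact: measurable_funX.
have mp : measurable_fun setT (fun x : R => `|x| `^ (2 + e)).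
  exact: (measurableT_comp (measurable_powR (2 + e)) (@normr_measurable R setT)).
have [s1 E1] := same_law_Ex mid i1.
have [s2 E2] := same_law_Ex msq i2.
have [s3 E3] := same_law_Ex mp ie.
split => //.
- by rewrite -v1 -E1.
- by rewrite -v2 -E2.
- by apply: le_trans vC; rewrite -E3.
Qed.

End copies.

Lemma powR_le_add1 (R : realType) (x p r : R) : 0 <= x -> 0 <= p -> p <= r -> x `^ p <= 1 + x `^ r.
Proof.
move=> x0 p0 pr; have xr := powR_ge0 x r.
case: (lerP x 1) => x1.
  have : x `^ p <= 1 `^ p by apply: ge0_ler_powR; rewrite ?nnegrE.
  by rewrite powR1; lra.
by have := ler_powR (ltW x1) pr; lra.
Qed.

Lemma normalized_of_moments (R : realType) (d : measure_display) (T : measurableType d)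
    (P : probability T R) (xi : {RV P >-> R}) (eps e C : R) : 0 < e -> e <= eps ->
  ('E_P[xi] = 0)%E -> ('V_P[xi] = 1)%E ->
  ('E_P[fun w => (`|xi w| `^ (2 + eps))%R] <= C%:E)%E -> normalized e P (1 + C) xi.
Proof.
move=> e0 ee hE hV hC.
have mxi : measurable_fun setT xi by [].
have mpow r : measurable_fun setT (fun w => `|xi w| `^ r).
  have mn : measurable_fun setT (fun w => `|xi w|) by apply: measurableT_comp => //; exact: normr_measurable.
  exact: (measurableT_comp (measurable_powR r) mn).
have seps : summable_rv P (fun w => `|xi w| `^ (2 + eps)).
  apply/integrableP; split; first exact/measurable_EFinP.
  rewrite unlock in hC; apply: le_lt_trans (ltry C); apply: le_trans hC.
  apply: ge0_le_integral => //.
  - by apply: measurableT_comp => //; exact/measurable_EFinP.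
  - exact/measurable_EFinP.
  - by move=> x _ /=; rewrite ger0_norm ?powR_ge0.
have Eeps : Ex P (fun w => `|xi w| `^ (2 + eps)) <= C.
  by rewrite -lee_fin; apply: le_trans hC; rewrite unlock /Ex /Rintegral fineK//; exact: integrable_fin_num.
have sdom : summable_rv P (fun w => 1 + `|xi w| `^ (2 + eps)).
  by apply: summableD => //; exact: summable_cst.
have spow r : 0 <= r -> r <= 2 + eps -> summable_rv P (fun w => `|xi w| `^ r).
  move=> r0 re; apply: (summable_le (mpow r) sdom) => w.
  by rewrite ger0_norm ?powR_ge0//; exact: powR_le_add1.
have s1 : summable_rv P xi.
  apply: (summable_le mxi (spow 1 _ _)); [lra|lra|] => w.
  by rewrite powRr1.
have s2 : summable_rv P (fun w => xi w ^+ 2).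
  apply: (summable_le _ (spow 2 _ _)); [exact: measurable_funX|lra|lra|] => w.
  by rewrite normrX -powR_mulrn.
have m1 : Ex P xi = 0 by rewrite /Ex /Rintegral; move: hE; rewrite unlock => ->.
split => //.
- by apply: spow; lra.
- rewrite /Ex /Rintegral.
  move: hV; rewrite /variance covariance.unlock hE expectation.unlock /=.
  have -> : (\int[P]_w ((((xi : T -> R) \- cst 0) * ((xi : T -> R) \- cst 0))%R w)%:E =
             \int[P]_w (xi w ^+ 2)%:E)%E.
    by apply: eq_integral => w _; congr (_%:E); rewrite expr2 -[xi w in RHS]subr0.
  by move=> ->.
- apply: (@le_trans _ _ (Ex P (fun w => 1 + `|xi w| `^ (2 + eps)))).
    apply: Ex_le => //; first by apply: spow; lra.
    by move=> w; apply: powR_le_add1 => //; lra.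
  by rewrite ExD//; [rewrite Ex_cst lerD2l|exact: summable_cst].
Qed.

(** * Choice of the scale *)

Section scales.
Context (R : realType).

Lemma exp_dominates (a c : R) (m : nat) : 0 < a ->
  \forall l \near \oo, c * l%:R ^+ m <= expR (a * l%:R).
Proof.
move=> a0; pose b := (a / m.+1%:R) ^+ m.+1.
have b0 : 0 < b by rewrite exprn_gt0// divr_gt0.
near=> l.
have hl : c / b <= l%:R by near: l; exact: nbhs_infty_ger.
have l0 : 0 <= l%:R :> R by [].
have h : (a / m.+1%:R * l%:R) ^+ m.+1 <= expR (a * l%:R).
  have -> : a * l%:R = m.+1%:R * (a / m.+1%:R * l%:R).
    by rewrite mulrA [m.+1%:R * _]mulrC divfK// pnatr_eq0.
  rewrite expRM_natl; apply: lerXn2r; rewrite ?nnegrE ?expR_ge0 ?mulr_ge0 ?divr_ge0// ?(ltW a0)//.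
  by apply: le_trans (expR_ge1Dx _); rewrite lerDr.
apply: le_trans h; rewrite exprMn -/b exprS [leRHS]mulrCA mulrA.
rewrite [leRHS](_ : _ = (l%:R * b) * l%:R ^+ m); last by ring.
by apply: ler_wpM2r; [exact: exprn_ge0|rewrite -ler_pdivrMr].
Unshelve. all: by end_near. Qed.

(** The Lyapunov exponent [e] buys the factor [l ^- (h * e)] in the comparison
    error; [h * e >= 297] beats the polynomial losses [l ^+ 296]. *)
Lemma clt_error_small (e C : R) (h l : nat) : 0 < e -> e <= 1 -> 0 <= C ->
  297 <= h%:R * e -> 1 <= l%:R :> R -> (3 * C + 1) * (162 * 324) <= l%:R ->
  clt_error e C (l ^ 16) (3 / l%:R ^+ (69 + h)) (9 * l%:R ^+ 53) <= (l%:R ^+ 190)^-1.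
Proof.
move=> e0 e1 C0 he l1 hl; have l0 : 0 < l%:R :> R by lra.
rewrite /clt_error natrX.
have -> : 2 * (9 * l%:R ^+ 53) * (3 * l%:R ^+ 16 * (3 / l%:R ^+ (69 + h))) = 162 * (l%:R ^+ h)^-1 :> R.
  rewrite exprD (_ : l%:R ^+ 69 = l%:R ^+ 53 * l%:R ^+ 16 :> R); last by rewrite -exprD.
  move: (l%:R ^+ 53) (exprn_gt0 53 l0) (l%:R ^+ 16) (exprn_gt0 16 l0) (l%:R ^+ h) (exprn_gt0 h l0) => x x0 y y0 z z0.
  by field; rewrite !gt_eqF.
have z0 : 0 <= (l%:R ^+ h)^-1 :> R by rewrite invr_ge0 exprn_ge0// ltW.
rewrite powRM//.
have p1 : 162 `^ e <= 162 :> R by apply: ler1_powR => //; rewrite (ler_nat R 1).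
have p2 : ((l%:R ^+ h)^-1) `^ e <= (l%:R ^+ 297)^-1 :> R.
  rewrite -powR_invn ?(ltW l0)// -powRrM -powR_invn ?(ltW l0)//.
  by apply: ler_powR => //; rewrite mulNr lerN2.
have p12 : 162 `^ e * ((l%:R ^+ h)^-1) `^ e <= 162 * (l%:R ^+ 297)^-1 :> R.
  by apply: ler_pM => //; exact: powR_ge0.
have c0 : 0 <= 3 * C + 1 by lra.
have D0 : 0 <= 4 * (9 * l%:R ^+ 53) ^+ 2 :> R by apply: mulr_ge0; rewrite ?sqr_ge0.
apply: (le_trans (ler_wpM2l c0 (ler_wpM2r D0 p12))).
rewrite [leLHS](_ : _ = (3 * C + 1) * (162 * 324) / l%:R * (l%:R ^+ 190)^-1); last first.
  rewrite (_ : l%:R ^+ 297 = l%:R ^+ 53 * l%:R ^+ 53 * (l%:R * l%:R ^+ 190) :> R); last first.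
    by rewrite -exprS -!exprD.
  move: (l%:R ^+ 53) (exprn_gt0 53 l0) (l%:R ^+ 190) (exprn_gt0 190 l0) => x x0 y y0.
  by move: (l%:R : R) l0 => u u0; field; rewrite !gt_eqF.
apply: ler_piMl; first by rewrite invr_ge0 exprn_ge0// ltW.
by rewrite ler_pdivrMr ?mul1r.
Qed.

Lemma succ_le_double (n : nat) : (0 < n)%N -> n.+1%:R <= 2 * n%:R :> R.
Proof. by move=> n0; rewrite -natrM ler_nat mul2n -addnn -addn1 leq_add2l. Qed.

Let sqr_ge1 (n : nat) : (0 < n)%N -> 1 <= n%:R ^+ 2 :> R.
Proof. by move=> n0; apply: exprn_ege1; rewrite ler1n. Qed.

Let scale_tau_of (l : R) : 1 <= l -> 5 * l ^+ 70 <= expR l ->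
  (4 * l ^+ 53 + 1) * expR (- l) <= (l ^+ 17)^-1.
Proof.
move=> l1 h; have l0 : 0 < l by lra.
rewrite expRN ler_pdivrMr ?expR_gt0// [leRHS]mulrC ler_pdivlMr ?exprn_gt0//.
apply: le_trans h; rewrite (_ : l ^+ 70 = l ^+ 53 * l ^+ 17); last by rewrite -exprD.
rewrite mulrA; apply: ler_wpM2r; first by rewrite exprn_ge0// ltW.
have : 1 <= l ^+ 53 by apply: exprn_ege1.
lra.
Qed.

Let scale_exp_of (n : nat) (x E : R) : (0 < n)%N -> n%:R ^+ 3 <= x -> 8 * x <= E ->
  4 * n%:R ^+ 2 * n.+1%:R <= E.
Proof.
move=> n0 nx xE; apply: le_trans xE; apply: (@le_trans _ _ (8 * n%:R ^+ 3)); last first.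
  exact: ler_wpM2l.
rewrite [n%:R ^+ 3]exprSr; have y1 := sqr_ge1 n0; move: (n%:R ^+ 2) y1 => y y1.
have := ler_wpM2l (le_trans ler01 y1) (succ_le_double n0).
by move: (n.+1%:R : R) (n%:R : R) => u v; lra.
Qed.

Let scale_lac_of (n : nat) (l x : R) : (0 < n)%N -> 1 <= l -> n%:R ^+ 2 <= x ->
  16 * x * l <= expR l -> n.+1%:R ^+ 2 * (l * expR (- l ^+ 2)) <= 1 / 4.
Proof.
move=> n0 l1 nx h.
rewrite expRN mulrA ler_pdivrMr ?expR_gt0//.
have ll : expR l <= expR (l ^+ 2) by rewrite ler_expR -[leLHS]expr1; apply: ler_weXn2l.
have l0 : 0 <= l by lra.
have h1 : n.+1%:R ^+ 2 <= 4 * x.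
  apply: (@le_trans _ _ ((2 * n%:R) ^+ 2)).
    by apply: lerXn2r; rewrite ?nnegrE//; exact: succ_le_double.
  by rewrite exprMn; move: (n%:R ^+ 2) nx => y; lra.
have := ler_wpM2r l0 h1; move: (n.+1%:R ^+ 2 * l) => y.
lra.
Qed.

Let scale_spread_of (n l : nat) (q x : R) : (0 < n)%N -> 0 < q -> q <= 1 -> n%:R ^+ 3 <= x ->
  x <= expR (q / 2 * l%:R) -> (1 - q / 2) ^+ l <= n%:R ^- 3.
Proof.
move=> n0 q0 q1 nx h.
have h1 : 1 - q / 2 <= expR (- (q / 2)) by have := expR_ge1Dx (- (q / 2)); lra.
apply: (@le_trans _ _ (expR (- (q / 2)) ^+ l)).
  by apply: lerXn2r; rewrite ?nnegrE ?expR_ge0//; lra.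
rewrite -expRM_natl mulrN [l%:R * _]mulrC expRN lef_pV2 ?posrE ?expR_gt0 ?exprn_gt0 ?ltr0n//.
exact: le_trans h.
Qed.

Let scale_q_of (n : nat) (q : R) : 0 < q -> 2 / q <= n%:R -> 1 / n.+1%:R ^+ 4 <= q / 2.
Proof.
move=> q0 h; have N1 : 1 <= n.+1%:R :> R by rewrite ler1n.
rewrite ler_pdivrMr; last by apply: exprn_gt0; lra.
have N4 : n.+1%:R <= n.+1%:R ^+ 4 :> R by rewrite -[leLHS]expr1; apply: ler_weXn2l.
have : 2 / q <= n.+1%:R ^+ 4 :> R.
  by apply: le_trans N4; apply: (le_trans h); rewrite ler_nat.
by rewrite ler_pdivrMr//; lra.
Qed.

Let scale_gh_of (l : R) (g : nat) : 10000 <= l -> (4 <= g)%N -> 32 * l ^+ 2 <= l ^+ g.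
Proof.
move=> h g4; apply: (@le_trans _ _ (l ^+ 4)); last by apply: ler_weXn2l => //; lra.
rewrite (_ : l ^+ 4 = l ^+ 2 * l ^+ 2); last by rewrite -exprD.
apply: ler_wpM2r; first exact: sqr_ge0.
by rewrite expr2; nra.
Qed.

(** The scale is tied to the degree by [l ^ B <= n < (l + 1) ^ B], so every
    requirement compares powers of [l] with each other or with exponentials. *)
Lemma scale_eventually (e C q : R) (h : nat) : 0 < e -> e <= 1 -> 0 <= C -> 0 < q -> q <= 1 ->
  297 <= h%:R * e -> let gh := (69 + h)%N in let B := (8 * gh + 4)%N in
  exists l0 : nat, forall l n, (l0 <= l)%N -> (l ^ B <= n < l.+1 ^ B)%N ->
    scale_ok n e C q l gh /\ l%:R ^+ (4 * gh + 2) <= Num.sqrt n%:R :> R.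
Proof.
move=> e0 e1 C0 q0 q1 he gh B.
have B17 : (17 <= B)%N by rewrite /B /gh mulnDr -addnA (leq_trans _ (leq_addr _ _)).
have g4 : (4 <= 2 * gh)%N by rewrite /gh mulnDr (leq_trans _ (leq_addr _ _)).
have BE : B = ((4 * gh + 2) * 2)%N by rewrite /B mulnDl mulnAC.
have q20 : 0 < q / 2 by lra.
suff : \forall l \near \oo, forall n, (l ^ B <= n < l.+1 ^ B)%N ->
    scale_ok n e C q l gh /\ l%:R ^+ (4 * gh + 2) <= Num.sqrt n%:R :> R.
  by move=> [l0 _ hl]; exists l0 => l n ll; exact: hl.
have big : 1 <= 10000 :> R by lra.
near=> l => n /andP[n1 n2].
have E1 : 10000 <= l%:R :> R by near: l; exact: nbhs_infty_ger.
have l1 : 1 <= l%:R :> R by exact: le_trans E1.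
have l0 : 0 < l%:R :> R by exact: lt_le_trans ltr01 l1.
have E2 : (3 * C + 1) * (162 * 324) <= l%:R by near: l; exact: nbhs_infty_ger.
have E3 : 5 * l%:R ^+ 70 <= expR (1 * l%:R) :> R by near: l; exact: exp_dominates.
have E4 : (8 * 2 ^+ (3 * B)) * l%:R ^+ (3 * B) <= expR (1 * l%:R) :> R by near: l; exact: exp_dominates.
have E5 : (16 * 2 ^+ (2 * B)) * l%:R ^+ (2 * B).+1 <= expR (1 * l%:R) :> R by near: l; exact: exp_dominates.
have E6 : 2 ^+ (3 * B) * l%:R ^+ (3 * B) <= expR (q / 2 * l%:R) :> R by near: l; exact: exp_dominates.
have E7 : 2 / q <= l%:R by near: l; exact: nbhs_infty_ger.
rewrite mul1r in E3 E4 E5; rewrite -mulrA in E4; rewrite [_ ^+ (2 * B).+1]exprSr mulrA -[16 * _ * _]mulrA in E5.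
have nlow : l%:R ^+ B <= n%:R :> R by rewrite -natrX ler_nat.
have lS : (0 < l)%N by rewrite -(ltr0n R).
have nup : n%:R <= (2 * l%:R) ^+ B :> R.
  apply: (@le_trans _ _ (l.+1%:R ^+ B)); first by rewrite -natrX ler_nat ltnW.
  by apply: lerXn2r; [rewrite nnegrE ler0n|rewrite nnegrE mulr_ge0// ltW|exact: succ_le_double].
have n17 : l%:R ^+ 17 <= n%:R :> R by apply: le_trans nlow; exact: ler_weXn2l.
have nl : l%:R <= n%:R :> R by apply: le_trans n17; rewrite -[leLHS]expr1; exact: ler_weXn2l.
have n0 : (0 < n)%N by rewrite -(ler1n R); exact: le_trans nl.
have npow (m : nat) : n%:R ^+ m <= 2 ^+ (m * B) * l%:R ^+ (m * B) :> R.
  rewrite -exprMn mulnC exprM; apply: lerXn2r => //; rewrite nnegrE ?ler0n// exprn_ge0// mulr_ge0// ltW//.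
split; last first.
  have p0 : 0 <= l%:R ^+ (4 * gh + 2) :> R by apply: exprn_ge0; exact: ltW.
  rewrite -[leLHS]ger0_norm// -sqrtr_sqr ler_wsqrtr// -exprM -BE.
  exact: nlow.
constructor.
- exact: E1.
- exact: (clt_error_small e0 e1 C0 he l1 E2).
- exact: (scale_tau_of l1 E3).
- exact: (scale_exp_of n0 (npow 3) E4).
- exact: (scale_lac_of n0 l1 (npow 2) E5).
- exact: (scale_spread_of n0 q0 q1 (npow 3) E6).
- exact: (scale_q_of q0 (le_trans E7 nl)).
- exact: n17.
- exact: (scale_gh_of E1 g4).
Unshelve. all: by end_near. Qed.

End scales.

(** * The main estimate *)

Lemma nat_root (B n : nat) : (0 < B)%N -> exists l, (l ^ B <= n < l.+1 ^ B)%N.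
Proof.
move=> B0; pose p l := (l ^ B <= n)%N.
have ex : exists l, p l by exists 0%N; rewrite /p exp0n.
have ub l : p l -> (l <= n)%N.
  rewrite /p; case: l => // l; apply: leq_trans.
  by rewrite -[X in (X <= _)%N]expn1 leq_pexp2l.
case: (ex_maxnP ex ub) => l pl lmax; exists l; rewrite -/(p l) pl /= ltnNge.
by apply/negP => /lmax; rewrite ltnn.
Qed.

(** The spread in [normalized_spread] depends on the law only through the
    moment bound. *)
Lemma uniform_spread (R : realType) (e C : R) : 0 < e -> 1 <= C ->
  exists q : R, [/\ 0 < q, q <= 1 & forall (d : measure_display) (T : measurableType d)
    (P : probability T R) (Y : T -> R) (y : R), normalized e P C Y ->
    Pr P [set w | `|Y w - y| <= 1 / 2] <= 1 - q].
Proof.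
move=> e0 C1; pose A := (8 * C) `^ (e^-1).
have C8 : 1 <= 8 * C by lra.
have A1 : 1 <= A by rewrite -[leLHS](powRr0 (8 * C)); apply: ler_powR; rewrite ?invr_ge0// ltW.
have Ae : A `^ e = 8 * C by rewrite /A -powRrM mulVf ?gt_eqF// powRr1//; lra.
have A2 : 1 <= A ^+ 2 by apply: exprn_ege1.
have qi : 1 / (8 * A ^+ 2) <= 1 / 8 by rewrite ler_pdivrMr; lra.
have q0 : 0 < 1 / (8 * A ^+ 2) by apply: divr_gt0 => //; lra.
exists (1 / (8 * A ^+ 2)); split => //; first by lra.
move=> d T P Y y nY; apply: (@normalized_spread _ _ _ _ e C A) => //; try lra.
  by rewrite -[leLHS]mulrC [leLHS](_ : _ = 1 / 8)//; field; rewrite gt_eqF//; lra.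
Qed.

Lemma root_error_le (R : realType) (n l B : nat) : (0 < n)%N -> (0 < l)%N -> (0 < B)%N ->
  (n < l.+1 ^ B)%N ->
  Num.sqrt n%:R / l%:R <= 2 * n%:R `^ (1 / 2 - B%:R^-1) :> R.
Proof.
move=> n0 l0 B0 nl; have nz : n%:R != 0 :> R by rewrite pnatr_eq0 -lt0n.
have l0' : 0 < l%:R :> R by rewrite ltr0n.
have Bz : B%:R != 0 :> R by rewrite pnatr_eq0 -lt0n.
rewrite powRB; last by apply/implyP.
rewrite div1r powR12_sqrt//.
have p0 : 0 < n%:R `^ B%:R^-1 :> R by rewrite powR_gt0// ltr0n.
have h : n%:R `^ B%:R^-1 <= 2 * l%:R :> R.
  apply: (@le_trans _ _ ((l.+1%:R ^+ B) `^ B%:R^-1)).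
    by apply: ge0_ler_powR; rewrite ?invr_ge0 ?nnegrE ?exprn_ge0// -natrX ler_nat ltnW.
  rewrite -powR_mulrn// -powRrM mulfV// powRr1//.
  by rewrite -natrM ler_nat mul2n -addnn -addn1 leq_add2l.
rewrite mulrCA; apply: ler_wpM2l; first exact: sqrtr_ge0.
by rewrite ler_pdivlMr// mulrC ler_pdivrMr.
Qed.

Lemma interval_trivial (R : realType) (n : nat) (n0 : (0 < n)%N) (d : measure_display)
    (T : measurableType d) (P : probability T R) (X : 'I_n.+1 -> {RV P >-> R}) (I : interval R) :
  exists m s : R,
  [/\ (\int[P]_w (elliptic_zero_count (fun j => X j w) (on_real_axis [set` I]))%:R%:E = m%:E)%E,
      (\int[@lebesgue_measure R]_(x in [set` I]) (root_density n x)%:E = s%:E)%E &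
      `|m - s| <= n%:R].
Proof.
have d1 w : 0 <= (0 : R) <= (elliptic_zero_count (fun j => X j w) (on_real_axis [set` I]))%:R.
  by rewrite lexx /=.
have d2 w : (elliptic_zero_count (fun j => X j w) (on_real_axis [set` I]))%:R <= n%:R :> R.
  by rewrite ler_nat; exact: (roots_in_le (fun j => X j w) (fun x => x \in I)).
have [m [hm m1 m2]] := integral_sandwich (summable_cst P 0) (summable_cst P n%:R) d1 d2.
rewrite !Ex_cst in m1 m2.
have f0 (x : R) : (0 <= (root_density n x)%:E)%E by rewrite lee_fin root_density_ge0.
have up : (\int[@lebesgue_measure R]_(x in [set` I]) (root_density n x)%:E <= (Num.sqrt n%:R)%:E)%E.
  rewrite -(integralT_root_density R n0); apply: ge0_subset_integral => //.
  exact: measurable_root_density.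
have lo : (0 <= \int[@lebesgue_measure R]_(x in [set` I]) (root_density n x)%:E)%E.
  by apply: integral_ge0.
move: up lo; case E : (integral _ _ _) => [s||]; rewrite ?leey_eq ?leeNy_eq// !lee_fin => up lo.
exists m, s; split => //.
have sn : Num.sqrt n%:R <= n%:R :> R.
  have n1 : 1 <= n%:R :> R by rewrite ler1n.
  rewrite -[leRHS]ger0_norm// -sqrtr_sqr ler_wsqrtr// expr2; nra.
by rewrite ler_norml; apply/andP; split; lra.
Qed.

(** The exponent is [c = 1 / B] for the power [B] of [scale_eventually], which
    depends on [e] only. Degrees below the threshold scale satisfy the trivial
    bound [n], which the constant absorbs. *)
Lemma expected_real_roots (R : realType) (eps : R) : 0 < eps ->
  exists c : R, 0 < c /\ forall C : R, 0 < C -> exists K : R,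
  forall n : nat, (0 < n)%N ->
  forall (d0 : measure_display) (T0 : measurableType d0)
    (P0 : probability T0 R) (xi : {RV P0 >-> R}),
  ('E_P0[xi] = 0)%E -> ('V_P0[xi] = 1)%E ->
  ('E_P0[fun w => (`|xi w| `^ (2 + eps))%R] <= C%:E)%E ->
  forall (d : measure_display) (T : measurableType d)
    (P : probability T R) (X : 'I_n.+1 -> {RV P >-> R}),
  independent_copies xi X -> forall I : interval R,
  exists m s : R,
  [/\ (\int[P]_w (elliptic_zero_count (fun j => X j w) (on_real_axis [set` I]))%:R%:E = m%:E)%E,
      (\int[@lebesgue_measure R]_(x in [set` I]) (root_density n x)%:E = s%:E)%E &
      `|m - s| <= K * n%:R `^ (1 / 2 - c)].
Proof.
move=> heps; pose e := Num.min eps 1.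
have e0 : 0 < e by rewrite lt_min heps /=.
have e1 : e <= 1 by rewrite ge_min lexx orbT.
have ee : e <= eps by rewrite ge_min lexx.
pose h := (Num.truncn (297 / e)).+1.
have he : 297 <= h%:R * e.
  have h0 : 0 <= 297 / e by apply: divr_ge0; [exact: ler0n|exact: ltW].
  by have /andP[_ h1] := truncn_itv h0; rewrite -ler_pdivrMr// ltW.
pose gh := (69 + h)%N; pose B := (8 * gh + 4)%N.
have B0 : (0 < B)%N by rewrite /B addn_gt0 orbT.
have B2 : (2 <= B)%N by rewrite /B (leq_trans _ (leq_addl _ _)).
have BR : 0 < B%:R :> R by rewrite ltr0n.
exists (B%:R^-1); split; first by rewrite invr_gt0.
move=> C C0; have C1 : 1 <= 1 + C by lra.
have [q [q0 q1 hq]] := uniform_spread e0 C1.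
have C1' : 0 <= 1 + C by lra.
have [l0 hl0] := scale_eventually e0 e1 C1' q0 q1 he.
exists (2 * (200 * 1000) * 2 + (l0.+1 ^ B)%:R).
move=> n n0 d0 T0 P0 xi hE hV hM d T P X [hX hlaw] I.
have nX j : normalized e P (1 + C) (X j).
  by apply: (normalized_copy (hlaw j)); exact: (normalized_of_moments e0 ee hE hV hM).
have [l /andP[ln1 ln2]] := nat_root n B0.
have small : (l <= l0)%N -> (n <= l0.+1 ^ B)%N.
  by move=> ll; apply: (leq_trans (ltnW ln2)); rewrite leq_exp2r.
move: (l0.+1 ^ B)%N small => N0 small.
have n1 : 1 <= n%:R :> R by rewrite ler1n.
have pw1 : 1 <= n%:R `^ (1 / 2 - B%:R^-1) :> R.
  rewrite -[leLHS](powRr0 n%:R); apply: ler_powR => //.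
  have : B%:R^-1 <= 2^-1 :> R by rewrite lef_pV2 ?posrE// (ler_nat R 2).
  lra.
set pw := n%:R `^ _ in pw1 *.
case: (ltnP l0 l) => ll.
  have lpos : (0 < l)%N by exact: leq_trans ll.
  have lnB : (l ^ B <= n < l.+1 ^ B)%N by rewrite ln1.
  have [ok hB] := hl0 l n (ltnW ll) lnB.
  have [m [s [hm hs ms]]] := interval_estimate n0 e0 e1 C1' hX nX
     (fun j y => hq _ _ _ _ y (nX j)) q0 q1 ok hB I.
  exists m, s; split => //; apply: (le_trans ms).
  have := @root_error_le R n l B n0 lpos B0 ln2; rewrite -/pw /root_error.
  have : 0 <= N0%:R * pw := mulr_ge0 (ler0n _ _) (le_trans ler01 pw1).
  by rewrite [(_ + N0%:R) * pw]mulrDl; move: (Num.sqrt n%:R / l%:R) (N0%:R * pw) => u v; lra.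
have [m [s [hm hs ms]]] := interval_trivial n0 X I.
exists m, s; split => //; apply: (le_trans ms).
have nl : n%:R <= N0%:R :> R by rewrite ler_nat; exact: small.
apply: (le_trans nl); rewrite -[leLHS]mulr1; apply: ler_pM => //.
rewrite lerDr; exact: mulr_ge0 (mulr_ge0 (ler0n _ 2) (mulr_ge0 (ler0n _ 200) (ler0n _ 1000))) (ler0n _ 2).
Qed.

Theorem theorem5p6 (R : realType) (eps : R) (heps : 0 < eps) :
  exists c : R, 0 < c /\
  forall C : R, 0 < C ->
  exists K : R,
  forall n : nat, (0 < n)%N ->
  forall (d0 : measure_display) (T0 : measurableType d0)
    (P0 : probability T0 R) (xi : {RV P0 >-> R}),
  ('E_P0[xi] = 0)%E ->
  ('V_P0[xi] = 1)%E ->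
  ('E_P0[fun w => (`|xi w| `^ (2 + eps))%R] <= C%:E)%E ->
  forall (d : measure_display) (T : measurableType d)
    (P : probability T R) (X : 'I_n.+1 -> {RV P >-> R}),
  independent_copies xi X ->
  let N (Omega : set R[i]) (w : T) : R :=
    (elliptic_zero_count (fun j => X j w) Omega)%:R in
  (`|'E_P[N (on_real_axis [set: R])] - (Num.sqrt n%:R)%:E|
     <= (K * n%:R `^ (1 / 2 - c))%:E)%E /\
  (forall I : interval R,
   `|'E_P[N (on_real_axis [set` I])]
       - \int[lebesgue_measure]_(x in [set` I])
           (pi^-1 * (1 / (1 + x ^+ 2 / n%:R)))%:E|
     <= (K * n%:R `^ (1 / 2 - c))%:E)%E.
Proof.
have [c [c0 hc]] := expected_real_roots heps.
exists c; split => // C C0; have [K hK] := hc C C0; exists K.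
move=> n n0 d0 T0 P0 xi hE hV hM d T P X hX N.
have est := hK n n0 d0 T0 P0 xi hE hV hM d T P X hX.
split => [|I].
  have [m [s [hm hs ms]]] := est `]-oo, +oo[.
  rewrite set_itvNyy integralT_root_density// in hm hs.
  by rewrite expectation.unlock hm hs lee_fin.
have [m [s [hm hs ms]]] := est I.
by rewrite expectation.unlock hm hs lee_fin.
Qed.
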